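(* Let $k \geq 0$ be a fixed integer, let $\{a_j\}_{j \in \mathbb{Z}}$ be a sequence of complex numbers, and let $A$ be the $n \times n$ Toeplitz matrix with symbol $\{a_j\}_{j \in \mathbb{Z}}$ truncated at $k$. Define $f: S^1 \to \mathbb{C}$ by $f(\omega) = \sum_{|j| \leq k} a_j \omega^j$, and let $\omega_n=\exp(2\pi\sqrt{-1}/n)$. Assume that there exist $\varepsilon_0 > 0$ and $c_0 \geq 1$ so that, for any $0 < \varepsilon' \leq \varepsilon_0$, \[ \sup_{z \in \mathbb{C}}\left| \left\{ 0 \leq j \leq n-1 : f(\omega_n^j) \in \mathfrak{R}(z, n^{-\varepsilon'}, n^{-c_0 \varepsilon'})\cup \mathfrak{R}(z, n^{-c_0 \varepsilon'}, n^{-\varepsilon'}) \right\} \right| = O_{\varepsilon'} (n^{1 - 3\varepsilon'}). \tag{a} \] Let $\gamma, \delta > 0$, and let $E$ be an $n \times n$ random matrix so that (i) there exist $M > 0$ and $\alpha \geq 0$ so that $\|E\| \leq M n^{\alpha}$ with probability $1 - O(n^{-\delta})$; (ii) there exists $\kappa > 0$ so that \[ \sup_{z \in \mathbb{C}, |z| \leq \beta} \mathbb{P}( \sigma_{\min}(A + n^{-\alpha - \gamma} E - z I) \leq n^{-\kappa}) = O ( n^{-\delta} ) \] for $\beta := \sqrt{2} \left( \sum_{|j| \leq k} |a_j| + M + 1 \right)$. Then, for any $p \geq 1$, there exist $C, \varepsilon > 0$ (depending on $p$, $k$, $f$, $\{a_j\}_{|j| \leq k}$, $\varepsilon_0$,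 $c_0$, $\gamma$, $\delta$, and the constants from assumptions (i), (ii), and (a)) so that \[ \min_{\sigma} \left( \frac{1}{n} \sum_{j=1}^n \left| \lambda_j(A + n^{-\gamma - \alpha} E) - f \left(\omega_n^{\sigma(j)} \right) \right|^p \right)^{1/p} \leq Cn^{-\varepsilon} \] with probability $1 - o(1)$, where the minimum is over all permutations $\sigma$ of $\{1,\dots,n\}$. In addition, there exist $C, \varepsilon > 0$ (depending on $k$, $f$, $\{a_j\}_{|j| \leq k}$, $\varepsilon_0$, $c_0$, $\gamma$, $\delta$, and the constants from assumptions (i), (ii), and (a)) so that \[ W_1( \mu_{A + n^{-\gamma - \alpha}E}, \mu) \leq C n^{-\varepsilon} \] with probability $1-o(1)$, where $\mu$ is the distribution of $f(U)$ and $U$ is a random variable uniformly distributed on $S^1$.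
   Context: $S^1=\{z\in\mathbb{C}:|z|=1\}$. The $n\times n$ Toeplitz matrix with symbol $\{a_j\}_{j\in\mathbb{Z}}$ truncated at $k$ is $A=(A_{ij})_{i,j=1}^n$ with $A_{ij}=a_{i-j}$ if $|i-j|\le k$ and $A_{ij}=0$ otherwise. Sums over $|j|\le k$ are over integers $j$. For $z\in\mathbb{C}$ and $r_1,r_2>0$, $\mathfrak{R}(z,r_1,r_2)=\{w\in\mathbb{C}:|\operatorname{Re}(w)-\operatorname{Re}(z)|\le r_1,\ |\operatorname{Im}(w)-\operatorname{Im}(z)|\le r_2\}$. For a finite set $S$, $|S|$ is its cardinality. $\|\cdot\|$ is the spectral norm, $\sigma_{\min}$ the smallest singular value, $I$ the identity matrix. $\lambda_1(M),\dots,\lambda_n(M)$ are the eigenvalues of $M$ counted with algebraic multiplicity (in a fixed order) and $\mu_M=\frac1n\sum_{j=1}^n\delta_{\lambda_j(M)}$. $W_1(\mu,\nu)=\inf_\pi\int|x-y|\,d\pi(x,y)$, the infimum over all probability measures $\pi$ on $\mathbb{C}\times\mathbb{C}$ with marginals $\mu$ and $\nu$. Asymptotic notation is as $n\to\infty$: $X=O(Y)$ means $|X|\le CY$ for a constant $C>0$ independent of $n$ and all $n\ge C$, with subscripts indicating parameters on which $C$ may depend. *)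

(* Defs.v *)
(* MathComp / MathComp-Analysis; the complex numbers are R[i] for R : realType. *)
From HB Require Import structures.
From mathcomp Require Import all_boot all_order all_algebra all_fingroup.
From mathcomp Require Import sesquilinear spectral.
From mathcomp Require Import complex.
From mathcomp Require Import all_classical all_reals all_analysis.
From mathcomp Require Import measurable_realfun.
Set Implicit Arguments.
Unset Strict Implicit.
Unset Printing Implicit Defensive.
Import Order.TTheory GRing.Theory Num.Theory.
Import numFieldNormedType.Exports.
Local Open Scope classical_set_scope.
Local Open Scope complex_scope.
Local Open Scope ring_scope.

(* The library norm `|z| takes values in R[i]; this modulus is in R. *)
Definition cabs (R : realType) (z : R[i]) : R := Normc.normc z.

(* exp(sqrt(-1) t) *)
Definition expi (R : realType) (t : R) : R[i] := cos t +i* sin t.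

Definition omega (R : realType) (n : nat) : R[i] := expi (2 * pi / n%:R).

(* The sums over |j| <= k are indexed by i < 2k+1, with j = i - k. *)
Definition symbol_fun (R : realType) (k : nat) (a : int -> R[i]) (w : R[i]) :
  R[i] :=
  \sum_(i < k.*2.+1) a (i%:Z - k%:Z) * w ^ (i%:Z - k%:Z).

Definition symbol_l1 (R : realType) (k : nat) (a : int -> R[i]) : R :=
  \sum_(i < k.*2.+1) cabs (a (i%:Z - k%:Z)).

Definition toeplitz_mx (R : realType) (k : nat) (a : int -> R[i]) (n : nat) :
  'M[R[i]]_n :=
  \matrix_(i, j) if (`|i%:Z - j%:Z| <= k%:Z) then a (i%:Z - j%:Z) else 0.

Definition rect (R : realType) (z : R[i]) (r1 r2 : R) : set R[i] :=
  [set w | `|complex.Re w - complex.Re z| <= r1 /\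
           `|complex.Im w - complex.Im z| <= r2].

(* The number of 0 <= j <= n-1 with f(omega_n^j) in
   R(z, n^-e, n^-(c e)) U R(z, n^-(c e), n^-e). *)
Definition rect_count (R : realType) (f : R[i] -> R[i]) (c e : R) (n : nat)
  (z : R[i]) : nat :=
  #|[pred j : 'I_n | f (omega R n ^+ j) \in
       rect z (n%:R `^ (- e)) (n%:R `^ (- (c * e))) `|`
       rect z (n%:R `^ (- (c * e))) (n%:R `^ (- e))]|.

(* The roots of the characteristic polynomial, with multiplicity, in a chosen
   order. *)
Definition eigvals (R : realType) (n : nat) (A : 'M[R[i]]_n) : seq R[i] :=
  sval (closed_field_poly_normal (char_poly A)).

Lemma char_poly_eigvals (R : realType) (n : nat) (A : 'M[R[i]]_n) :
  char_poly A = \prod_(z <- eigvals A) ('X - z%:P).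
Proof.
rewrite /eigvals; case: closed_field_poly_normal => s /= {1}->.
by rewrite (eqP (char_poly_monic A)) scale1r.
Qed.

Lemma size_eigvals (R : realType) (n : nat) (A : 'M[R[i]]_n) :
  size (eigvals A) = n.
Proof.
have := size_char_poly A.
by rewrite char_poly_eigvals size_prod_XsubC => -[].
Qed.

Definition eigval (R : realType) (n : nat) (A : 'M[R[i]]_n) (j : nat) : R[i] :=
  (eigvals A)`_j.

Definition l2norm (R : realType) (n : nat) (v : 'cV[R[i]]_n) : R :=
  Num.sqrt (\sum_i cabs (v i 0) ^+ 2).

Definition spectral_norm (R : realType) (n : nat) (A : 'M[R[i]]_n) : R :=
  sup [set l2norm (A *m v) | v in [set v : 'cV[R[i]]_n | l2norm v <= 1]].

Definition singular_values (R : realType) (n : nat) (A : 'M[R[i]]_n) : seq R :=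
  [seq Num.sqrt (complex.Re z) | z <- eigvals ((A ^t* )%sesqui *m A)].

(* The minimum of the (nonempty, for 0 < n) list of singular values. *)
Definition sigma_min (R : realType) (n : nat) (A : 'M[R[i]]_n) : R :=
  let s := singular_values A in \big[Num.min/head 0 s]_(x <- s) x.

(* X = O(Y) with explicit constant K. *)
Definition bigO_with (R : realType) (K : R) (X : nat -> \bar R) (Y : nat -> R) :
  Prop :=
  0 < K /\ forall n : nat, K <= n%:R -> (`|X n| <= (K * Y n)%:E)%E.

(* "A holds with probability at least q". For measurable A this is q <= P A;
   the sub-event B gives a meaning to it without the measurability of A, since
   P is unconstrained on non-measurable sets. *)
Definition with_prob_ge (R : realType) (d : measure_display)
  (T : measurableType d) (P : probability T R) (A : set T) (q : R) : Prop :=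
  exists B : set T, [/\ measurable B, B `<=` A & (q%:E <= P B)%E].

(* One random n x n matrix for every n, each on its own probability space. *)
Record random_matrices (R : realType) := RandomMatrices {
  rm_disp : nat -> measure_display ;
  rm_space : forall n, measurableType (rm_disp n) ;
  rm_prob : forall n, probability (rm_space n) R ;
  rm_mx : forall n, rm_space n -> 'M[R[i]]_n ;
  rm_meas : forall n (i j : 'I_n),
    measurable_fun setT (fun t => complex.Re (rm_mx t i j)) /\
    measurable_fun setT (fun t => complex.Im (rm_mx t i j)) }.

(* "with probability 1 - O(n^-del)", with explicit constant K *)
Definition with_prob_1_bigO (R : realType) (E : random_matrices R)
  (K del : R) (A : forall n, set (rm_space E n)) : Prop :=
  0 < K /\ forall n : nat, K <= n%:R ->
    with_prob_ge (rm_prob E n) (A n) (1 - K * n%:R `^ (- del)).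

(* "with probability 1 - o(1)" *)
Definition with_prob_1_o1 (R : realType) (E : random_matrices R)
  (A : forall n, set (rm_space E n)) : Prop :=
  exists q : nat -> R, q n @[n --> \oo] --> 0 /\
    \forall n \near \oo, with_prob_ge (rm_prob E n) (A n) (1 - q n).

Definition perturbed (R : realType) (k : nat) (a : int -> R[i]) (alp gam : R)
  (E : random_matrices R) (n : nat) (t : rm_space E n) : 'M[R[i]]_n :=
  toeplitz_mx k a n + (n%:R `^ (- alp - gam))%:C *: rm_mx t.

(* (n^-1 sum_(j = 1 .. n) |lambda_j(A) - f(omega_n^(s j))|^p)^(1/p); the
   index j : 'I_n stands for j + 1. *)
Definition matching_cost (R : realType) (p : R) (f : R[i] -> R[i]) (n : nat)
  (A : 'M[R[i]]_n) (s : 'S_n) : R :=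
  (n%:R^-1 * \sum_(j < n)
     cabs (eigval A j - f (omega R n ^+ (s j).+1)) `^ p) `^ p^-1.

Definition min_matching_cost (R : realType) (p : R) (f : R[i] -> R[i])
  (n : nat) (A : 'M[R[i]]_n) : R :=
  \big[Num.min/matching_cost p f A 1%g]_(s : 'S_n) matching_cost p f A s.

(* The measurable space C is R * R with its product sigma-algebra. *)
Definition to_plane (R : realType) (z : R[i]) : R * R :=
  (complex.Re z, complex.Im z).
Definition of_plane (R : realType) (x : R * R) : R[i] := x.1 +i* x.2.

Definition empirical_measure (R : realType) (n : nat) (A : 'M[R[i]]_n) :
  {measure set (R * R) -> \bar R} :=
  mscale (n%:R^-1)%:nng (msum (fun j => \d_(to_plane (eigval A j))) n).

Definition coupling (R : realType) (mu nu : {measure set (R * R) -> \bar R})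
  (Q : probability ((R * R) * (R * R))%type R) : Prop :=
  forall B : set (R * R), measurable B ->
    Q (B `*` setT) = mu B /\ Q (setT `*` B) = nu B.

Definition W1 (R : realType) (mu nu : {measure set (R * R) -> \bar R}) :
  \bar R :=
  ereal_inf [set (\int[Q]_x (cabs (of_plane x.1 - of_plane x.2))%:E)%E
             | Q in [set Q | coupling mu nu Q]].

Definition cmeasurable (R : realType) (g : R -> R[i]) : Prop :=
  measurable_fun setT (fun t => complex.Re (g t)) /\
  measurable_fun setT (fun t => complex.Im (g t)).

Lemma cmeasurable_cst (R : realType) (c : R[i]) :
  cmeasurable (fun _ : R => c).
Proof. by split; exact: measurable_cst. Qed.

Lemma cmeasurableD (R : realType) (g h : R -> R[i]) :
  cmeasurable g -> cmeasurable h -> cmeasurable (fun t => g t + h t).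
Proof.
move=> [gr gi] [hr hi]; split.
  by under eq_fun do rewrite raddfD; exact: measurable_funD.
by under eq_fun do rewrite raddfD; exact: measurable_funD.
Qed.

Lemma cmeasurableM (R : realType) (g h : R -> R[i]) :
  cmeasurable g -> cmeasurable h -> cmeasurable (fun t => g t * h t).
Proof.
move=> [gr gi] [hr hi]; split.
  rewrite (_ : (fun t => _) = (fun t =>
     complex.Re (g t) * complex.Re (h t) -
     complex.Im (g t) * complex.Im (h t))); last first.
    by apply/funext => t; case: (g t) (h t) => [? ?] [? ?].
  by apply: measurable_funB; exact: measurable_funM.
rewrite (_ : (fun t => _) = (fun t =>
   complex.Re (g t) * complex.Im (h t) +
   complex.Im (g t) * complex.Re (h t))); last first.
  by apply/funext => t; case: (g t) (h t) => [? ?] [? ?].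
by apply: measurable_funD; exact: measurable_funM.
Qed.

Lemma cmeasurableX (R : realType) (g : R -> R[i]) (n : nat) :
  cmeasurable g -> cmeasurable (fun t => g t ^+ n).
Proof.
move=> mg; elim: n => [|n IH]; first exact: cmeasurable_cst.
by under eq_fun do rewrite exprS; exact: cmeasurableM.
Qed.

Lemma cmeasurable_sum (R : realType) (n : nat) (g : 'I_n -> R -> R[i]) :
  (forall i, cmeasurable (g i)) -> cmeasurable (fun t => \sum_(i < n) g i t).
Proof.
move=> mg; elim: n g mg => [|n IH] g mg.
  by under eq_fun do rewrite big_ord0; exact: cmeasurable_cst.
under eq_fun do rewrite big_ord_recl.
by apply: cmeasurableD => //; apply: IH.
Qed.

Lemma expiV (R : realType) (t : R) : (expi t)^-1 = expi (- t).
Proof.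
have e1 : expi t * expi (- t) = 1.
  rewrite /expi cosN sinN; apply/eqP; rewrite eq_complex /=.
  by rewrite !mulrN opprK -!expr2 cos2Dsin2 mulrC addNr !eqxx.
have e0 : expi t != 0.
  by apply: contra_eq_neq e1 => ->; rewrite mul0r eq_sym oner_neq0.
by apply: (mulfI e0); rewrite e1 mulfV.
Qed.

Lemma cmeasurable_expi (R : realType) (h : R -> R) :
  measurable_fun setT h -> cmeasurable (fun t => expi (h t)).
Proof.
move=> mh; split=> /=.
  by apply: (measurableT_comp (f := cos)) => //;
     apply: continuous_measurable_fun; exact: continuous_cos.
by apply: (measurableT_comp (f := sin)) => //;
   apply: continuous_measurable_fun; exact: continuous_sin.
Qed.

(* f(U), where U = exp(2 pi sqrt(-1) t) is uniform on the unit circle when t is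
   uniform on [0, 1]. *)
Definition symbol_circle (R : realType) (k : nat) (a : int -> R[i])
  (t : measurableTypeR R) : R * R :=
  to_plane (symbol_fun k a (expi (2 * pi * t))).

Lemma measurable_symbol_circle (R : realType) (k : nat) (a : int -> R[i]) :
  measurable_fun setT (symbol_circle k a).
Proof.
have mL : measurable_fun setT (fun t : R => 2 * pi * t).
  exact: measurable_funM.
suff [mr mi] : cmeasurable
    (fun t : R => symbol_fun k a (expi (2 * pi * t))).
  exact: measurable_fun_pair.
apply: cmeasurable_sum => i; apply: cmeasurableM; first exact: cmeasurable_cst.
case: (_ - _) => m; first by apply: cmeasurableX; exact: cmeasurable_expi.
rewrite /exprz; under eq_fun do rewrite -exprVn expiV.
by apply/cmeasurableX/cmeasurable_expi; exact: measurableT_comp.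
Qed.

HB.instance Definition _ (R : realType) (k : nat) (a : int -> R[i]) :=
  isMeasurableFun.Build _ _ _ _ (symbol_circle k a)
    (@measurable_symbol_circle R k a).

Definition symbol_law (R : realType) (k : nat) (a : int -> R[i]) :
  probability (R * R)%type R :=
  distribution (uniform_prob (@ltr01 R)) (symbol_circle k a).

(* Main.v *)
(* The symbol samples f(omega_n^j) are the eigenvalues of a circulant matrix that
   differs from A by a matrix of rank at most 2k. Let lambda_j be the eigenvalues
   of A + N, where N is the scaled noise. When sigma_min(A + N - z) is not too
   small, log |det(A + N - z)| is within o(n) of sum_j log max(|f(omega_n^j) - z|, eta),
   because replacing the few circulant eigenvalues within eta of z is a further low
   rank change and because a determinant det(1 + X) with X of rank r is at most
   (1 + |X|)^r. Thus the logarithmic potentials of the two spectra agree at the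
   polynomially many sample points for which assumption (ii) is used in a union bound.

   The average of log |x - z| over equispaced points of a circle is explicit, since
   the product of x - rho u over the m-th roots of unity u is x^m - rho^m; averaging
   also over several radii handles the x close to a circle. The differences of these
   averages for radii 2r and r are Lipschitz bumps supported in a disc, whose sums over
   the two spectra therefore agree. Adding up the bumps centred in one cell of a mesh
   bounds from below the number of lambda_j in this cell by the number of f(omega_n^j)
   well inside it; by assumption (a), few of these lie near the cell boundaries. A
   permutation maximizing the number of indices in a common cell is the matching.

   For W_1, the coupling is the joint law of f(exp(2 pi i t)) and the eigenvalue matched
   to f(omega_n^j), where t is uniform on [0, 1] and j is the integer part of n t. *)
Require Import Defs.
From HB Require Import structures.
From mathcomp Require Import all_boot all_order all_algebra all_fingroup.
From mathcomp Require Import sesquilinear spectral.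
From mathcomp Require Import complex.
From mathcomp Require Import all_classical all_reals all_analysis.
From mathcomp Require Import measurable_realfun.
From mathcomp Require Import ring lra zify.
Import Order.TTheory GRing.Theory Num.Theory.
Import numFieldNormedType.Exports.
Local Open Scope classical_set_scope.
Local Open Scope complex_scope.
Local Open Scope ring_scope.
Set Implicit Arguments.
Unset Strict Implicit.
Unset Printing Implicit Defensive.

(** * Modulus, vector norm and determinants *)

(** All scales are powers of one integer q, the integer part of n^tau: cells have side 1/q, bumps
    have inner radius 1/K with K = q^c, and each is averaged over L = q^(2c+2) radii. About (qK)^2
    bumps are summed while a single point sees a total of order q^2, so an error in the potentials
    is amplified by K^2; this dictates the exponents. One circle per bump would not do: a point
    close to it costs log(1/eta), and nothing prevents most points from being there. Among L radii
    each point is close to at most one, so the loss is (log n)/L per point.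

    Assumption (a) enters at two exponents: at tau for the thin rectangles along cell sides, and at
    the larger tau(3c+5) for the number of samples within eta of z, which is a rank.

    The list of eigenvalues is in a chosen order, so no event about it is assumed measurable.
    Probability enters only through the norm event and the measurable events that sigma_min exceeds
    n^(-kap) at the sample points; on their intersection everything is deterministic. *)

Lemma cabsE (R : realType) (z : R[i]) : `|z| = (cabs z)%:C.
Proof. by rewrite normc_def; case: z. Qed.

Lemma cabs_ge0 (R : realType) (z : R[i]) : 0 <= cabs z.
Proof. by rewrite -lecR -cabsE normr_ge0. Qed.

Lemma cabsM (R : realType) (x y : R[i]) : cabs (x * y) = cabs x * cabs y.
Proof. exact: Normc.normcM. Qed.

Lemma cabsD (R : realType) (x y : R[i]) : cabs (x + y) <= cabs x + cabs y.
Proof. exact: le_normcD. Qed.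

Lemma cabsN (R : realType) (x : R[i]) : cabs (- x) = cabs x.
Proof. exact: normcN. Qed.

Lemma cabs0 (R : realType) : cabs (0 : R[i]) = 0.
Proof. exact: Normc.normc0. Qed.

Lemma cabs1 (R : realType) : cabs (1 : R[i]) = 1.
Proof. exact: Normc.normc1. Qed.

Lemma cabsV (R : realType) (x : R[i]) : cabs x^-1 = (cabs x)^-1.
Proof. exact: Normc.normcV. Qed.

Lemma cabs_eq0 (R : realType) (x : R[i]) : (cabs x == 0) = (x == 0).
Proof.
apply/eqP/eqP => [|->]; [exact: Normc.eq0_normc|exact: cabs0].
Qed.

Lemma cabs_gt0 (R : realType) (x : R[i]) : (0 < cabs x) = (x != 0).
Proof. by rewrite lt_def cabs_ge0 andbT cabs_eq0. Qed.

Lemma cabsX (R : realType) (x : R[i]) (n : nat) : cabs (x ^+ n) = cabs x ^+ n.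
Proof.
by elim: n => [|n IH]; rewrite ?expr0 ?cabs1// !exprS cabsM IH.
Qed.

Lemma cabs_real (R : realType) (x : R) : cabs x%:C = `|x|.
Proof. by rewrite /cabs /= expr0n addr0 sqrtr_sqr. Qed.

Lemma cabs_prod (R : realType) (I : Type) (s : seq I) (F : I -> R[i]) :
  cabs (\prod_(i <- s) F i) = \prod_(i <- s) cabs (F i).
Proof.
by elim/big_rec2: _ => [|i y z _ <-]; rewrite ?cabs1// cabsM.
Qed.

Lemma cabs_sum (R : realType) (I : Type) (s : seq I) (P : pred I)
    (F : I -> R[i]) :
  cabs (\sum_(i <- s | P i) F i) <= \sum_(i <- s | P i) cabs (F i).
Proof.
elim/big_rec2: _ => [|i y z _ h]; first by rewrite cabs0.
by apply: le_trans (cabsD _ _) _; rewrite lerD2l.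
Qed.

Lemma cabs_sq (R : realType) (z : R[i]) :
  cabs z ^+ 2 = complex.Re z ^+ 2 + complex.Im z ^+ 2.
Proof.
by case: z => x y /=; rewrite /cabs /= sqr_sqrtr// addr_ge0// sqr_ge0.
Qed.

Lemma cabs_subC (R : realType) (x y : R[i]) : cabs (x - y) = cabs (y - x).
Proof. by rewrite -cabsN opprB. Qed.

Lemma ler_cabsB (R : realType) (x y : R[i]) : cabs x - cabs y <= cabs (x - y).
Proof. by rewrite lerBlDr; apply: le_trans (cabsD _ _); rewrite subrK. Qed.

Lemma ReB (R : realType) (x y : R[i]) :
  complex.Re (x - y) = complex.Re x - complex.Re y.
Proof. by case: x y => [? ?] [? ?]. Qed.

Lemma ImB (R : realType) (x y : R[i]) :
  complex.Im (x - y) = complex.Im x - complex.Im y.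
Proof. by case: x y => [? ?] [? ?]. Qed.

Lemma Re_le_cabs (R : realType) (z : R[i]) : `|complex.Re z| <= cabs z.
Proof.
rewrite -(@ler_pXn2r _ 2)// ?nnegrE ?cabs_ge0//.
by rewrite cabs_sq real_normK ?num_real// lerDl sqr_ge0.
Qed.

Lemma Im_le_cabs (R : realType) (z : R[i]) : `|complex.Im z| <= cabs z.
Proof.
rewrite -(@ler_pXn2r _ 2)// ?nnegrE ?cabs_ge0//.
by rewrite cabs_sq real_normK ?num_real// lerDr sqr_ge0.
Qed.

Lemma cabs_le_ReIm (R : realType) (z : R[i]) :
  cabs z <= `|complex.Re z| + `|complex.Im z|.
Proof.
rewrite -(@ler_pXn2r _ 2)// ?nnegrE ?cabs_ge0 ?addr_ge0//.
rewrite cabs_sq sqrrD !real_normK ?num_real//.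
have := mulr_ge0 (normr_ge0 (complex.Re z)) (normr_ge0 (complex.Im z)); lra.
Qed.

Lemma l2norm_ge0 (R : realType) (n : nat) (v : 'cV[R[i]]_n) : 0 <= l2norm v.
Proof. exact: sqrtr_ge0. Qed.

Lemma l2norm_sq (R : realType) (n : nat) (v : 'cV[R[i]]_n) :
  l2norm v ^+ 2 = \sum_i cabs (v i 0) ^+ 2.
Proof. by rewrite sqr_sqrtr// sumr_ge0// => i _; rewrite exprn_ge0// cabs_ge0. Qed.

Lemma l2norm_gt0 (R : realType) (n : nat) (v : 'cV[R[i]]_n) :
  v != 0 -> 0 < l2norm v.
Proof.
move=> v0; have [i vi] : exists i, v i 0 != 0.
  apply/existsP; apply: contraNT v0 => /existsPn h.
  by apply/eqP/matrixP => i j; rewrite ord1 mxE; apply/eqP/negPn/h.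
rewrite sqrtr_gt0 (bigD1 i)//= ltr_wpDr//.
  by rewrite sumr_ge0// => j _; rewrite exprn_ge0// cabs_ge0.
by rewrite exprn_gt0// cabs_gt0.
Qed.

Lemma l2norm0 (R : realType) (n : nat) : l2norm (0 : 'cV[R[i]]_n) = 0.
Proof.
by rewrite /l2norm big1 ?sqrtr0// => i _; rewrite mxE cabs0 expr0n.
Qed.

Lemma l2normZ (R : realType) (n : nat) (c : R[i]) (v : 'cV[R[i]]_n) :
  l2norm (c *: v) = cabs c * l2norm v.
Proof.
rewrite /l2norm -[X in X * _](ger0_norm (cabs_ge0 c)) -sqrtr_sqr -sqrtrM ?sqr_ge0//.
by congr Num.sqrt; rewrite mulr_sumr; apply: eq_bigr => i _; rewrite mxE cabsM exprMn.
Qed.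

(** Cauchy-Schwarz from 2 a b <= (t/s) a^2 + (s/t) b^2 with s and t the two norms; the cases s = 0
    and t = 0 are separate because of the quotients. *)
Lemma sum_mul_le_sqrt (R : realType) (n : nat) (a b : 'I_n -> R) :
  \sum_i a i * b i <= Num.sqrt (\sum_i a i ^+ 2) * Num.sqrt (\sum_i b i ^+ 2).
Proof.
set s := Num.sqrt (\sum_i a i ^+ 2); set t := Num.sqrt (\sum_i b i ^+ 2).
have sE : \sum_i a i ^+ 2 = s ^+ 2.
  by rewrite sqr_sqrtr// sumr_ge0// => i _; rewrite sqr_ge0.
have tE : \sum_i b i ^+ 2 = t ^+ 2.
  by rewrite sqr_sqrtr// sumr_ge0// => i _; rewrite sqr_ge0.
have s0 : 0 <= s by exact: sqrtr_ge0.
have t0 : 0 <= t by exact: sqrtr_ge0.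
have zero (c : 'I_n -> R) (r : R) i : \sum_i c i ^+ 2 = r ^+ 2 -> r = 0 -> c i = 0.
  move=> E r0; move: E; rewrite r0 expr0n => /eqP; rewrite psumr_eq0.
    by move=> /allP/(_ i); rewrite mem_index_enum sqrf_eq0 => /(_ isT)/eqP.
  by move=> j _; exact: sqr_ge0.
have [s1|s1] := eqVneq s 0.
  by rewrite s1 mul0r big1// => i _; rewrite (zero a s)// mul0r.
have [t1|t1] := eqVneq t 0.
  by rewrite t1 mulr0 big1// => i _; rewrite (zero b t)// mulr0.
have sp : 0 < s by rewrite lt_def s1.
have tp : 0 < t by rewrite lt_def t1.
have -> : s * t = \sum_i ((t / s) * a i ^+ 2 + (s / t) * b i ^+ 2) / 2.
  rewrite -mulr_suml big_split/= -!mulr_sumr sE tE.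
  by field; rewrite s1 t1.
apply: ler_sum => i _; rewrite ler_pdivlMr//.
have := sqr_ge0 (t * a i - s * b i) => h.
rewrite -subr_ge0.
have -> : t / s * a i ^+ 2 + s / t * b i ^+ 2 - a i * b i * 2 =
  (t * a i - s * b i) ^+ 2 / (s * t) by field; rewrite s1 t1.
by rewrite divr_ge0// mulr_ge0.
Qed.

Lemma l2normD (R : realType) (n : nat) (u v : 'cV[R[i]]_n) :
  l2norm (u + v) <= l2norm u + l2norm v.
Proof.
rewrite -(@ler_pXn2r _ 2)// ?nnegrE ?addr_ge0 ?l2norm_ge0// sqrrD !l2norm_sq.
apply: le_trans (_ : \sum_i (cabs (u i 0) + cabs (v i 0)) ^+ 2 <= _).
  apply: ler_sum => i _; rewrite ler_pXn2r// ?nnegrE ?addr_ge0 ?cabs_ge0// mxE.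
  exact: cabsD.
under eq_bigr do rewrite sqrrD; rewrite !big_split/=.
rewrite lerD2r lerD2l mulr2n.
by apply: lerD; exact: (sum_mul_le_sqrt (fun i => cabs (u i 0)) (fun i => cabs (v i 0))).
Qed.

(** An operator norm bound without a supremum: it applies to rectangular matrices and composes
    directly under sums and products. *)
Definition opbound (R : realType) (m n : nat) (A : 'M[R[i]]_(m, n)) (t : R) :=
  forall v, l2norm (A *m v) <= t * l2norm v.

Lemma opbound_le (R : realType) (m n : nat) (A : 'M[R[i]]_(m, n)) (s t : R) :
  s <= t -> opbound A s -> opbound A t.
Proof.
by move=> st h v; apply: le_trans (h v) _; rewrite ler_wpM2r// l2norm_ge0.
Qed.

Lemma opboundD (R : realType) (m n : nat) (A B : 'M[R[i]]_(m, n)) (s t : R) :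
  opbound A s -> opbound B t -> opbound (A + B) (s + t).
Proof.
move=> hA hB v; rewrite mulmxDl mulrDl.
by apply: le_trans (l2normD _ _) _; rewrite lerD.
Qed.

Lemma opboundZ (R : realType) (m n : nat) (A : 'M[R[i]]_(m, n)) (s : R) (c : R[i]) :
  opbound A s -> opbound (c *: A) (cabs c * s).
Proof.
move=> hA v; rewrite -scalemxAl l2normZ -mulrA.
by rewrite ler_wpM2l ?cabs_ge0.
Qed.

Lemma opboundN (R : realType) (m n : nat) (A : 'M[R[i]]_(m, n)) (s : R) :
  opbound A s -> opbound (- A) s.
Proof. by move=> /(opboundZ (-1)); rewrite scaleN1r cabsN cabs1 mul1r. Qed.

Lemma opboundB (R : realType) (m n : nat) (A B : 'M[R[i]]_(m, n)) (s t : R) :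
  opbound A s -> opbound B t -> opbound (A - B) (s + t).
Proof. by move=> hA /opboundN; apply: opboundD. Qed.

Lemma opboundM (R : realType) (m n p : nat) (A : 'M[R[i]]_(m, n))
    (B : 'M[R[i]]_(n, p)) (s t : R) :
  0 <= s -> opbound A s -> opbound B t -> opbound (A *m B) (s * t).
Proof.
move=> s0 hA hB v; rewrite -mulmxA -mulrA.
by apply: le_trans (hA _) _; rewrite ler_wpM2l.
Qed.

Lemma opbound_scalar (R : realType) (n : nat) (c : R[i]) :
  opbound (c%:M : 'M[R[i]]_n) (cabs c).
Proof. by move=> v; rewrite mul_scalar_mx l2normZ. Qed.

Lemma opbound0 (R : realType) (m n : nat) : opbound (0 : 'M[R[i]]_(m, n)) 0.
Proof. by move=> v; rewrite mul0mx l2norm0 mul0r. Qed.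

Lemma opbound_sum (R : realType) (m n : nat) (I : Type) (s : seq I)
    (A : I -> 'M[R[i]]_(m, n)) (t : I -> R) :
  (forall i, opbound (A i) (t i)) ->
  opbound (\sum_(i <- s) A i) (\sum_(i <- s) t i).
Proof.
move=> h; elim/big_rec2: _ => [|i y z _ hyz]; first exact: opbound0.
exact: opboundD.
Qed.

Lemma l2norm_dot (R : realType) (n : nat) (v : 'cV[R[i]]_n) :
  ((v ^t*)%sesqui *m v) 0 0 = (l2norm v ^+ 2)%:C.
Proof.
rewrite l2norm_sq mxE rmorph_sum/=; apply: eq_bigr => i _.
by rewrite !mxE rmorphXn/= -cabsE normCK mulrC.
Qed.

Lemma l2norm_unitary (R : realType) (n : nat) (U : 'M[R[i]]_n) (v : 'cV[R[i]]_n) :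
  U \is unitarymx -> l2norm (U *m v) = l2norm v.
Proof.
move=> /unitarymxP/mulmx1C UU; apply/eqP.
rewrite -(eqrXn2 (n := 2)) ?l2norm_ge0//; apply/eqP/complexI.
rewrite -!l2norm_dot trmx_mul map_mxM/= mulmxA -(mulmxA _ _ U) UU mulmx1.
by [].
Qed.

Lemma opbound_unitary (R : realType) (n : nat) (U : 'M[R[i]]_n) :
  U \is unitarymx -> opbound U 1.
Proof. by move=> h v; rewrite mul1r l2norm_unitary. Qed.

Lemma opbound_diag (R : realType) (n : nat) (d : 'rV[R[i]]_n) (t : R) :
  0 <= t -> (forall i, cabs (d 0 i) <= t) -> opbound (diag_mx d) t.
Proof.
move=> t0 h v; rewrite -(@ler_pXn2r _ 2)// ?nnegrE ?mulr_ge0 ?l2norm_ge0//.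
rewrite exprMn !l2norm_sq mulr_sumr; apply: ler_sum => i _.
rewrite mul_diag_mx mxE cabsM exprMn ler_wpM2r ?sqr_ge0//.
by rewrite ler_pXn2r// nnegrE cabs_ge0.
Qed.

Lemma mem_eigvals (R : realType) (n : nat) (A : 'M[R[i]]_n) (z : R[i]) :
  (z \in eigvals A) = root (char_poly A) z.
Proof. by rewrite char_poly_eigvals root_prod_XsubC. Qed.

Lemma char_poly_horner (R : comNzRingType) (n : nat) (A : 'M[R]_n) (z : R) :
  (char_poly A).[z] = \det (z%:M - A).
Proof.
rewrite /char_poly -horner_evalE -det_map_mx; congr (\det _).
by apply/matrixP => i j; rewrite !mxE /= /horner_eval !hornerE ?hornerMn ?hornerX.
Qed.

Lemma eigvals_eigenvector (R : realType) (n : nat) (A : 'M[R[i]]_n) (z : R[i]) :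
  z \in eigvals A -> exists2 v : 'cV[R[i]]_n, v != 0 & A *m v = z *: v.
Proof.
(* [det0P] provides a row vector, so the determinant is transposed to reach a column eigenvector. *)
rewrite mem_eigvals /root char_poly_horner -det_tr => /det0P[v v0 hv].
exists v^T; first by rewrite -(inj_eq trmx_inj) trmxK trmx0.
apply/trmx_inj; rewrite trmx_mul linearZ/= !trmxK.
move: hv; rewrite linearB/= tr_scalar_mx mulmxBr mul_mx_scalar.
by move/eqP; rewrite subr_eq0 => /eqP.
Qed.

Lemma eigvals_opbound (R : realType) (n : nat) (A : 'M[R[i]]_n) (t : R) (z : R[i]) :
  opbound A t -> z \in eigvals A -> cabs z <= t.
Proof.
move=> h /eigvals_eigenvector[v v0 hv].
by have := h v; rewrite hv l2normZ ler_pM2r// l2norm_gt0.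
Qed.

Lemma det_scalar_sub (R : realType) (n : nat) (A : 'M[R[i]]_n) (z : R[i]) :
  \det (z%:M - A) = \prod_(x <- eigvals A) (z - x).
Proof.
rewrite -char_poly_horner char_poly_eigvals horner_prod.
by apply: eq_bigr => x _; rewrite hornerXsubC.
Qed.

Lemma cabs_det_sub (R : realType) (n : nat) (A : 'M[R[i]]_n) (z : R[i]) :
  cabs (\det (A - z%:M)) = \prod_(x <- eigvals A) cabs (x - z).
Proof.
rewrite -opprB -scaleN1r detZ cabsM cabsX cabsN cabs1 expr1n mul1r.
by rewrite det_scalar_sub cabs_prod; apply: eq_bigr => x _; rewrite cabs_subC.
Qed.

Lemma cabs_det_1D (R : realType) (n : nat) (A : 'M[R[i]]_n) :
  cabs (\det (1%:M + A)) = \prod_(x <- eigvals A) cabs (x + 1).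
Proof.
have -> : 1%:M + A = A - (- 1)%:M by rewrite raddfN/= opprK addrC.
by rewrite cabs_det_sub; under eq_bigr do rewrite opprK.
Qed.

(* By Sylvester's identity det(1 + UV) = det(1 + VU) only r eigenvalues matter, and
   those of VU are eigenvalues of UV. *)
Lemma det_1D_lowrank (R : realType) (n : nat) (A : 'M[R[i]]_n) (t : R) (r : nat) :
  0 <= t -> opbound A t -> (\rank A <= r)%N ->
  cabs (\det (1%:M + A)) <= (1 + t) ^+ r.
Proof.
move=> t0 hA hr.
pose U := col_base A; pose V := row_base A.
have AE : A = U *m V by rewrite mulmx_base.
have -> : \det (1%:M + A) = \det (1%:M + V *m U).
  (* Both determinants equal that of the block matrix: eliminating its lower left block leaves 1 +
     UV, eliminating its upper right block leaves 1 + VU. *)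
  have d1 : \det (block_mx 1%:M (- V) U 1%:M) = \det (1%:M + A).
    have := congr1 determinant (mulmx_block 1%:M 0 (- U) 1%:M 1%:M (- V) U 1%:M).
    rewrite det_mulmx det_lblock !det1 !mul1r => ->.
    rewrite !mul1mx !mul0mx !addr0 mulNmx mulmx1 addNr det_ublock det1 mul1r.
    by rewrite mulNmx mulmxN opprK -AE addrC.
  have d2 : \det (block_mx 1%:M (- V) U 1%:M) = \det (1%:M + V *m U).
    have := congr1 determinant (mulmx_block 1%:M V 0 1%:M 1%:M (- V) U 1%:M).
    rewrite det_mulmx det_ublock !det1 !mul1r => ->.
    by rewrite !mul1mx !mul0mx !add0r mulmx1 addNr det_lblock det1 mulr1.
  by rewrite -d1 d2.
have VU x : x \in eigvals (V *m U) -> cabs x <= t.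
  move=> /eigvals_eigenvector[v v0 hv].
  have [->|x0] := eqVneq x 0; first by rewrite cabs0.
  have w0 : U *m v != 0.
    apply: contra_neq v0 => Uv0; move: hv; rewrite -mulmxA Uv0 mulmx0.
    by move/esym/eqP; rewrite scaler_eq0 (negPf x0) => /eqP.
  have := hA (U *m v); rewrite {1}AE -mulmxA (mulmxA V) hv -scalemxAr l2normZ.
  by rewrite ler_pM2r// l2norm_gt0.
rewrite cabs_det_1D.
apply: le_trans (_ : (1 + t) ^+ \rank A <= _); last first.
  by rewrite ler_weXn2l// lerDl.
rewrite -[X in _ ^+ X](size_eigvals (V *m U)).
elim: (eigvals _) VU => [|x s IH] VU; first by rewrite big_nil expr0.
rewrite big_cons exprS ler_pM ?cabs_ge0 ?prodr_ge0//.
- by move=> i _; exact: cabs_ge0.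
- apply: le_trans (cabsD _ _) _; rewrite cabs1 addrC lerD2l.
  by apply: VU; rewrite mem_head.
- by apply: IH => y ys; apply: VU; rewrite in_cons ys orbT.
Qed.

(** Every eigenvalue x of A has |x| <= t, so each factor |1 + x| is at least 1 - t >= 0. *)
Lemma det_1D_ge (R : realType) (n : nat) (A : 'M[R[i]]_n) (t : R) :
  t <= 1 -> opbound A t -> (1 - t) ^+ n <= cabs (\det (1%:M + A)).
Proof.
move=> t1 hA; rewrite cabs_det_1D -[X in _ ^+ X](size_eigvals A).
have := fun z => @eigvals_opbound _ _ _ _ z hA.
elim: (eigvals A) => [|x s IH] h; first by rewrite big_nil expr0.
rewrite big_cons exprS ler_pM ?exprn_ge0 ?subr_ge0//.
- have := ler_cabsB 1 (- x); rewrite cabs1 cabsN opprK [1 + x]addrC => h1.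
  by apply: le_trans h1; rewrite lerB// h// mem_head.
- by apply: IH => y ys; apply: h; rewrite in_cons ys orbT.
Qed.

Lemma invmx_opbound (R : realType) (n : nat) (B : 'M[R[i]]_n) (t : R) :
  0 < t -> (forall v, t * l2norm v <= l2norm (B *m v)) ->
  B \in unitmx /\ opbound (invmx B) t^-1.
Proof.
move=> t0 h.
have uB : B \in unitmx.
  rewrite unitmxE unitfE -det_tr; apply/negP => /det0P[v v0 hv].
  have vT0 : v^T != 0 by rewrite -(inj_eq trmx_inj) trmxK trmx0.
  have := h v^T; rewrite -[B *m _]trmxK trmx_mul trmxK hv trmx0 l2norm0.
  by rewrite leNgt mulr_gt0// l2norm_gt0.
split=> // v; have := h (invmx B *m v); rewrite mulmxA mulmxV// mul1mx.
by rewrite ler_pdivlMl.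
Qed.

(** * Circulant approximation *)

Lemma expiD (R : realType) (s t : R) : expi (s + t) = expi s * expi t.
Proof.
rewrite /expi cosD sinD; apply/eqP; rewrite eq_complex /=.
by rewrite eqxx/= addrC [cos s * _]mulrC [sin s * _]mulrC [cos t * _]mulrC.
Qed.

Lemma expi0 (R : realType) : expi (0 : R) = 1.
Proof. by rewrite /expi cos0 sin0. Qed.

Lemma expi_2pi (R : realType) : expi (2 * pi : R) = 1.
Proof. by rewrite /expi mulr_natl cos2pi sin2pi. Qed.

Lemma expiX (R : realType) (t : R) (n : nat) : expi t ^+ n = expi (n%:R * t).
Proof.
elim: n => [|n IH]; first by rewrite mul0r expi0.
by rewrite exprS IH -expiD -natr1 mulrDl mul1r addrC.
Qed.

Lemma cabs_expi (R : realType) (t : R) : cabs (expi t) = 1.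
Proof. by rewrite /cabs /= cos2Dsin2 sqrtr1. Qed.

(** Half angle: cos t = 1 - 2 sin(t/2)^2, and sin is positive on the open interval from 0 to pi. *)
Lemma expi_neq1 (R : realType) (t : R) : 0 < t < 2 * pi -> expi t != 1.
Proof.
move=> /andP[t0 t2]; apply/eqP => /(congr1 (@complex.Re R)) /=.
have -> : t = t / 2 + t / 2 by field.
rewrite cosD -!expr2 cos2sin2 => h.
have : 0 < sin (t / 2).
  apply: sin_gt0_pi; apply/andP; split; lra.
by move=> s0; have := exprn_gt0 2 s0; lra.
Qed.

Lemma omega_prim (R : realType) (n : nat) : (0 < n)%N ->
  n.-primitive_root (omega R n).
Proof.
move=> n0; have n0R : 0 < n%:R :> R by rewrite ltr0n.
rewrite /primitive_root_of_unity n0; apply/forallP => i; apply/eqP.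
rewrite unity_rootE expiX.
have [->|ni] := eqVneq i.+1 n.
  have -> : n%:R * (2 * pi / n%:R) = 2 * pi :> R by field; rewrite gt_eqF.
  by rewrite expi_2pi eqxx.
have {ni}hi : (i.+1 < n)%N by rewrite ltn_neqAle ni ltn_ord.
apply/negbTE/expi_neq1; have p0 := pi_gt0 R.
rewrite mulr_gt0 ?divr_gt0 ?mulr_gt0//=.
rewrite mulrA ltr_pdivrMr// mulrC ltr_pM2l ?mulr_gt0//.
by rewrite ltr_nat.
Qed.

Lemma omega_neq0 (R : realType) (n : nat) : omega R n != 0.
Proof. by rewrite -cabs_gt0 cabs_expi. Qed.

Lemma cabs_omega (R : realType) (n : nat) : cabs (omega R n) = 1.
Proof. exact: cabs_expi. Qed.

Lemma conjC_real (R : realType) (x : R) : (x%:C)^* = x%:C :> R[i].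
Proof. exact: conjc_real. Qed.

Lemma conj_unit (R : realType) (z : R[i]) : cabs z = 1 -> z^* = z^-1.
Proof.
move=> z1; have z0 : z != 0 by rewrite -cabs_gt0 z1.
by apply: (mulfI z0); rewrite mulfV// -normCK cabsE z1 expr1n.
Qed.

Lemma cabs_exprz1 (R : realType) (z : R[i]) (e : int) :
  cabs z = 1 -> cabs (z ^ e) = 1.
Proof.
case: e => m h /=; first by rewrite -exprnP cabsX h expr1n.
by rewrite NegzE -exprnN cabsV cabsX h expr1n invr1.
Qed.

Lemma omega_exprz_eq1 (R : realType) (n : nat) (e : int) : (0 < n)%N ->
  (omega R n ^ e == 1) = (n %| `|e|)%N.
Proof.
move=> n0; rewrite (prim_order_dvd (omega_prim R n0)).
case: e => m //; rewrite NegzE -exprnN abszN /= -{1}[1]invr1.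
by rewrite (inj_eq (@invr_inj _)).
Qed.

(** Orthogonality of characters, by the geometric sum. It yields both the unitarity of [dft] and the
    entries of a circulant matrix; integer exponents accommodate differences of indices. *)
Lemma sum_omega (R : realType) (n : nat) (e : int) : (0 < n)%N ->
  \sum_(m < n) (omega R n ^ e) ^+ m = if (n %| `|e|)%N then n%:R else 0.
Proof.
move=> n0; set x := omega R n ^ e.
have xn : x ^+ n = 1.
  have w1 := prim_expr_order (omega_prim R n0).
  by rewrite exprnP /x exprzAC -exprnP w1 exp1rz.
rewrite -(omega_exprz_eq1 R e n0) -/x; have [x1|x1] := eqVneq x 1.
  rewrite (eq_bigr (fun=> 1)); last by move=> i _; rewrite x1 expr1n.
  by rewrite sumr_const card_ord.
have := subrX1 x n; rewrite xn subrr => /esym/eqP.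
by rewrite mulf_eq0 subr_eq0 (negPf x1) => /eqP.
Qed.

Definition dft (R : realType) (n : nat) : 'M[R[i]]_n :=
  \matrix_(i, m) (((Num.sqrt n%:R)^-1)%:C * (omega R n ^ (- i%:Z)) ^+ m).

Lemma dft_unitary (R : realType) (n : nat) : (0 < n)%N -> dft R n \is unitarymx.
Proof.
move=> n0; have n0R : 0 < n%:R :> R by rewrite ltr0n.
apply/unitarymxP/matrixP => i j; rewrite !mxE.
have o0 := omega_neq0 R n.
rewrite (eq_bigr (fun m : 'I_n =>
    (n%:R^-1)%:C * (omega R n ^ (j%:Z - i%:Z)) ^+ m)); last first.
  move=> m _; rewrite !mxE rmorphM/= rmorphXn/=.
  rewrite (@conj_unit _ (omega R n ^ (- j%:Z))); last first.
    by rewrite cabs_exprz1// cabs_omega.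
  rewrite invr_expz opprK mulrACA -exprMn -expfzDr// addrC.
  congr (_ * _); rewrite conjC_real -rmorphM -invfM -expr2 sqr_sqrtr//.
rewrite -mulr_sumr sum_omega//.
have -> : (n %| `|j%:Z - i%:Z|)%N = (i == j).
  apply/idP/idP => [h|/eqP->]; last by rewrite subrr dvdn0.
  apply/eqP/val_inj => /=; move: h; have := ltn_ord i; have := ltn_ord j.
  move=> hi hj /dvdnP[q hq].
  case: q hq => [|q] hq; lia.
case: (i == j); rewrite /= ?mulr0//.
by rewrite -(rmorph_nat (real_complex R)) -rmorphM/= mulVf ?gt_eqF.
Qed.

(** Given by its spectrum d rather than by a generating column, so that products, inverses,
    determinant and rank are read off d; the entries are computed in [circulant_entry]. *)
Definition circulant (R : realType) (n : nat) (d : 'rV[R[i]]_n) : 'M[R[i]]_n :=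
  dft R n *m diag_mx d *m ((dft R n) ^t*)%sesqui.

Lemma dftK (R : realType) (n : nat) : (0 < n)%N ->
  ((dft R n) ^t*)%sesqui *m dft R n = 1%:M.
Proof. by move=> n0; apply/mulmx1C/unitarymxP/dft_unitary. Qed.

Lemma circulantM (R : realType) (n : nat) (d e : 'rV[R[i]]_n) : (0 < n)%N ->
  circulant d *m circulant e = circulant (\row_i (d 0 i * e 0 i)).
Proof.
move=> n0; rewrite /circulant !mulmxA; congr (_ *m _).
rewrite -(mulmxA (dft R n *m diag_mx d)) dftK// mulmx1 -mulmxA mulmx_diag.
by [].
Qed.

Lemma circulant_scalar (R : realType) (n : nat) (c : R[i]) : (0 < n)%N ->
  circulant (\row_(i < n) c) = c%:M.
Proof.
move=> n0; rewrite /circulant.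
have -> : diag_mx (\row_(i < n) c) = c%:M.
  by apply/matrixP => i j; rewrite !mxE.
rewrite mul_mx_scalar -scalemxAl.
by have /unitarymxP -> := dft_unitary R n0; rewrite scalemx1.
Qed.

Lemma circulantB (R : realType) (n : nat) (d e : 'rV[R[i]]_n) :
  circulant d - circulant e = circulant (d - e).
Proof. by rewrite /circulant -mulmxBl -mulmxBr; congr (_ *m _ *m _); rewrite linearB. Qed.

Lemma opbound_circulant (R : realType) (n : nat) (d : 'rV[R[i]]_n) (t : R) :
  (0 < n)%N -> 0 <= t -> (forall i, cabs (d 0 i) <= t) -> opbound (circulant d) t.
Proof.
move=> n0 t0 h; have U := dft_unitary R n0.
rewrite -[t]mulr1 -[t in t * 1]mul1r; apply: opboundM; rewrite ?mul1r//.
  rewrite -[t]mul1r; apply: opboundM => //; first exact: opbound_unitary.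
  exact: opbound_diag.
by apply: opbound_unitary; rewrite trmxC_unitary.
Qed.

Lemma cabs_det_circulant (R : realType) (n : nat) (d : 'rV[R[i]]_n) : (0 < n)%N ->
  cabs (\det (circulant d)) = \prod_i cabs (d 0 i).
Proof.
move=> n0; rewrite !det_mulmx mulrAC -det_mulmx.
have /unitarymxP -> := dft_unitary R n0.
by rewrite det1 mul1r det_diag cabs_prod.
Qed.

Lemma rank_nonzero_rows (F : fieldType) (m n : nat) (A : 'M[F]_(m, n)) :
  (\rank A <= #|[pred i | row i A != 0%R]|)%N.
Proof.
pose B := (\sum_(i | row i A != 0) <<row i A>>)%MS.
have AB : (A <= B)%MS.
  apply/row_subP => i; have [->|i0] := eqVneq (row i A) 0; first exact: sub0mx.
  by rewrite (sumsmx_sup i)// genmxE.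
apply: leq_trans (mxrankS AB) _.
apply: leq_trans (_ : \sum_(i | row i A != 0%R) \rank <<row i A>>%MS <= _)%N.
  exact: (mxrank_sum_leqif _).1.
rewrite -sum1_card; apply: leq_sum => i _.
by rewrite genmxE rank_leq_row.
Qed.

Lemma rank_circulant (R : realType) (n : nat) (d : 'rV[R[i]]_n) :
  (\rank (circulant d) <= #|[pred i | d 0%R i != 0%R]|)%N.
Proof.
apply: leq_trans (mxrankM_maxl _ _) _.
apply: leq_trans (mxrankM_maxr _ _) _.
apply: leq_trans (rank_nonzero_rows _) _; apply: subset_leq_card.
apply/fintype.subsetP => i; rewrite !inE; apply: contraNneq => di.
by apply/eqP/matrixP => a b; rewrite !mxE di mul0rn.
Qed.

(** The sum over m keeps the coefficients whose index is congruent to i - j modulo n. As n may be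
    small compared with k, several of them can land in one entry. *)
Lemma circulant_entry (R : realType) (k : nat) (a : int -> R[i]) (n : nat)
    (i j : 'I_n) :
  circulant (\row_m symbol_fun k a (omega R n ^+ m)) i j =
  \sum_(l < k.*2.+1)
    if (n %| `|(l%:Z - k%:Z - (i%:Z - j%:Z))%R|)%N then a (l%:Z - k%:Z) else 0.
Proof.
have n0 : (0 < n)%N by case: n i {j} => -[].
have n0R : 0 < n%:R :> R by rewrite ltr0n.
have o0 := omega_neq0 R n.
rewrite /circulant mxE.
transitivity (\sum_(m < n) \sum_(l < k.*2.+1) (n%:R^-1)%:C * a (l%:Z - k%:Z) *
    (omega R n ^ (l%:Z - k%:Z - (i%:Z - j%:Z))) ^+ m).
  apply: eq_bigr => m _; rewrite mul_mx_diag !mxE /symbol_fun.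
  rewrite mulr_sumr mulr_suml; apply: eq_bigr => l _.
  rewrite rmorphM/= rmorphXn/= (@conj_unit _ (omega R n ^ (- j%:Z)));
    last by rewrite cabs_exprz1// cabs_omega.
  rewrite conjC_real invr_expz opprK.
  have -> : (n%:R^-1)%:C = (Num.sqrt n%:R)^-1%:C * (Num.sqrt n%:R)^-1%:C :> R[i].
    by rewrite -rmorphM -invfM -expr2 sqr_sqrtr// ltW.
  have -> : (omega R n ^ (l%:Z - k%:Z - (i%:Z - j%:Z))) ^+ m =
     (omega R n ^ (- i%:Z)) ^+ m * (omega R n ^+ m) ^ (l%:Z - k%:Z) *
     (omega R n ^ j) ^+ m.
    have -> : (omega R n ^+ m) ^ (l%:Z - k%:Z) = (omega R n ^ (l%:Z - k%:Z)) ^+ m.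
      by rewrite !exprnP exprzAC.
    rewrite -!exprMn -!expfzDr//.
    by congr ((_ ^ _) ^+ _); ring.
  by ring.
rewrite exchange_big/=; apply: eq_bigr => l _.
rewrite -mulr_sumr sum_omega//; case: ifP => _; last by rewrite mulr0.
rewrite mulrAC -(rmorph_nat (real_complex R)) -rmorphM/=.
by rewrite mulVf ?gt_eqF// mul1r.
Qed.

(** If k <= i < n - k, then i - j differs from any index in [-k, k] by less than n, so congruence
    modulo n is equality and the rows i agree. At most 2k rows remain. *)
Lemma rank_toeplitz_circulant (R : realType) (k : nat) (a : int -> R[i]) (n : nat) :
  (\rank (toeplitz_mx k a n -
    circulant (\row_m symbol_fun k a (omega R n ^+ m)))%R <= k.*2)%N.
Proof.
apply: leq_trans (rank_nonzero_rows _) _.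
apply: leq_trans (_ : #|[pred i : 'I_n | (i < k)%N || (n - k <= i)%N]| <= _)%N.
  apply: subset_leq_card; apply/fintype.subsetP => i; rewrite !inE.
  apply: contraNT; rewrite negb_or -leqNgt -ltnNge => /andP[ki ink].
  apply/eqP/matrixP => ? j; rewrite mxE [RHS]mxE [LHS]mxE [X in _ + X]mxE.
  rewrite circulant_entry mxE; apply/eqP; rewrite subr_eq0; apply/eqP.
  have := ltn_ord j => jn.
  case: ifP => [h|h].
    have lt : (`|(i%:Z - j%:Z + k%:Z)%R| < k.*2.+1)%N by lia.
    rewrite (bigD1 (Ordinal lt))//= big1 ?addr0.
      rewrite ifT; first by congr a; lia.
      rewrite (_ : (_ - _ - _)%R = 0) ?dvdn0//; lia.
    move=> l /eqP nl; rewrite ifF//; apply/negP => /dvdnP[q hq].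
    apply: nl; apply/val_inj => /=; have := ltn_ord l.
    case: q hq => [|q] hq; lia.
  rewrite big1// => l _; rewrite ifF//; apply/negP => /dvdnP[q hq].
  have := ltn_ord l; case: q hq => [|q] hq; lia.
apply: leq_trans (_ : #|[pred i : 'I_n | (i < k)%N]| +
                      #|[pred i : 'I_n | (n - k <= i)%N]| <= _)%N.
  rewrite -cardUI; apply: leq_trans (leq_addr _ _).
  by apply: subset_leq_card; apply/fintype.subsetP => i; rewrite !inE.
rewrite -addnn leq_add//.
  rewrite -sum1_card (eq_bigl (fun i : 'I_n => (i < k)%N))//.
  rewrite -(big_mkord (fun i => (i < k)%N) (fun=> 1%N)) sum1_count.
  rewrite -[X in (_ <= X)%N](size_iota 0 k) -size_filter.
  by apply: uniq_leq_size; rewrite ?filter_uniq ?iota_uniq// => x;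
    rewrite mem_filter !mem_iota; lia.
rewrite -sum1_card (eq_bigl (fun i : 'I_n => (n - k <= i)%N))//.
rewrite -(big_mkord (fun i => (n - k <= i)%N) (fun=> 1%N)) sum1_count.
rewrite -[X in (_ <= X)%N](size_iota (n - k) k) -size_filter.
by apply: uniq_leq_size; rewrite ?filter_uniq ?iota_uniq// => x;
  rewrite mem_filter !mem_iota; lia.
Qed.

Lemma symbol_l1_ge0 (R : realType) (k : nat) (a : int -> R[i]) :
  0 <= symbol_l1 k a.
Proof. by rewrite /symbol_l1 sumr_ge0// => i _; exact: cabs_ge0. Qed.

Lemma cabs_symbol_fun (R : realType) (k : nat) (a : int -> R[i]) (w : R[i]) :
  cabs w = 1 -> cabs (symbol_fun k a w) <= symbol_l1 k a.
Proof.
move=> w1; apply: le_trans (cabs_sum _ _ _) _; apply: ler_sum => i _.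
by rewrite cabsM cabs_exprz1// mulr1.
Qed.

(** Each row and each column has at most one 1, so every coordinate of v is copied at most once. *)
Lemma opbound_partial_perm (R : realType) (m n : nat) (r : 'I_m -> 'I_n -> bool) :
  (forall i j j', r i j -> r i j' -> j = j') ->
  (forall i i' j, r i j -> r i' j -> i = i') ->
  opbound (\matrix_(i, j) ((r i j)%:R : R[i])) 1.
Proof.
move=> h1 h2 v; rewrite mul1r -(@ler_pXn2r _ 2)// ?nnegrE ?l2norm_ge0// !l2norm_sq.
apply: le_trans (_ : \sum_i \sum_j (r i j)%:R * cabs (v j 0) ^+ 2 <= _).
  apply: ler_sum => i _; rewrite mxE.
  have [[j rij]|/forallNP h] := pselect (exists j, r i j).
    rewrite (bigD1 j)//= big1 ?addr0; last first.
      move=> j' nj; rewrite mxE; case: (boolP (r i j')) => [rij'|]; last by rewrite mul0r.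
      by rewrite (h1 _ _ _ rij' rij) eqxx in nj.
    rewrite mxE rij mul1r (bigD1 j)//= rij mul1r lerDl sumr_ge0// => j' _.
    by rewrite mulr_ge0 ?sqr_ge0.
  rewrite big1 ?cabs0 ?expr0n//=; last first.
    by move=> j _; rewrite mxE; case: (boolP (r i j)) => [/h//|]; rewrite mul0r.
  by apply: sumr_ge0 => j _; rewrite mulr_ge0 ?sqr_ge0.
rewrite exchange_big/=; apply: ler_sum => j _; rewrite -mulr_suml.
rewrite ler_piMl ?sqr_ge0//.
have [[i rij]|/forallNP h] := pselect (exists i, r i j).
  rewrite (bigD1 i)//= big1 ?addr0 ?rij// => i' ni.
  case: (boolP (r i' j)) => // rij'.
  by rewrite (h2 _ _ _ rij' rij) eqxx in ni.
by rewrite big1// => i _; case: (boolP (r i j)) => [/h//|].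
Qed.

(** A banded Toeplitz matrix is a combination of shifts with coefficients a_l, and each shift is a
    partial permutation. *)
Lemma opbound_toeplitz (R : realType) (k : nat) (a : int -> R[i]) (n : nat) :
  opbound (toeplitz_mx k a n) (symbol_l1 k a).
Proof.
have -> : toeplitz_mx k a n = \sum_(l < k.*2.+1) a (l%:Z - k%:Z) *:
    \matrix_(i, j) ((i%:Z - j%:Z == l%:Z - k%:Z)%:R : R[i]).
  apply/matrixP => i j; rewrite mxE summxE.
  case: ifP => h.
    have lt : (`|(i%:Z - j%:Z + k%:Z)%R| < k.*2.+1)%N by lia.
    rewrite (bigD1 (Ordinal lt))//= big1 ?addr0.
      have e : `|(i%:Z - j%:Z + k%:Z)%R|%N%:Z - k%:Z = i%:Z - j%:Z by lia.
      by rewrite mxE [X in _ = _ * X]mxE e eqxx mulr1.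
    move=> l /eqP nl; rewrite !mxE; case: eqP => [e|]; last by rewrite mulr0.
    by case: nl; apply/val_inj => /=; lia.
  rewrite big1// => l _; rewrite !mxE; case: eqP => [e|]; last by rewrite mulr0.
  by have := ltn_ord l; lia.
rewrite /symbol_l1; apply: opbound_sum => l; rewrite -[cabs _]mulr1.
apply: opboundZ; apply: opbound_partial_perm.
  by move=> i j j' /eqP e1 /eqP e2; apply/val_inj => /=; lia.
by move=> i i' j /eqP e1 /eqP e2; apply/val_inj => /=; lia.
Qed.

Lemma ln_1B_ge (R : realType) (x : R) : 0 <= x <= 2^-1 -> - (2 * x) <= ln (1 - x).
Proof.
move=> /andP[x0 x1]; have p : 0 < 1 - x by lra.
rewrite lerNl -lnV ?posrE//.
have -> : (1 - x)^-1 = 1 + x / (1 - x) by field; rewrite gt_eqF.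
have q : 0 <= x / (1 - x) by rewrite divr_ge0// ltW.
apply: le_trans (le_ln1Dx _) _; first lra.
rewrite ler_pdivrMr//; nra.
Qed.

Lemma ln_prod (R : realType) (I : Type) (s : seq I) (F : I -> R) :
  (forall i, 0 < F i) -> ln (\prod_(i <- s) F i) = \sum_(i <- s) ln (F i).
Proof.
move=> h; elim: s => [|i s IH]; first by rewrite !big_nil ln1.
by rewrite !big_cons lnM ?IH// posrE// prodr_gt0.
Qed.

(** It serves in two roles. With a tiny eta it is the logarithmic kernel with its singularity cut
    off; with eta a radius rho it is the exact mean of log |z - w| over the circle |w| = rho. *)
Definition logmax (R : realType) (eta : R) (z : R[i]) : R :=
  ln (Num.max (cabs z) eta).

Lemma ln_det_1D (R : realType) (n : nat) (X : 'M[R[i]]_n) (t : R) :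
  0 <= t -> t <= 2^-1 -> opbound X t ->
  `|ln (cabs (\det (1%:M + X)))| <= 2 * n%:R * t.
Proof.
move=> t0 t1 hX; set D := cabs _.
have low : (1 - t) ^+ n <= D by apply: det_1D_ge hX; lra.
have up : D <= (1 + t) ^+ n := det_1D_lowrank t0 hX (rank_leq_row X).
have p : 0 < 1 - t by lra.
have p' : 0 < 1 + t by lra.
have q : 0 < D by apply: lt_le_trans low; rewrite exprn_gt0.
move: low; rewrite -ler_ln ?posrE ?exprn_gt0// lnXn// -[ln _ *+ n]mulr_natl => low.
move: up; rewrite -ler_ln ?posrE ?exprn_gt0// lnXn// -[ln _ *+ n]mulr_natl => up.
have l1 : - (2 * t) <= ln (1 - t) by apply: ln_1B_ge; rewrite t0.
have l2 : ln (1 + t) <= t by apply: le_ln1Dx; lra.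
have nn : 0 <= n%:R :> R by [].
have m1 := ler_wpM2l nn l1; have m2 := ler_wpM2l nn l2; have m3 := mulr_ge0 nn t0.
rewrite ler_norml; apply/andP; split.
  by apply: le_trans low; rewrite -mulrA mulrCA -mulrN.
apply: le_trans up _; apply: le_trans m2 _.
by rewrite -mulrA ler_peMl// ler1n.
Qed.

(* Replacing the eigenvalues of the circulant matrix below eta in modulus by eta
   changes it by a matrix of rank #{j : |f(omega^j) - z| < eta} and makes the
   perturbation N relatively small; low rank changes cost only a factor
   (1 + norm)^rank in the determinant, in both directions. *)
Lemma logdet_compare (R : realType) (k : nat) (a : int -> R[i]) (n : nat)
    (z : R[i]) (N : 'M[R[i]]_n) (nu eta s K : R) :
  let y := fun j : 'I_n => symbol_fun k a (omega R n ^+ j) in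
  let B := toeplitz_mx k a n + N - z%:M in
  let r := (k.*2 + #|[pred j | (cabs (y j - z) < eta)%R]|)%N in
  (0 < n)%N -> 0 <= nu -> 0 < eta <= 1 -> nu / eta <= 2^-1 -> opbound N nu ->
  0 < s -> (forall v, s * l2norm v <= l2norm (B *m v)) ->
  2 * symbol_l1 k a + 2 * cabs z + 1 <= K ->
  `|ln (cabs (\det B)) - \sum_j logmax eta (y j - z)|
    <= r%:R * ln (1 + K * (s^-1 + 2 / eta)) + 2 * n%:R * (nu / eta).
Proof.
move=> y B r n0 nu0 /andP[eta0 eta1] nue hN s0 hB hK.
have l0 := symbol_l1_ge0 k a; have z0 := cabs_ge0 z.
have K0 : 0 < K by lra.
pose d := \row_j (y j - z).
pose d' := \row_j (if cabs (d 0 j) < eta then eta%:C else d 0 j).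
have cd' j : cabs (d' 0 j) = Num.max (cabs (y j - z)) eta.
  rewrite !mxE; case: ltP => h; last by [].
  by rewrite cabs_real ger0_norm// ltW.
have d'eta j : eta <= cabs (d' 0 j) by rewrite cd' le_max lexx orbT.
have d'0 j : d' 0 j != 0 by rewrite -cabs_gt0; exact: lt_le_trans (d'eta j).
have yl j : cabs (y j) <= symbol_l1 k a.
  by apply: cabs_symbol_fun; rewrite cabsX cabs_omega expr1n.
pose C := circulant d'; pose iC := circulant (\row_j (d' 0 j)^-1).
have CiC : C *m iC = 1%:M.
  rewrite circulantM// -(circulant_scalar 1 n0); congr circulant.
  by apply/rowP => j; rewrite !mxE mulfV//; have := d'0 j; rewrite !mxE.
have iCC : iC *m C = 1%:M by exact: mulmx1C.
have hiC : opbound iC eta^-1.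
  apply: opbound_circulant => //; first by rewrite invr_ge0 ltW.
  move=> j; rewrite mxE cabsV lef_pV2 ?posrE ?cabs_gt0//.
have hC : opbound C (symbol_l1 k a + cabs z + 1).
  apply: opbound_circulant => //; first by rewrite !addr_ge0.
  move=> j; rewrite cd' ge_max; apply/andP; split; last lra.
  apply: le_trans (cabsD _ _) _; rewrite cabsN; have := yl j; lra.
pose X := iC *m N.
have hX : opbound X (nu / eta).
  by rewrite mulrC; apply: opboundM => //; rewrite invr_ge0 ltW.
(* [B0] factors as C (1 + X) with X small, so its log-determinant is the sum of the [logmax] terms
   up to 2 n nu / eta. *)
pose B0 := C + N.
have B0E : B0 = C *m (1%:M + X) by rewrite mulmxDr mulmx1 mulmxA CiC mul1mx.
pose D := toeplitz_mx k a n - z%:M - C.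
have BE : B = B0 + D by rewrite /B /B0 /D [_ - C]addrC addrACA addrN add0r addrA [N + _]addrC.
have hD : opbound D K.
  apply: opbound_le hK _.
  have -> : 2 * symbol_l1 k a + 2 * cabs z + 1 =
    symbol_l1 k a + cabs z + (symbol_l1 k a + cabs z + 1) by ring.
  apply: opboundB => //; apply: opboundB; first exact: opbound_toeplitz.
  exact: opbound_scalar.
have rD : (\rank D <= r)%N.
  have -> : D = (toeplitz_mx k a n -
      circulant (\row_m symbol_fun k a (omega R n ^+ m))) + circulant (d - d').
    have -> : circulant (d - d') = circulant (\row_m symbol_fun k a (omega R n ^+ m))
        - z%:M - C.
      rewrite -(circulant_scalar z n0) !circulantB; congr circulant.
      by apply/rowP => j; rewrite !mxE.
    by rewrite [RHS]addrA [X in _ = X + _]addrA subrK.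
  apply: leq_trans (mxrank_add _ _) _; apply: leq_add.
    exact: rank_toeplitz_circulant.
  apply: leq_trans (rank_circulant _) _; apply: subset_leq_card.
  apply/fintype.subsetP => j; rewrite !inE; apply: contraNT => h.
  by rewrite !mxE (negPf h) subrr.
have lowC v : eta * l2norm v <= l2norm (C *m v).
  have := hiC (C *m v); rewrite mulmxA iCC mul1mx.
  by rewrite ler_pdivlMl.
have low0 v : eta / 2 * l2norm v <= l2norm (B0 *m v).
  rewrite B0E -mulmxA; apply: le_trans (lowC _).
  rewrite -mulrA ler_pM2l// mulmxDl mul1mx.
  have h1 := hX v.
  have h2 : l2norm v <= l2norm (v + X *m v) + l2norm (X *m v).
    rewrite -[X in X <= _](_ : l2norm (v + X *m v + (- 1) *: (X *m v)) = _).
      apply: le_trans (l2normD _ _) _.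
      by rewrite l2normZ cabsN cabs1 mul1r.
    by rewrite scaleN1r addrK.
  have := ler_wpM2r (l2norm_ge0 v) nue; lra.
have [uB0 iB0] := invmx_opbound (divr_gt0 eta0 (ltr0n _ 2)) low0.
have [uB iB] := invmx_opbound s0 hB.
have cdet (M : 'M[R[i]]_n) : M \in unitmx -> 0 < cabs (\det M).
  by rewrite unitmxE unitfE cabs_gt0.
set S := \sum_j _.
have lnB0 : ln (cabs (\det B0)) = S + ln (cabs (\det (1%:M + X))).
  rewrite B0E det_mulmx cabsM lnM ?posrE.
  - congr (_ + _); rewrite cabs_det_circulant// ln_prod.
      by apply: eq_bigr => j _; rewrite cd'.
    by move=> j; rewrite cabs_gt0.
  - by rewrite cabs_det_circulant// prodr_gt0// => j _; rewrite cabs_gt0.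
  - apply: cdet; move: uB0; rewrite B0E !unitmxE det_mulmx.
    by rewrite unitrM => /andP[].
have nue0 : 0 <= nu / eta by rewrite divr_ge0// ltW.
have lnX := ln_det_1D nue0 nue hX.
set W := 1 + K * (s^-1 + 2 / eta).
have s1 : 0 < s^-1 by rewrite invr_gt0.
have e1 : 0 < 2 / eta by rewrite divr_gt0.
have W0 : 0 < W by rewrite /W ltr_pwDl// mulr_ge0 ?addr_ge0 ?ltW.
(* Passing from M to M' multiplies the determinant by det(1 + M^-1 (M' - M)). It is applied from
   [B0] to B and back, and W is large enough for the inverse bounds of both. *)
have main (M M' : 'M[R[i]]_n) (t : R) : M \in unitmx -> M' \in unitmx -> 0 <= t ->
    opbound (invmx M) t -> t <= s^-1 + 2 / eta -> (\rank (M' - M)%R <= r)%N ->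
    opbound (M' - M) K ->
    ln (cabs (\det M')) <= ln (cabs (\det M)) + r%:R * ln W.
  move=> uM uM' t0 iM tle rk oK.
  have M'E : M' = M *m (1%:M + invmx M *m (M' - M)).
    by rewrite mulmxDr mulmx1 mulmxA mulmxV// mul1mx addrC subrK.
  have ob : opbound (invmx M *m (M' - M)) (t * K) by exact: opboundM.
  have rk2 : (\rank (invmx M *m (M' - M)) <= r)%N.
    exact: leq_trans (mxrankM_maxr _ _) rk.
  have tK : 0 <= t * K by rewrite mulr_ge0// ltW.
  have := det_1D_lowrank tK ob rk2 => h.
  have u1 : 0 < cabs (\det (1%:M + invmx M *m (M' - M))).
    apply: cdet; move: uM'; rewrite {1}M'E !unitmxE det_mulmx unitrM.
    by case/andP.
  rewrite {1}M'E det_mulmx cabsM lnM ?posrE ?u1 ?(cdet _ uM)// lerD2l.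
  rewrite mulr_natl -lnXn// ler_ln ?posrE ?exprn_gt0//.
  apply: le_trans h _; apply: lerXn2r; rewrite ?nnegrE ?(ltW W0)//.
    by rewrite addr_ge0.
  by rewrite /W lerD2l mulrC ler_wpM2l// ltW.
have m1 : ln (cabs (\det B)) <= ln (cabs (\det B0)) + r%:R * ln W.
  have BN : B - B0 = D by rewrite BE addrC addKr.
  apply: (main B0 B (eta / 2)^-1 uB0 uB _ iB0).
  - by rewrite invr_ge0 divr_ge0// ltW.
  - by rewrite invf_div lerDr ltW.
  - by rewrite BN.
  - by rewrite BN.
have m2 : ln (cabs (\det B0)) <= ln (cabs (\det B)) + r%:R * ln W.
  have BN : B0 - B = - D by rewrite BE opprD addrA subrr add0r.
  apply: (main B B0 s^-1 uB uB0 (ltW s1) iB).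
  - by rewrite lerDl ltW.
  - by rewrite BN mxrank_opp.
  - by rewrite BN; exact: opboundN.
rewrite lnB0 in m1 m2.
rewrite ler_norml; apply/andP; split.
  rewrite lerBrDl; apply: le_trans (_ : S + ln (cabs (\det (1%:M + X))) - r%:R * ln W <= _).
    rewrite -[leRHS]addrA lerD2l opprD [leLHS]addrC lerD2r.
    by move: lnX; rewrite ler_norml => /andP[].
  by rewrite lerBlDr.
rewrite lerBlDl; apply: le_trans m1 _.
rewrite -addrA lerD2l addrC lerD2l.
by move: lnX; rewrite ler_norml => /andP[].
Qed.

(** * Smallest singular value *)

Lemma l2norm_mul_dot (R : realType) (n : nat) (B : 'M[R[i]]_n) (v : 'cV[R[i]]_n) :
  ((v ^t*)%sesqui *m ((B ^t*)%sesqui *m B *m v)) 0 0 = (l2norm (B *m v) ^+ 2)%:C.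
Proof. by rewrite -l2norm_dot trmx_mul map_mxM/= !mulmxA. Qed.

Lemma eigvals_gram (R : realType) (n : nat) (B : 'M[R[i]]_n) (z : R[i]) :
  z \in eigvals ((B ^t*)%sesqui *m B) -> z = (complex.Re z)%:C /\ 0 <= complex.Re z.
Proof.
move=> /eigvals_eigenvector[v v0 hv].
have := l2norm_mul_dot B v; rewrite hv -scalemxAr mxE l2norm_dot => h.
have p : 0 < l2norm v ^+ 2 by rewrite exprn_gt0// l2norm_gt0.
have zE : z = (l2norm (B *m v) ^+ 2 / l2norm v ^+ 2)%:C.
  rewrite rmorphM/= -h fmorphV/= mulfK//.
  by apply/negP => /eqP/complexI/eqP; rewrite gt_eqF.
by rewrite zE /=; split=> //; rewrite divr_ge0 ?sqr_ge0.
Qed.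

(** A condition on every Gram eigenvalue does not depend on their order; these eigenvalues are real
    and nonnegative, so square roots can be removed. *)
Lemma sigma_min_gtP (R : realType) (n : nat) (B : 'M[R[i]]_n) (c : R) :
  (0 < n)%N -> 0 <= c ->
  c < sigma_min B <->
  (forall z, z \in eigvals ((B ^t*)%sesqui *m B) -> c ^+ 2 < complex.Re z).
Proof.
move=> n0 c0; set H := _ *m B.
have sz : c < sigma_min B <-> (forall z, z \in eigvals H -> c < Num.sqrt (complex.Re z)).
  rewrite /sigma_min; set s := singular_values B.
  (* The default value of the minimum belongs to the list because 0 < n, so it adds no
     constraint. *)
  have s0 : head 0 s \in s.
    rewrite /s /singular_values -/H; move: (size_eigvals H).
    case: (eigvals H) => [n0'|x l _]; last by rewrite /= mem_head.
    by rewrite -n0' in n0.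
  have minE (x0 : R) (l : seq R) :
      (c < \big[Num.min/x0]_(x <- l) x) = (c < x0) && all (fun x => c < x) l.
    elim: l => [|x l IH]; first by rewrite big_nil andbT.
    by rewrite big_cons lt_min IH/= andbCA.
  have -> : (c < \big[Num.min/head 0 s]_(x <- s) x) = all (fun x => c < x) s.
    by rewrite minE andb_idl// => /allP; apply.
  rewrite /s /singular_values -/H all_map; split.
    by move=> /allP h z hz; exact: h.
  by move=> h; apply/allP => z hz; exact: h.
rewrite sz; split=> h z hz; have h' := h z hz; have [_ z0] := eigvals_gram hz.
  move: h'; rewrite -{1}(ger0_norm c0) -sqrtr_sqr.
  by case: (ltgtP (c ^+ 2) (complex.Re z)) => //;
    [move=> /ltW /ler_wsqrtr; rewrite leNgt => /negbTE->|move=> ->; rewrite ltxx].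
rewrite -(ger0_norm c0) -sqrtr_sqr ltr_sqrt//.
by apply: le_lt_trans h'; exact: sqr_ge0.
Qed.

(** Diagonalizing the Gram matrix by a unitary P gives |Bv|^2 = sum_j d_j |w_j|^2 with w = Pv and
    all d_j > c^2. *)
Lemma sigma_min_lower (R : realType) (n : nat) (B : 'M[R[i]]_n) (c : R)
    (v : 'cV[R[i]]_n) :
  (0 < n)%N -> 0 <= c -> c < sigma_min B -> c * l2norm v <= l2norm (B *m v).
Proof.
move=> n0 c0 /(sigma_min_gtP B n0 c0); set H := _ *m B => hH.
have nH : H \is normalmx.
  by apply/normalmxP; rewrite /H trmx_mul map_mxM/= trmxCK.
have /orthomx_spectralP HE := nH.
set P := spectralmx H in HE; set d := spectral_diag H in HE.
have uP : P \is unitarymx := spectral_unitarymx H.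
have iP : P \in unitmx := spectral_unit H.
have dH i : d 0 i \in eigvals H.
  rewrite mem_eigvals /root char_poly_horner.
  have -> : (d 0 i)%:M - H = invmx P *m ((d 0 i)%:M - diag_mx d) *m P.
    by rewrite mulmxBr mulmxBl -HE mul_mx_scalar -scalemxAl mulVmx// scalemx1.
  rewrite !det_mulmx; set D := _ - diag_mx d.
  have -> : D = diag_mx (\row_j (d 0 i - d 0 j)).
    by apply/matrixP => a b; rewrite !mxE -mulrnBl.
  by rewrite det_diag (bigD1 i)//= mxE subrr mul0r mulr0 mul0r.
rewrite -(@ler_pXn2r _ 2)// ?nnegrE ?mulr_ge0 ?l2norm_ge0//.
rewrite -(l2norm_unitary v uP) exprMn -lecR -l2norm_mul_dot -/H HE.
have -> : (v ^t*)%sesqui *m (invmx P *m diag_mx d *m P *m v) =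
    ((P *m v) ^t*)%sesqui *m (diag_mx d *m (P *m v)).
  by rewrite trmx_mul map_mxM/= -invmx_unitary// !mulmxA.
move: (P *m v) => w; rewrite l2norm_sq mxE mulr_sumr rmorph_sum/=.
apply: ler_sum => j _; rewrite mul_diag_mx !mxE.
have [dr _] := eigvals_gram (dH j); rewrite {}dr.
have -> : (w j 0)^* * ((complex.Re (d 0 j))%:C * w j 0) =
    (complex.Re (d 0 j) * cabs (w j 0) ^+ 2)%:C.
  by rewrite rmorphM rmorphXn/= -cabsE normCK mulrCA [X in _ = _ * X]mulrC.
rewrite lecR ler_wpM2r ?sqr_ge0//.
exact/ltW/hH.
Qed.

(** The coefficients of a characteristic polynomial, unlike a chosen list of its roots, are
    polynomial in the matrix entries; measurability is carried by them. *)
Definition pmeasurable (R : realType) (d : measure_display) (T : measurableType d)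
    (F : T -> {poly R[i]}) :=
  forall j, measurable_fun setT (fun t => complex.Re (F t)`_j) /\
            measurable_fun setT (fun t => complex.Im (F t)`_j).

Lemma pmeasurable_cst (R : realType) d (T : measurableType d) (p : {poly R[i]}) :
  pmeasurable (fun _ : T => p).
Proof. by move=> j; split; exact: measurable_cst. Qed.

Lemma pmeasurableD (R : realType) d (T : measurableType d) (F G : T -> {poly R[i]}) :
  pmeasurable F -> pmeasurable G -> pmeasurable (fun t => F t + G t).
Proof.
move=> mF mG j; have [f1 f2] := mF j; have [g1 g2] := mG j.
split; under eq_fun do rewrite coefD raddfD; exact: measurable_funD.
Qed.

Lemma pmeasurable_sum (R : realType) d (T : measurableType d) (I : Type) (s : seq I)
    (F : I -> T -> {poly R[i]}) :
  (forall i, pmeasurable (F i)) -> pmeasurable (fun t => \sum_(i <- s) F i t).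
Proof.
move=> mF; elim: s => [|i s IH].
  by under eq_fun do rewrite big_nil; exact: pmeasurable_cst.
by under eq_fun do rewrite big_cons; exact: pmeasurableD.
Qed.

Lemma cmeasurable_mul (R : realType) d (T : measurableType d) (g h : T -> R[i]) :
  measurable_fun setT (fun t => complex.Re (g t)) /\
  measurable_fun setT (fun t => complex.Im (g t)) ->
  measurable_fun setT (fun t => complex.Re (h t)) /\
  measurable_fun setT (fun t => complex.Im (h t)) ->
  measurable_fun setT (fun t => complex.Re (g t * h t)) /\
  measurable_fun setT (fun t => complex.Im (g t * h t)).
Proof.
move=> [gr gi] [hr hi]; split.
  rewrite (_ : (fun t => _) = (fun t =>
     complex.Re (g t) * complex.Re (h t) -
     complex.Im (g t) * complex.Im (h t))); last first.
    by apply/funext => t; case: (g t) (h t) => [? ?] [? ?].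
  by apply: measurable_funB; exact: measurable_funM.
rewrite (_ : (fun t => _) = (fun t =>
   complex.Re (g t) * complex.Im (h t) +
   complex.Im (g t) * complex.Re (h t))); last first.
  by apply/funext => t; case: (g t) (h t) => [? ?] [? ?].
by apply: measurable_funD; exact: measurable_funM.
Qed.

Lemma pmeasurableM (R : realType) d (T : measurableType d) (F G : T -> {poly R[i]}) :
  pmeasurable F -> pmeasurable G -> pmeasurable (fun t => F t * G t).
Proof.
move=> mF mG j.
have h (i : 'I_j.+1) := cmeasurable_mul (mF i) (mG (j - i)%N).
split; under eq_fun do rewrite coefM raddf_sum; apply: measurable_sum => i.
- by have [] := h i.
- by have [] := h i.
Qed.

Lemma pmeasurable_prod (R : realType) d (T : measurableType d) (I : Type) (s : seq I)
    (F : I -> T -> {poly R[i]}) :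
  (forall i, pmeasurable (F i)) -> pmeasurable (fun t => \prod_(i <- s) F i t).
Proof.
move=> mF; elim: s => [|i s IH].
  by under eq_fun do rewrite big_nil; exact: pmeasurable_cst.
by under eq_fun do rewrite big_cons; exact: pmeasurableM.
Qed.

Lemma pmeasurableC (R : realType) d (T : measurableType d) (g : T -> R[i]) :
  measurable_fun setT (fun t => complex.Re (g t)) /\
  measurable_fun setT (fun t => complex.Im (g t)) ->
  pmeasurable (fun t => (g t)%:P).
Proof.
move=> [g1 g2] [|j]; split; under eq_fun do rewrite coefC /=.
- exact: g1.
- exact: g2.
- exact: measurable_cst.
- exact: measurable_cst.
Qed.

Lemma pmeasurable_gram_char_poly (R : realType) d (T : measurableType d) (n : nat)
    (M : T -> 'M[R[i]]_n) :
  (forall i j, measurable_fun setT (fun t => complex.Re (M t i j)) /\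
               measurable_fun setT (fun t => complex.Im (M t i j))) ->
  pmeasurable (fun t => char_poly (((M t) ^t*)%sesqui *m M t)).
Proof.
move=> mM; rewrite /char_poly /determinant.
apply: pmeasurable_sum => s; apply: pmeasurableM; first exact: pmeasurable_cst.
apply: pmeasurable_prod => i.
rewrite (_ : (fun t => _) = (fun t => 'X *+ (i == s i) +
    (-1) * \sum_k ((M t k i)^*)%:P * (M t k (s i))%:P)); last first.
  apply/funext => t; rewrite !mxE mulN1r rmorph_sum/=; congr (_ - _).
  by apply: eq_bigr => k _; rewrite !mxE rmorphM.
apply: pmeasurableD; first exact: pmeasurable_cst.
apply: pmeasurableM; first exact: pmeasurable_cst.
apply: pmeasurable_sum => k; apply: pmeasurableM; last exact: pmeasurableC.
apply: pmeasurableC; have [m1 m2] := mM k i; split.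
  rewrite (_ : (fun t => _) = (fun t => complex.Re (M t k i)))//.
  by apply/funext => t; case: (M t k i).
rewrite (_ : (fun t => _) = (fun t => - complex.Im (M t k i))).
  exact: measurableT_comp.
by apply/funext => t; case: (M t k i).
Qed.

(** The constant size makes the composition a sum over an index range that does not vary with t. *)
Lemma pmeasurable_comp (R : realType) d (T : measurableType d) (n : nat)
    (F : T -> {poly R[i]}) (q : {poly R[i]}) :
  (forall t, size (F t) = n) -> pmeasurable F -> pmeasurable (fun t => F t \Po q).
Proof.
move=> hn mF; rewrite (_ : (fun t => _) =
    (fun t => \sum_(i < n) ((F t)`_i)%:P * q ^+ i)); last first.
  apply/funext => t; rewrite comp_polyE hn.
  by apply: eq_bigr => i _; rewrite mul_polyC.
apply: pmeasurable_sum => i; apply: pmeasurableM; last exact: pmeasurable_cst.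
exact: pmeasurableC.
Qed.

Lemma prod_XsubC_comp (R : comNzRingType) (s : seq R) (c : R) :
  (\prod_(z <- s) ('X - z%:P)) \Po (c%:P - 'X) =
  (-1) ^+ size s * \prod_(z <- s) ('X + (z - c)%:P).
Proof.
elim: s => [|z s IH]; first by rewrite !big_nil comp_polyC mulr1.
rewrite !big_cons comp_polyM IH comp_polyB comp_polyX comp_polyC exprS polyCB.
by ring.
Qed.

(** A y <= 0 in s would make -y >= 0 a root, whereas a polynomial with positive coefficients is
    positive there. Conversely, multiplying by X + y with y > 0 keeps the coefficients positive. *)
Lemma coef_prod_XaddC_gt0 (R : realDomainType) (s : seq R) :
  (forall i, (i <= size s)%N -> 0 < (\prod_(y <- s) ('X + y%:P))`_i) <->
  (forall y, y \in s -> 0 < y).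
Proof.
split=> [h y ys|].
  rewrite ltNge; apply/negP => y0.
  have root0 : (\prod_(y <- s) ('X + y%:P)).[- y] = 0.
    rewrite horner_prod (big_rem y)//= !hornerE addNr mul0r.
    by [].
  move: root0; set p := \prod_(_ <- _) _.
  have sp : size p = (size s).+1.
    rewrite /p (eq_bigr (fun y => 'X - (- y)%:P)) ?size_prod_XsubC//.
    by move=> x _; rewrite polyCN opprK.
  rewrite horner_coef sp big_ord_recl/= expr0 mulr1 => /eqP.
  rewrite gt_eqF// ltr_wpDr ?h// sumr_ge0// => i _.
  rewrite mulr_ge0 ?exprn_ge0 ?oppr_ge0// ltW// h//.
elim: s => [|y s IH] h i hi.
  by move: hi; rewrite leqn0 => /eqP->; rewrite big_nil coef1 ltr01.
have {}IH := IH (fun y' ys => h y' (mem_behead (s := y :: s) ys)).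
have y0 : 0 < y by apply: h; rewrite mem_head.
rewrite big_cons mulrDl coefD coefXM coefCM.
set p := \prod_(_ <- _) _ in IH *.
have p0 j : 0 <= p`_j.
  have [/IH/ltW//|hj] := leqP j (size s).
  rewrite nth_default//; apply: leq_trans hj.
  rewrite /p (eq_bigr (fun y => 'X - (- y)%:P)) ?size_prod_XsubC//.
  by move=> x _; rewrite polyCN opprK.
case: i hi => [|i] hi /=; first by rewrite add0r mulr_gt0// IH.
by rewrite ltr_wpDr ?IH// mulr_ge0// ltW.
Qed.

(* sigma_min > c iff the monic real-rooted polynomial prod_i (X + s_i^2 - c^2), read
   off the characteristic polynomial of the Gram matrix, has positive coefficients;
   this avoids the arbitrary order in which the eigenvalues are chosen. *)
Lemma measurable_sigma_min_gt (R : realType) d (T : measurableType d) (n : nat)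
    (M : T -> 'M[R[i]]_n) (c : R) :
  (0 < n)%N -> 0 <= c ->
  (forall i j, measurable_fun setT (fun t => complex.Re (M t i j)) /\
               measurable_fun setT (fun t => complex.Im (M t i j))) ->
  measurable [set t | c < sigma_min (M t)].
Proof.
move=> n0 c0 mM.
pose H t := ((M t) ^t*)%sesqui *m M t.
pose F t := (-1) ^+ n * (char_poly (H t) \Po ((c ^+ 2)%:C%:P - 'X)).
have mF : pmeasurable F.
  apply: pmeasurableM; first exact: pmeasurable_cst.
  apply: (@pmeasurable_comp _ _ _ n.+1); first by move=> t; rewrite size_char_poly.
  exact: pmeasurable_gram_char_poly.
rewrite (_ : [set t | _] =
    \bigcap_(i in [set i | (i <= n)%N]) [set t | 0 < complex.Re (F t)`_i]).
  apply: bigcap_measurable; first by exists 0%N.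
  move=> i _; have [m1 _] := mF i.
  rewrite (_ : [set t | _] = setT `&`
      (fun t => complex.Re (F t)`_i) @^-1` [set` `]0, +oo[]).
    exact: m1.
  by apply/seteqP; split=> t /=; rewrite in_itv/= andbT//; case.
have FE t i : (F t)`_i = ((\prod_(y <- [seq complex.Re z - c ^+ 2 | z <- eigvals (H t)])
    ('X + y%:P))`_i)%:C.
  rewrite -coef_map; congr (coefp i _).
  rewrite /F char_poly_eigvals prod_XsubC_comp size_eigvals mulrA -exprMn.
  rewrite mulrNN mulr1 expr1n mul1r rmorph_prod big_map.
  have zr z : z \in eigvals (H t) -> z = (complex.Re z)%:C by move=> /eigvals_gram[].
  elim: (eigvals (H t)) zr => [|z l IH] zr; first by rewrite !big_nil.
  rewrite !big_cons IH; last by move=> x xl; apply: zr; rewrite in_cons xl orbT.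
  congr (_ * _).
  rewrite (rmorphD (map_poly (real_complex R)))/= map_polyX map_polyC/=.
  rewrite {1}(zr z (mem_head _ _)).
  by rewrite -rmorphB.
have key t := coef_prod_XaddC_gt0 [seq complex.Re z - c ^+ 2 | z <- eigvals (H t)].
apply/seteqP; split=> t /=.
  move=> /(sigma_min_gtP _ n0 c0) h i hi /=; rewrite FE.
  have /key : forall y, y \in [seq complex.Re z - c ^+ 2 | z <- eigvals (H t)] -> 0 < y.
    by move=> y /mapP[z hz ->]; rewrite subr_gt0; exact: h.
  by apply; rewrite size_map size_eigvals.
move=> h; apply/(sigma_min_gtP _ n0 c0) => z hz; rewrite -subr_gt0.
apply: (proj1 (key t)); last exact: map_f.
by move=> i; rewrite size_map size_eigvals => /h /=; rewrite FE.
Qed.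

(** * Logarithmic potentials on rings *)

Lemma bernoulli_ge (R : realType) (y : R) (m : nat) :
  -1 <= y -> 1 + m%:R * y <= (1 + y) ^+ m.
Proof.
move=> y1; elim: m => [|m IH]; first by rewrite mul0r addr0 expr0.
rewrite exprS; apply: le_trans (_ : (1 + y) * (1 + m%:R * y) <= _); last first.
  by rewrite ler_wpM2l//; lra.
rewrite -natr1; have := mulr_ge0 (ler0n R m) (sqr_ge0 y); lra.
Qed.

(** With t = 1/(2m), Bernoulli gives (1 - t)^m >= 1/2, and (1 + t)(1 - t) <= 1. *)
Lemma exp_1Dinv_le2 (R : realType) (m : nat) : (0 < m)%N ->
  (1 + (2 * m%:R)^-1) ^+ m <= 2 :> R.
Proof.
move=> m0; have mR : 0 < m%:R :> R by rewrite ltr0n.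
set t := (2 * m%:R)^-1.
have mt : m%:R * t = 2^-1 by rewrite /t; field; rewrite gt_eqF.
have t0 : 0 < t by rewrite invr_gt0 mulr_gt0.
have t1 : t <= 2^-1.
  by rewrite -mt ler_peMl ?(ltW t0)// ler1n.
have h : 2^-1 <= (1 - t) ^+ m.
  have := @bernoulli_ge R (- t) m; rewrite mulrN mt => h.
  by apply: le_trans (h _); lra.
have p : 0 < (1 - t) ^+ m by lra.
have q : (1 + t) ^+ m * (1 - t) ^+ m <= 1.
  rewrite -exprMn exprn_ile1//; nra.
have := ler_wpM2l (exprn_ge0 m (ltW (addr_gt0 ltr01 t0))) h.
lra.
Qed.

Lemma prod_circle (R : realType) (m : nat) (x : R[i]) (rho : R) :
  (0 < m)%N -> rho != 0 ->
  \prod_(u < m) (x - rho%:C * omega R m ^+ u) = x ^+ m - (rho ^+ m)%:C.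
Proof.
move=> m0 r0; have rc0 : rho%:C != 0 :> R[i].
  by apply: contraNneq r0 => /complexI ->.
have := congr1 (fun p => p.[x / rho%:C]) (factor_Xn_sub_1 (omega_prim R m0)).
rewrite big_mkord horner_prod -polyC1 hornerD hornerN hornerXn hornerC => h.
have -> : x ^+ m - (rho ^+ m)%:C = rho%:C ^+ m * ((x / rho%:C) ^+ m - 1).
  by rewrite mulrBr -exprMn mulrC divfK// mulr1 rmorphXn.
rewrite -h -[X in _ ^+ X](card_ord m) -prodr_const -big_split/=.
by apply: eq_bigr => u _; rewrite hornerXsubC mulrBr mulrCA mulfV// mulr1.
Qed.

Lemma logmax_le (R : realType) (eta t : R) (z : R[i]) :
  0 < eta -> cabs z <= t -> eta <= t -> logmax eta z <= ln t.
Proof.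
move=> e0 zt et; rewrite /logmax ler_ln ?posrE ?ge_max ?zt//.
  by rewrite lt_max e0 orbT.
exact: lt_le_trans et.
Qed.

Lemma logmax_ge (R : realType) (eta : R) (z : R[i]) :
  0 < eta -> ln eta <= logmax eta z.
Proof.
by move=> e0; rewrite /logmax ler_ln ?posrE ?lt_max ?le_max ?lexx ?e0 ?orbT.
Qed.

(** When the m-th powers of |x| and rho differ by a factor 2, the exact product |x^m - rho^m| is
    within a factor 2 of their maximum, and no point of the circle is close enough to x for the
    floor eta to act. *)
Lemma circle_far (R : realType) (m : nat) (x : R[i]) (rho eta : R) :
  (0 < m)%N -> 0 < rho -> 0 < eta -> eta <= rho / (2 * m%:R) ->
  2 * rho ^+ m <= cabs x ^+ m \/ 2 * cabs x ^+ m <= rho ^+ m ->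
  `|\sum_(u < m) logmax eta (x - rho%:C * omega R m ^+ u) -
    m%:R * logmax rho x| <= ln 2.
Proof.
move=> m0 r0 e0 er far; have mR : 0 < m%:R :> R by rewrite ltr0n.
have x0 := cabs_ge0 x; have rm := exprn_gt0 m r0.
(* A radius closer than rho/(2m) would contradict (1 + 1/(2m))^m <= 2 or (1 - 1/(2m))^m >= 1/2. *)
have gap : rho / (2 * m%:R) <= `|cabs x - rho|.
  case: far => far.
    rewrite ger0_norm; last first.
      rewrite subr_ge0 -(@ler_pXn2r _ m)// ?nnegrE// ?ltW//; lra.
    rewrite lerBrDl leNgt; apply/negP => h.
    have : cabs x ^+ m < rho ^+ m * 2.
      apply: lt_le_trans (_ : (rho * (1 + (2 * m%:R)^-1)) ^+ m <= _).
        rewrite mulrDr mulr1 ltr_pXn2r ?nnegrE//.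
        by rewrite addr_ge0 ?(ltW r0)// ltW// divr_gt0// mulr_gt0.
      by rewrite exprMn ler_pM2l// exp_1Dinv_le2.
    lra.
  rewrite ler0_norm; last first.
    rewrite subr_le0 -(@ler_pXn2r _ m)// ?nnegrE// ?ltW//; have := exprn_ge0 m x0; lra.
  rewrite opprB lerBrDl -lerBrDr leNgt; apply/negP => h.
  have t1 : (2 * m%:R)^-1 <= 1 :> R.
    by rewrite invf_le1 ?mulr_gt0// -natrM ler1n muln_gt0.
  have : rho ^+ m * 2^-1 < cabs x ^+ m.
    apply: le_lt_trans (_ : (rho * (1 - (2 * m%:R)^-1)) ^+ m < _).
      rewrite exprMn ler_pM2l//.
      have := @bernoulli_ge R (- (2 * m%:R)^-1) m.
      have -> : 1 + m%:R * - (2 * m%:R)^-1 = 2^-1 :> R by field; rewrite gt_eqF.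
      by apply; lra.
    rewrite ltr_pXn2r ?nnegrE ?mulr_ge0 ?subr_ge0 ?(ltW r0)//.
    by rewrite mulrBr mulr1.
  lra.
have zle u : rho / (2 * m%:R) <= cabs (x - rho%:C * omega R m ^+ u).
  apply: le_trans gap _; rewrite ler_norml.
  have c1 : cabs (rho%:C * omega R m ^+ u) = rho.
    by rewrite cabsM cabs_real ger0_norm ?ltW// cabsX cabs_omega expr1n mulr1.
  have := ler_cabsB x (rho%:C * omega R m ^+ u).
  have := ler_cabsB (rho%:C * omega R m ^+ u) x; rewrite cabs_subC c1.
  by move=> *; apply/andP; split; lra.
have g0 : 0 < rho / (2 * m%:R) by rewrite divr_gt0// mulr_gt0.
have -> : \sum_(u < m) logmax eta (x - rho%:C * omega R m ^+ u) =
    ln (cabs (x ^+ m - (rho ^+ m)%:C)).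
  rewrite -prod_circle ?gt_eqF// cabs_prod ln_prod.
    apply: eq_bigr => u _; rewrite /logmax max_l//.
    exact: le_trans er (zle u).
  by move=> u; exact: lt_le_trans g0 (zle u).
set M := Num.max (cabs x ^+ m) (rho ^+ m).
have ME : m%:R * logmax rho x = ln M.
  rewrite /logmax mulr_natl -lnXn ?lt_max ?r0 ?orbT//; congr ln.
  rewrite /M; case: (leP (cabs x) rho) => h.
    by rewrite max_r// lerXn2r ?nnegrE// ltW.
  by rewrite max_l// lerXn2r ?nnegrE// ltW.
have M0 : 0 < M by rewrite lt_max rm orbT.
rewrite ME; set D := cabs _.
have cr : cabs (rho ^+ m)%:C = rho ^+ m by rewrite cabs_real ger0_norm// ltW.
have up : D <= 2 * M.
  apply: le_trans (cabsD _ _) _; rewrite cabsN cabsX cr.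
  have h1 : cabs x ^+ m <= M by rewrite le_max lexx.
  have h2 : rho ^+ m <= M by rewrite le_max lexx orbT.
  lra.
have low : M / 2 <= D.
  have h1 := ler_cabsB (x ^+ m) (rho ^+ m)%:C.
  have := ler_cabsB (rho ^+ m)%:C (x ^+ m).
  rewrite cabs_subC -/D cr cabsX => h2; rewrite cabsX cr -/D in h1.
  have xm := exprn_ge0 m x0.
  have aux (X Y D' : R) : 0 <= X -> 0 < Y -> X - Y <= D' -> Y - X <= D' ->
      2 * Y <= X \/ 2 * X <= Y -> Num.max X Y / 2 <= D'.
    by move=> ? ? ? ? [] ?; case: (leP X Y) => ?; lra.
  exact: aux far.
have D0 : 0 < D by apply: lt_le_trans low; rewrite divr_gt0.
move: up low; rewrite -ler_ln ?posrE ?mulr_gt0// lnM ?posrE// => up.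
rewrite -ler_ln ?posrE ?divr_gt0// ln_div ?posrE// => low.
by rewrite ler_norml; apply/andP; split; lra.
Qed.

(** A crude bound, term by term: here |x| <= 2 rho, so both logarithms lie between ln eta and ln(4
    rho). *)
Lemma circle_near (R : realType) (m : nat) (x : R[i]) (rho eta : R) :
  (0 < m)%N -> 0 < rho -> 0 < eta -> eta <= rho -> cabs x ^+ m <= 2 * rho ^+ m ->
  `|\sum_(u < m) logmax eta (x - rho%:C * omega R m ^+ u) -
    m%:R * logmax rho x| <= m%:R * ln (4 * rho / eta).
Proof.
move=> m0 r0 e0 er near; have mR : 0 < m%:R :> R by rewrite ltr0n.
have x2 : cabs x <= 2 * rho.
  rewrite -(@ler_pXn2r _ m)// ?nnegrE ?cabs_ge0 ?mulr_ge0 ?(ltW r0)//.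
  apply: le_trans near _; rewrite exprMn ler_pM2r ?exprn_gt0//.
  by rewrite -[leLHS]expr1 ler_weXn2l// ler1n.
have lnq : ln (4 * rho / eta) = ln (4 * rho) - ln eta.
  by rewrite ln_div ?posrE ?mulr_gt0.
have ln4 : ln (4 * rho) = ln 4 + ln rho by rewrite lnM ?posrE.
have ln42 : ln (4 : R) = ln 2 + ln 2 by rewrite -lnM ?posrE//; congr ln; ring.
have ln20 : 0 < ln (2 : R) by rewrite ln_gt0// ltr1n.
have G1 : ln rho <= logmax rho x by exact: logmax_ge.
have G2 : logmax rho x <= ln (2 * rho) by apply: logmax_le => //; lra.
have ln2r : ln (2 * rho) = ln 2 + ln rho by rewrite lnM ?posrE.
have lner : ln eta <= ln rho by rewrite ler_ln ?posrE.
have const (c : R) : m%:R * c = \sum_(u < m) c.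
  by rewrite sumr_const card_ord mulr_natl.
rewrite !const -sumrB.
apply: le_trans (ler_norm_sum _ _ _) _; apply: ler_sum => u _.
have c1 : cabs (rho%:C * omega R m ^+ u) = rho.
  by rewrite cabsM cabs_real ger0_norm ?ltW// cabsX cabs_omega expr1n mulr1.
have U : logmax eta (x - rho%:C * omega R m ^+ u) <= ln (4 * rho).
  apply: logmax_le => //; last lra.
  by apply: le_trans (cabsD _ _) _; rewrite cabsN c1; lra.
have V : ln eta <= logmax eta (x - rho%:C * omega R m ^+ u) by exact: logmax_ge.
by rewrite ler_norml; apply/andP; split; lra.
Qed.

Definition ring_rad (R : realType) (L : nat) (r : R) (l : nat) : R :=
  r * (L + l)%:R / L%:R.

Lemma ring_rad_bounds (R : realType) (L : nat) (r : R) (l : nat) :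
  (l < L)%N -> 0 < r -> r <= ring_rad L r l <= 2 * r.
Proof.
move=> lL r0; have L0 : 0 < L%:R :> R by rewrite ltr0n (leq_ltn_trans _ lL).
rewrite /ring_rad; apply/andP; split.
  by rewrite ler_pdivlMr// ler_pM2l// ler_nat leq_addr.
rewrite ler_pdivrMr//.
have h : (L + l)%:R <= 2 * L%:R :> R by rewrite -natrM ler_nat; lia.
by have := ler_wpM2l (ltW r0) h; lra.
Qed.

(** Distinct radii have ratio at least 1 + 1/(2L), whose power 6L is at least 1 + 3 by Bernoulli;
    this fixes the number 6L of points per circle. *)
Lemma ring_rad_ratio (R : realType) (L : nat) (r : R) (l l' : nat) :
  (l < l')%N -> (l' < L)%N -> 0 < r ->
  4 * ring_rad L r l ^+ (6 * L) <= ring_rad L r l' ^+ (6 * L).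
Proof.
move=> ll' l'L r0; have L0 : 0 < L%:R :> R by rewrite ltr0n (leq_ltn_trans _ l'L).
have q0 : 0 < (L + l)%:R :> R by rewrite ltr0n; lia.
have -> : ring_rad L r l' = ring_rad L r l * (1 + (l' - l)%:R / (L + l)%:R).
  rewrite /ring_rad natrB ?(ltnW ll')// !natrD.
  by field; rewrite -natrD !gt_eqF.
apply: le_trans (_ : ring_rad L r l ^+ (6 * L) * 4 <= _); first by rewrite mulrC.
rewrite [leRHS]exprMn; apply: ler_wpM2l.
  by rewrite exprn_ge0// /ring_rad divr_ge0 ?mulr_ge0// ltW.
apply: le_trans (bernoulli_ge _ _); last first.
  by rewrite (le_trans (lerN10 _))// divr_ge0.
rewrite mulrA; apply: le_trans (_ : 1 + 3 <= _); first lra.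
rewrite lerD2l ler_pdivlMr// -!natrM ler_nat.
have : (L + l <= 2 * L)%N by lia.
have : (1 <= l' - l)%N by lia.
nia.
Qed.

(* With m = 6L points per circle, the m-th powers of distinct radii differ by a factor
   at least 4, so |x|^m is comparable to rho^m for at most one of the L radii rho. *)
Lemma ring_sum_approx (R : realType) (L : nat) (x : R[i]) (r eta : R) :
  (0 < L)%N -> 0 < r -> 0 < eta -> eta <= r / (2 * (6 * L)%:R) ->
  `|\sum_(l < L) \sum_(u < 6 * L) logmax eta (x - (ring_rad L r l)%:C * omega R (6 * L) ^+ u) -
    (6 * L)%:R * \sum_(l < L) logmax (ring_rad L r l) x| <=
  (6 * L)%:R * (1 + ln (8 * r / eta)).
Proof.
move=> L0 r0 e0 er; set m := (6 * L)%N.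
have m0 : (0 < m)%N by rewrite muln_gt0.
have mR : 0 < m%:R :> R by rewrite ltr0n.
pose near l := (ring_rad L r l ^+ m < 2 * cabs x ^+ m) && (cabs x ^+ m < 2 * ring_rad L r l ^+ m).
have re : eta <= r.
  apply: le_trans er _; rewrite ler_pdivrMr ?mulr_gt0// ler_peMr ?ltW//.
  by rewrite -natrM ltr1n /m; lia.
pose Lam := ln (8 * r / eta).
have Lam0 : 0 <= Lam.
  rewrite /Lam ln_ge0// ler_pdivlMr//; lra.
rewrite mulr_sumr -sumrB; apply: le_trans (ler_norm_sum _ _ _) _.
apply: le_trans (_ : \sum_(l < L) (ln 2 + (if near l then m%:R * Lam else 0)) <= _).
  apply: ler_sum => l _; have /andP[b1 b2] := ring_rad_bounds (ltn_ord l) r0.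
  have p : 0 < ring_rad L r l by exact: lt_le_trans b1.
  have ln20 : 0 <= ln (2 : R) by rewrite ln_ge0// ler1n.
  case: ifP => hn; last first.
    rewrite addr0; apply: circle_far => //.
      apply: le_trans er _; rewrite ler_pM2r// invr_gt0 mulr_gt0//.
    move/negbT: hn; rewrite negb_and -!leNgt => /orP[]; [by right|by left].
  apply: le_trans (_ : m%:R * ln (4 * ring_rad L r l / eta) <= _).
    apply: circle_near => //; first exact: le_trans b1.
    by case/andP: hn => _ /ltW.
  have q1 : 0 < 4 * ring_rad L r l / eta by rewrite divr_gt0// mulr_gt0.
  have q2 : 0 < 8 * r / eta by rewrite divr_gt0// mulr_gt0.
  rewrite -[leLHS]add0r lerD// ler_pM2l// ler_ln ?posrE//.
  by rewrite ler_pM2r ?invr_gt0//; lra.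
rewrite big_split/= sumr_const card_ord mulrDr mulr1 lerD//.
  rewrite -[leLHS]mulr_natl [leLHS]mulrC.
  apply: le_trans (_ : 1 * L%:R <= _).
    by rewrite ler_pM2r ?ltr0n//; have := @ln_sublinear R 2; have := @le_ln1Dx R 1; lra.
  by rewrite mul1r ler_nat /m leq_pmull.
(* Two near radii would have m-th powers within a factor less than 4 of each other, so at most one
   radius pays the large error. *)
have [[l nl]|/forallNP h] := pselect (exists l : 'I_L, near l).
  rewrite (bigD1 l)//= nl big1 ?addr0// => l' l'l.
  case: ifP => // nl'; exfalso.
  move: nl nl' => /andP[n1 n2] /andP[n1' n2'].
  have /orP[lt|lt] : (l < l')%N || (l' < l)%N.
    by rewrite -neq_ltn eq_sym.
  - have := ring_rad_ratio lt (ltn_ord l') r0; rewrite -/m; lra.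
  - have := ring_rad_ratio lt (ltn_ord l) r0; rewrite -/m; lra.
rewrite big1; first by rewrite mulr_ge0// ltW.
by move=> l _; case: ifP => // /h.
Qed.

(** * Radial bumps *)

Lemma natr_mul_sum (R : pzRingType) (n : nat) (c : R) : n%:R * c = \sum_(i < n) c.
Proof. by rewrite sumr_const card_ord mulr_natl. Qed.

Lemma ring_sum_approx_family (R : realType) (n L : nat) (x : 'I_n -> R[i]) (w : R[i])
    (r eta : R) :
  (0 < L)%N -> 0 < r -> 0 < eta -> eta <= r / (2 * (6 * L)%:R) ->
  `|\sum_(l < L) \sum_(u < 6 * L) \sum_(i < n)
       logmax eta (x i - (w + (ring_rad L r l)%:C * omega R (6 * L) ^+ u)) -
    (6 * L)%:R * \sum_(i < n) \sum_(l < L) logmax (ring_rad L r l) (x i - w)| <=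
  n%:R * ((6 * L)%:R * (1 + ln (8 * r / eta))).
Proof.
move=> L0 r0 e0 er.
have -> : \sum_(l < L) \sum_(u < 6 * L) \sum_(i < n)
       logmax eta (x i - (w + (ring_rad L r l)%:C * omega R (6 * L) ^+ u)) =
    \sum_(i < n) \sum_(l < L) \sum_(u < 6 * L)
       logmax eta (x i - w - (ring_rad L r l)%:C * omega R (6 * L) ^+ u).
  rewrite [RHS]exchange_big/=; apply: eq_bigr => l _.
  rewrite [RHS]exchange_big/=; apply: eq_bigr => u _.
  by apply: eq_bigr => i _; rewrite opprD addrA.
rewrite mulr_sumr -sumrB; apply: le_trans (ler_norm_sum _ _ _) _.
rewrite [leRHS]natr_mul_sum.
by apply: ler_sum => i _; apply: ring_sum_approx.
Qed.

(** After division by the 6L points per circle, the discretization error is logarithmic per point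
    although L radii are summed; averaging over them divides it by L. *)
Lemma ring_average_compare (R : realType) (n L : nat) (x y : 'I_n -> R[i]) (w : R[i])
    (r eta1 eta2 eps : R) :
  (0 < L)%N -> 0 < r -> 0 < eta1 -> 0 < eta2 ->
  eta1 <= r / (2 * (6 * L)%:R) -> eta2 <= r / (2 * (6 * L)%:R) ->
  (forall (l : 'I_L) (u : 'I_(6 * L)),
    let z := w + (ring_rad L r l)%:C * omega R (6 * L) ^+ u in
    `|\sum_i logmax eta1 (x i - z) - \sum_i logmax eta2 (y i - z)| <= eps) ->
  `|\sum_i \sum_(l < L) logmax (ring_rad L r l) (x i - w) -
    \sum_i \sum_(l < L) logmax (ring_rad L r l) (y i - w)| <=
  L%:R * eps + n%:R * (2 + ln (8 * r / eta1) + ln (8 * r / eta2)).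
Proof.
move=> L0 r0 e10 e20 er1 er2 h.
have hx := ring_sum_approx_family x w L0 r0 e10 er1.
have hy := ring_sum_approx_family y w L0 r0 e20 er2.
set Sx := \sum_(l < L) _ in hx; set Sy := \sum_(l < L) _ in hy.
set Gx := \sum_i _ in hx *; set Gy := \sum_i _ in hy *.
have m0 : 0 < (6 * L)%:R :> R by rewrite ltr0n muln_gt0.
have hS : `|Sx - Sy| <= L%:R * ((6 * L)%:R * eps).
  rewrite -sumrB; apply: le_trans (ler_norm_sum _ _ _) _.
  rewrite [leRHS]natr_mul_sum.
  apply: ler_sum => l _; rewrite -sumrB; apply: le_trans (ler_norm_sum _ _ _) _.
  rewrite [leRHS]natr_mul_sum.
  by apply: ler_sum => u _; apply: h.
rewrite -(ler_pM2l m0) -[X in X * _](ger0_norm (ltW m0)) -normrM mulrBr.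
have -> : (6 * L)%:R * Gx - (6 * L)%:R * Gy =
  (Sx - Sy) - (Sx - (6 * L)%:R * Gx) + (Sy - (6 * L)%:R * Gy) by ring.
apply: le_trans (ler_normD _ _) _.
apply: le_trans (lerD (ler_normB _ _) (lexx _)) _.
apply: le_trans (lerD (lerD hS hx) hy) _.
by rewrite le_eqVlt; apply/orP; left; apply/eqP; ring.
Qed.

(* A radial bump: log 2 on the disc of radius r, 0 outside the disc of radius 4r. *)
Definition bump_log (R : realType) (L : nat) (r : R) (z : R[i]) : R :=
  L%:R^-1 * (\sum_(l < L) (logmax (ring_rad L (2 * r) l) z - logmax (ring_rad L r l) z)).

Lemma bump_compare (R : realType) (n L : nat) (x y : 'I_n -> R[i]) (w : R[i])
    (r eta1 eta2 eps : R) :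
  (0 < L)%N -> 0 < r -> 0 < eta1 -> 0 < eta2 ->
  eta1 <= r / (2 * (6 * L)%:R) -> eta2 <= r / (2 * (6 * L)%:R) ->
  (forall (b : bool) (l : 'I_L) (u : 'I_(6 * L)),
    let z := w + (ring_rad L (if b then 2 * r else r) l)%:C * omega R (6 * L) ^+ u in
    `|\sum_i logmax eta1 (x i - z) - \sum_i logmax eta2 (y i - z)| <= eps) ->
  `|\sum_i bump_log L r (x i - w) - \sum_i bump_log L r (y i - w)| <=
  2 * (eps + n%:R * (2 + ln (16 * r / eta1) + ln (16 * r / eta2)) / L%:R).
Proof.
move=> L0 r0 e10 e20 er1 er2 h.
have LR : 0 < L%:R :> R by rewrite ltr0n.
have r20 : 0 < 2 * r by rewrite mulr_gt0.
have m0 : 0 < 2 * (6 * L)%:R :> R by rewrite mulr_gt0// ltr0n muln_gt0.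
have rr : r / (2 * (6 * L)%:R) <= 2 * r / (2 * (6 * L)%:R).
  by rewrite ler_pM2r ?invr_gt0//; lra.
have h1 := ring_average_compare L0 r0 e10 e20 er1 er2 (h false).
have h2 := ring_average_compare L0 r20 e10 e20 (le_trans er1 rr) (le_trans er2 rr) (h true).
have lnm e : 0 < e -> ln (8 * r / e) <= ln (16 * r / e).
  move=> e0; have q1 : 0 < 8 * r / e by rewrite divr_gt0// mulr_gt0.
  have q2 : 0 < 16 * r / e by rewrite divr_gt0// mulr_gt0.
  by rewrite ler_ln ?posrE// ler_pM2r ?invr_gt0//; lra.
have l1 := lnm _ e10; have l2 := lnm _ e20.
have e16 e : 8 * (2 * r) / e = 16 * r / e by ring.
rewrite !e16 in h2.
pose G (v : 'I_n -> R[i]) (s : R) := \sum_i \sum_(l < L) logmax (ring_rad L s l) (v i - w).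
have bE (v : 'I_n -> R[i]) : \sum_i bump_log L r (v i - w) =
    L%:R^-1 * (G v (2 * r) - G v r).
  rewrite -mulr_sumr; congr (_ * _); rewrite -sumrB.
  by apply: eq_bigr => i _; rewrite sumrB.
rewrite !bE -mulrBr normrM ger0_norm ?invr_ge0 ?(ltW LR)// ler_pdivrMl//.
have -> : G x (2 * r) - G x r - (G y (2 * r) - G y r) =
  G x (2 * r) - G y (2 * r) - (G x r - G y r) by ring.
apply: le_trans (ler_normB _ _) _; apply: le_trans (lerD h2 h1) _.
set A := ln (16 * r / eta1) in l1 *; set B := ln (16 * r / eta2) in l2 *.
have -> : L%:R * (2 * (eps + n%:R * (2 + A + B) / L%:R)) =
  L%:R * eps + n%:R * (2 + A + B) + (L%:R * eps + n%:R * (2 + A + B)).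
  by field; rewrite gt_eqF.
by rewrite lerD2l lerD2l ler_wpM2l// lerD// lerD2l.
Qed.

Lemma ring_rad2 (R : realType) (L : nat) (r : R) (l : nat) : ring_rad L (2 * r) l = 2 * ring_rad L r l.
Proof. by rewrite /ring_rad -!mulrA. Qed.

Lemma logmax_diff (R : realType) (s : R) (z : R[i]) : 0 < s ->
  0 <= logmax (2 * s) z - logmax s z <= ln 2.
Proof.
move=> s0; have z0 := cabs_ge0 z; rewrite subr_ge0; apply/andP; split.
  rewrite /logmax ler_ln ?posrE ?lt_max ?mulr_gt0 ?s0 ?orbT//.
  rewrite ge_max !le_max lexx/=; apply/orP; right; lra.
rewrite lerBlDr -lnM ?posrE ?lt_max ?s0 ?orbT//.
rewrite /logmax ler_ln ?posrE ?mulr_gt0 ?lt_max ?s0 ?mulr_gt0 ?orbT//.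
by rewrite maxr_pMr// ge_max !le_max lexx orbT andbT; apply/orP; left; lra.
Qed.

Lemma bump_bounds (R : realType) (L : nat) (r : R) (z : R[i]) : (0 < L)%N -> 0 < r ->
  0 <= bump_log L r z <= ln 2.
Proof.
move=> L0 r0; have LR : 0 < L%:R :> R by rewrite ltr0n.
have h (l : 'I_L) : 0 <= logmax (ring_rad L (2 * r) l) z - logmax (ring_rad L r l) z <= ln 2.
  rewrite ring_rad2; apply: logmax_diff.
  by have /andP[h _] := ring_rad_bounds (ltn_ord l) r0; exact: lt_le_trans h.
apply/andP; split.
  by rewrite mulr_ge0 ?invr_ge0 ?sumr_ge0// => l _; case/andP: (h l).
rewrite ler_pdivrMl// [leRHS]natr_mul_sum.
by apply: ler_sum => l _; case/andP: (h l).
Qed.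

Lemma bump_inner (R : realType) (L : nat) (r : R) (z : R[i]) : (0 < L)%N -> 0 < r ->
  cabs z <= r -> bump_log L r z = ln 2.
Proof.
move=> L0 r0 zr; have LR : 0 < L%:R :> R by rewrite ltr0n.
rewrite /bump_log (eq_bigr (fun=> ln 2)).
  by rewrite -natr_mul_sum mulrA mulVf ?gt_eqF// mul1r.
move=> l _; rewrite ring_rad2 /logmax.
have /andP[h _] := ring_rad_bounds (ltn_ord l) r0.
rewrite !max_r; [|lra|lra].
by rewrite lnM ?posrE ?addrK//; exact: lt_le_trans h.
Qed.

(** All radii of both families are at most 4r, so every maximum equals |z| and the difference
    cancels. *)
Lemma bump_outer (R : realType) (L : nat) (r : R) (z : R[i]) : 0 < r ->
  4 * r <= cabs z -> bump_log L r z = 0.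
Proof.
move=> r0 zr; rewrite /bump_log big1 ?mulr0// => l _; rewrite ring_rad2 /logmax.
have /andP[h h'] := ring_rad_bounds (ltn_ord l) r0.
by rewrite !max_l ?subrr//; lra.
Qed.

Lemma ln_lip (R : realType) (a b c : R) : 0 < c -> c <= a -> c <= b ->
  `|ln a - ln b| <= `|a - b| / c.
Proof.
move=> c0; wlog ab : a b / a <= b.
  move=> H ca cb; have [/H|/ltW/H] := leP a b; first exact.
  by move=> /(_ cb ca); rewrite distrC [X in _ <= X / _]distrC.
move=> ca cb; have a0 : 0 < a by exact: lt_le_trans ca.
have b0 : 0 < b by exact: lt_le_trans cb.
rewrite distrC ger0_norm ?subr_ge0 ?ler_ln ?posrE//.
rewrite distrC ger0_norm ?subr_ge0//.
rewrite -ln_div ?posrE//.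
have -> : b / a = 1 + (b - a) / a by field; rewrite gt_eqF.
have p : 0 <= (b - a) / a by rewrite divr_ge0 ?subr_ge0// ltW.
apply: le_trans (le_ln1Dx _) _; first by lra.
by rewrite ler_wpM2l ?subr_ge0// lef_pV2 ?posrE.
Qed.

Lemma max_lip (R : realType) (a b c : R) :
  `|Num.max a c - Num.max b c| <= `|a - b|.
Proof.
wlog ab : a b / a <= b.
  move=> H; have [/H//|/ltW/H] := leP a b.
  by rewrite distrC [X in _ <= X]distrC.
have h1 : Num.max a c <= Num.max b c by rewrite ge_max !le_max ab lexx !orbT.
rewrite distrC ger0_norm ?subr_ge0// distrC ger0_norm ?subr_ge0//.
rewrite lerBlDr ge_max; apply/andP; split.
  by rewrite addrC -lerBlDr opprB addrC subrK le_max lexx.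
apply: le_trans (_ : Num.max a c <= _); first by rewrite le_max lexx orbT.
by rewrite lerDr subr_ge0.
Qed.

Lemma logmax_lip (R : realType) (s : R) (z z' : R[i]) : 0 < s ->
  `|logmax s z - logmax s z'| <= cabs (z - z') / s.
Proof.
move=> s0; apply: le_trans (ln_lip s0 _ _) _; rewrite ?le_max ?lexx ?orbT//.
rewrite ler_pM2r ?invr_gt0//; apply: le_trans (max_lip _ _ _) _.
have h1 := ler_cabsB z z'; have := ler_cabsB z' z; rewrite cabs_subC => h2.
by rewrite ler_norml; apply/andP; split; lra.
Qed.

(** Each [logmax] with floor at least r is Lipschitz with constant 1/r, and the bump averages
    differences of two of them. *)
Lemma bump_lip (R : realType) (L : nat) (r : R) (z z' : R[i]) : (0 < L)%N -> 0 < r ->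
  `|bump_log L r z - bump_log L r z'| <= 2 * cabs (z - z') / r.
Proof.
move=> L0 r0; have LR : 0 < L%:R :> R by rewrite ltr0n.
rewrite /bump_log -mulrBr normrM ger0_norm ?invr_ge0 ?(ltW LR)// ler_pdivrMl//.
rewrite -sumrB; apply: le_trans (ler_norm_sum _ _ _) _.
rewrite [leRHS]natr_mul_sum; apply: ler_sum => l _.
have /andP[h _] := ring_rad_bounds (ltn_ord l) r0.
have rp : 0 < ring_rad L r l by exact: lt_le_trans h.
have -> : logmax (ring_rad L (2 * r) l) z - logmax (ring_rad L r l) z -
  (logmax (ring_rad L (2 * r) l) z' - logmax (ring_rad L r l) z') =
  (logmax (ring_rad L (2 * r) l) z - logmax (ring_rad L (2 * r) l) z') -
  (logmax (ring_rad L r l) z - logmax (ring_rad L r l) z') by ring.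
apply: le_trans (ler_normB _ _) _.
have c0 := cabs_ge0 (z - z').
have b s : r <= s -> `|logmax s z - logmax s z'| <= cabs (z - z') / r.
  move=> rs; have s0 : 0 < s by exact: lt_le_trans rs.
  by apply: le_trans (logmax_lip _ _ s0) _; rewrite ler_wpM2l// lef_pV2 ?posrE.
apply: le_trans (lerD (b _ _) (b _ h)) _; first by rewrite ring_rad2; lra.
by rewrite -mulrDl [2 * _]mulr_natl mulr2n.
Qed.

(** * Matching by cells *)

(* A permutation with the most agreements leaves no label wrongly used on both
   sides, since otherwise a transposition would add an agreement. *)
Lemma exists_matching (n : nat) (T : finType) (cx cy : 'I_n -> T) :
  exists s : 'S_n, (#|[pred j | cx j != cy (s j)]| <=
    \sum_(Q : T) (#|[pred j | cy j == Q]| - #|[pred j | cx j == Q]|))%N.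
Proof.
pose ag (s : 'S_n) := #|[pred j | cx j == cy (s j)]|.
case: (@arg_maxnP _ (1%g : 'S_n) predT ag isT) => s _ smax.
exists s.
have noswap j j' : cx j != cy (s j) -> cx j' != cy (s j') -> cx j != cy (s j').
  move=> bj bj'; apply/eqP => e.
  have : (ag (tperm j j' * s)%g <= ag s)%N := smax _ isT.
  rewrite leqNgt => /negP; apply.
  (* The transposition touches only j and j', both disagreements, so former agreements survive and j
     becomes a new one. *)
  apply: (@leq_trans #|[predU1 j & [pred i | cx i == cy (s i)]]|).
    by rewrite cardU1 inE (negPf bj).
  apply: subset_leq_card; apply/fintype.subsetP => i.
  rewrite !inE permM => /orP[/eqP->|/eqP ai]; first by rewrite tpermL e.
  rewrite tpermD ?ai//.
    by apply: contraNneq bj => ->; rewrite ai.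
  by apply: contraNneq bj' => ->; rewrite ai.
have -> : #|[pred j | cx j != cy (s j)]| =
    (\sum_(Q : T) #|[pred j | (cx j != cy (s j)) && (cy (s j) == Q)]|)%N.
  rewrite -sum1_card (partition_big (fun j => cy (s j)) predT)//=.
  by apply: eq_bigr => Q _; rewrite sum1_card; apply: eq_card => j; rewrite !inE.
apply: leq_sum => Q _.
have -> : #|[pred j | cy j == Q]| = #|[pred j | cy (s j) == Q]|.
  rewrite -(card_in_image (f := s) (A := [pred j | cy (s j) == Q])); last exact: in2W perm_inj.
  apply: eq_card => j; rewrite inE; apply/idP/fintype.imageP.
    by move=> h; exists ((s^-1)%g j); rewrite ?inE permKV.
  by move=> [u]; rewrite inE => hu ->.
(* If some disagreement j' has its partner in Q, then every j with cx j = Q is an agreement, with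
   its own partner in Q. So the disagreements with partner in Q number at most the excess of cy over
   cx. *)
case: (pickP [pred j | (cx j != cy (s j)) && (cy (s j) == Q)]) => [j'|h0]; last first.
  by rewrite (eq_card h0) card0.
move=> /andP[/= bj' /eqP hj'].
rewrite leq_subRL.
  rewrite addnC -(cardID [pred j | cx j != cy (s j)] [pred j | cy (s j) == Q]).
  apply: leq_add.
    by apply/eq_leq/eq_card => j; rewrite !inE andbC.
  apply: subset_leq_card; apply/fintype.subsetP => j; rewrite !inE => /eqP cj.
  have aj : cx j == cy (s j).
    by apply/negPn/negP => bj; have := noswap _ _ bj bj'; rewrite cj hj' eqxx.
  by rewrite aj -cj eq_sym aj.
apply: subset_leq_card; apply/fintype.subsetP => j; rewrite !inE => /eqP cj.
have aj : cx j == cy (s j).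
  by apply/negPn/negP => bj; have := noswap _ _ bj bj'; rewrite cj hj' eqxx.
by rewrite -cj eq_sym.
Qed.

Lemma sum_card_pred (I T : finType) (f : I -> T) (p : pred I) :
  (\sum_(Q : T) #|[pred j | p j && (f j == Q)]| = #|p|)%N.
Proof.
rewrite -[RHS]sum1_card (partition_big f predT)//=.
by apply: eq_bigr => Q _; rewrite sum1_card; apply: eq_card => j; rewrite !inE.
Qed.

(* Smooth test functions supported in single cells transfer the points lying deep
   inside a cell; the others are counted as lost. *)
Lemma cell_deficit (R : realType) (V : Type) (W T : finType) (n : nat)
    (x y : 'I_n -> V) (g : W -> V -> R) (ctr : W -> V) (cell : V -> T)
    (deep : pred 'I_n) (Gm Gp e : R) :
  (forall w v, 0 <= g w v) -> (forall w, 0 < g w (ctr w)) ->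
  (forall j, deep j -> forall w v, 0 < g w (y j) -> 0 < g w v -> cell v = cell (y j)) ->
  0 < Gp -> Gm <= Gp -> 0 <= e ->
  (forall i, \sum_w g w (x i) <= Gp) -> (forall j, Gm <= \sum_w g w (y j)) ->
  (forall w, `|\sum_i g w (x i) - \sum_j g w (y j)| <= e) ->
  (\sum_(Q : T) (#|[pred j | cell (y j) == Q]| - #|[pred i | cell (x i) == Q]|))%:R <=
    #|predC deep|%:R + (1 - Gm / Gp) * n%:R + #|W|%:R * e / Gp.
Proof.
move=> g0 gc hdeep Gp0 GmGp e0 hx hy he.
pose nd Q := #|[pred j | ~~ deep j && (cell (y j) == Q)]|.
pose dp Q := #|[pred j | deep j && (cell (y j) == Q)]|.
pose wq Q := #|[pred w | true && (cell (ctr w) == Q)]|.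
pose nx Q := #|[pred i | cell (x i) == Q]|.
have c0 : 0 <= 1 - Gm / Gp by rewrite subr_ge0 ler_pdivrMr// mul1r.
have key Q : ((#|[pred j | cell (y j) == Q]| - nx Q)%N)%:R <=
    (nd Q)%:R + (1 - Gm / Gp) * (dp Q)%:R + (wq Q)%:R * e / Gp.
  have split : #|[pred j | cell (y j) == Q]| = (nd Q + dp Q)%N.
    rewrite -(cardID (predC deep)) /nd /dp; congr (_ + _)%N.
      by apply: eq_card => j; rewrite !inE andbC.
    by apply: eq_card => j; rewrite !inE negbK.
  (* [inW] selects the test functions supported in Q. A point x outside Q does not see them, while a
     deep y in Q sees no others, so its full total, at least Gm, is counted. *)
  pose inW w := `[< forall v, 0 < g w v -> cell v = Q >].
  have main : Gm * (dp Q)%:R - (wq Q)%:R * e <= Gp * (nx Q)%:R.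
    have s1 : \sum_(w | inW w) \sum_i g w (x i) <= Gp * (nx Q)%:R.
      rewrite exchange_big/= (bigID (fun i => cell (x i) == Q))/=.
      rewrite [X in _ + X]big1 ?addr0; last first.
        move=> i ni; rewrite big1// => w /asboolP hw.
        apply/eqP; rewrite eq_le g0 andbT leNgt; apply/negP => /hw hh.
        by rewrite hh eqxx in ni.
      rewrite mulr_natr /nx -sumr_const; apply: ler_sum => i _.
      apply: le_trans (hx i); rewrite [leRHS](bigID inW)/= lerDl.
      by apply: sumr_ge0 => w _; exact: g0.
    have s2 : Gm * (dp Q)%:R <= \sum_(w | inW w) \sum_j g w (y j).
      rewrite exchange_big/= (bigID (fun j => deep j && (cell (y j) == Q)))/=.
      apply: ler_wpDr.
        by apply: sumr_ge0 => j _; apply: sumr_ge0 => w _; exact: g0.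
      rewrite mulr_natr /dp -sumr_const; apply: ler_sum => j.
      rewrite !inE => /andP[dj /eqP cj]; apply: le_trans (hy j) _.
      rewrite (bigID inW)/= [X in _ + X]big1 ?addr0// => w /asboolPn nw.
      apply/eqP; rewrite eq_le g0 andbT leNgt; apply/negP => gp; apply: nw => v gv.
      by rewrite -cj; exact: hdeep gv.
    have s3 : \sum_(w | inW w) \sum_j g w (y j) <=
        \sum_(w | inW w) \sum_i g w (x i) + (wq Q)%:R * e.
      apply: le_trans (_ : \sum_(w | inW w) (\sum_i g w (x i) + e) <= _).
        apply: ler_sum => w _; have := he w; rewrite ler_norml => /andP[h _]; lra.
      rewrite big_split/= lerD2l sumr_const -[e *+ _]mulr_natl ler_wpM2r// ler_nat.
      apply: subset_leq_card; apply/fintype.subsetP => w hw0.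
      have hw : forall v, 0 < g w v -> cell v = Q := asboolW hw0.
      by rewrite inE/= (hw _ (gc w)) eqxx.
    lra.
  have dn : 0 <= (dp Q)%:R :> R by [].
  have b1 : 0 <= (1 - Gm / Gp) * (dp Q)%:R by rewrite mulr_ge0.
  have b2 : 0 <= (wq Q)%:R * e / Gp by rewrite divr_ge0 ?mulr_ge0 ?(ltW Gp0).
  have [le|lt] := leqP #|[pred j | cell (y j) == Q]| (nx Q).
    move: le; rewrite -subn_eq0 => /eqP ->.
    by rewrite !addr_ge0.
  rewrite natrB ?(ltnW lt)// split natrD.
  have : Gm / Gp * (dp Q)%:R - (wq Q)%:R * e / Gp <= (nx Q)%:R.
    rewrite mulrAC -mulrBl ler_pdivrMr// [leRHS]mulrC; exact: main.
  lra.
rewrite natr_sum; apply: le_trans (ler_sum _ (fun Q _ => key Q)) _.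
rewrite !big_split/= -mulr_sumr -!mulr_suml -!natr_sum.
rewrite /nd /dp /wq !sum_card_pred lerD2r lerD2l ler_wpM2l// ler_nat.
by rewrite -[X in (_ <= X)%N](card_ord n); exact: max_card.
Qed.

Lemma big_window (R : realType) (F : nat -> R) (N i0 J : nat) : (i0 + J <= N)%N ->
  (forall i, (i < i0)%N || (i0 + J <= i)%N -> F i = 0) ->
  \sum_(i < N) F i = \sum_(i < J) F (i0 + i)%N.
Proof.
move=> hN h0; rewrite -(big_mkord xpredT F).
rewrite (@big_cat_nat _ _ _ i0)//=; last by apply: leq_trans hN; exact: leq_addr.
rewrite (@big_cat_nat _ _ _ (i0 + J) i0)//=; last exact: leq_addr.
rewrite big_nat big1 ?add0r; last by move=> i /andP[_ hi]; apply: h0; rewrite hi.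
rewrite [X in _ + X]big_nat [X in _ + X]big1 ?addr0; last first.
  by move=> i /andP[hi _]; apply: h0; rewrite hi orbT.
rewrite -{1}[i0]add0n big_addn addKn big_mkord.
by apply: eq_bigr => i _; rewrite addnC.
Qed.

Definition grid_pt (R : realType) (h O : R) (i j : nat) : R[i] :=
  (i%:R * h - O) +i* (j%:R * h - O).

(** The sum of all bumps as seen from a grid point: the offsets run over a window around index 4q
    that contains the support, of radius 4qh. It is the value, independent of z, around which all
    sums of bumps lie. *)
Definition grid_ref (R : realType) (L q : nat) (h : R) : R :=
  \sum_(i < 8 * q + 2) \sum_(j < 8 * q + 2)
    bump_log L (q%:R * h) (((4 * q)%:R - i%:R) * h +i* (((4 * q)%:R - j%:R) * h)).

Lemma ln2_ge (R : realType) : 2^-1 <= ln (2 : R).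
Proof.
have e : (2 : R) = (1 + - 2^-1)^-1 by field.
rewrite [X in ln X]e lnV ?posrE; last lra.
have := @le_ln1Dx R (- 2^-1); lra.
Qed.

(** At the at least (q/2)^2 offsets with both coordinates between 0 and q/2 steps the bump equals ln
    2 >= 1/2; elsewhere it is nonnegative. *)
Lemma grid_ref_ge (R : realType) (L q : nat) (h : R) : (0 < L)%N -> (0 < q)%N -> 0 < h ->
  q%:R ^+ 2 / 8 <= grid_ref L q h.
Proof.
move=> L0 q0 h0; have qR : 0 < q%:R :> R by rewrite ltr0n.
have r0 : 0 < q%:R * h by rewrite mulr_gt0.
pose I (i : nat) : R := ((4 * q <= i) && (i < 4 * q + (q./2).+1))%N%:R.
have sI : \sum_(i < 8 * q + 2) I i = ((q./2).+1)%:R.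
  rewrite (@big_window _ I _ (4 * q) (q./2).+1); last 2 first.
  - by have := odd_double_half q; lia.
  - by move=> i hi; rewrite /I; case: (boolP (_ && _)) => //; lia.
  rewrite (eq_bigr (fun=> 1)) ?sumr_const ?card_ord// => i _.
  by rewrite /I leq_addr ltn_add2l ltn_ord.
apply: le_trans (_ : \sum_(i < 8 * q + 2) \sum_(j < 8 * q + 2) I i * I j * ln 2 <= _).
  rewrite (eq_bigr (fun i : 'I_(8 * q + 2) => I i * (((q./2).+1)%:R * ln 2))); last first.
    by move=> i _; rewrite -sI mulr_suml mulr_sumr; apply: eq_bigr => j _; rewrite mulrA.
  rewrite -mulr_suml sI mulrA.
  have hq : q%:R / 2 <= ((q./2).+1)%:R :> R.
    rewrite ler_pdivrMr// -natrM ler_nat; have := odd_double_half q; lia.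
  have l2 := ln2_ge R.
  have hq2 : (q%:R / 2) ^+ 2 <= ((q./2).+1)%:R * ((q./2).+1)%:R :> R.
    by rewrite expr2 ler_pM// divr_ge0.
  have := ler_pM (sqr_ge0 (q%:R / 2)) (_ : 0 <= 2^-1) hq2 l2.
  by move=> /(_ _)/(le_trans _) => H; apply: H; rewrite ?invr_ge0//; lra.
apply: ler_sum => i _; apply: ler_sum => j _.
have /andP[b0 _] := @bump_bounds R L (q%:R * h) (((4 * q)%:R - i%:R) * h +i* (((4 * q)%:R - j%:R) * h)) L0 r0.
rewrite /I; case: (boolP (_ && _)) => hi; last by rewrite !mul0r.
case: (boolP (_ && _)) => hj; last by rewrite mulr0 mul0r.
rewrite !mul1r bump_inner//.
apply: le_trans (cabs_le_ReIm _) _ => /=.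
have half (a : nat) : (4 * q <= a)%N && (a < 4 * q + (q./2).+1)%N ->
    `|((4 * q)%:R - a%:R) * h| <= q%:R * h / 2.
  move=> /andP[a1 a2]; rewrite normrM (ger0_norm (ltW h0)) distrC -natrB//.
  rewrite normr_nat mulrAC ler_wpM2r ?(ltW h0)// ler_pdivlMr// -natrM ler_nat.
  have := odd_double_half q; lia.
have := half _ hi; have := half _ hj; lra.
Qed.

(** There are (8q+2)^2 <= (10q)^2 terms in a window, each with error at most 4/q: a total of 400
    q. *)
Definition grid_cst (R : realType) : R := 400.

(** Rounding z to a grid point turns the sum into [grid_ref] and moves each coordinate by at most h,
    hence each bump by at most 2 * 2h / (qh). The hypothesis on z keeps the support inside the N by
    N grid. *)
Lemma grid_sum_approx (R : realType) (L q N : nat) (h O : R) (z : R[i]) :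
  (0 < L)%N -> (0 < q)%N -> 0 < h ->
  (forall t, t = complex.Re z \/ t = complex.Im z ->
     (4 * q)%:R * h <= t + O /\ t + O + (4 * q + 2)%:R * h <= N%:R * h) ->
  `|\sum_(i < N) \sum_(j < N) bump_log L (q%:R * h) (z - grid_pt h O i j) -
    grid_ref L q h| <= grid_cst R * q%:R.
Proof.
move=> L0 q0 h0 hz; have qR : 0 < q%:R :> R by rewrite ltr0n.
have r0 : 0 < q%:R * h by rewrite mulr_gt0.
have idx (t : R) : t = complex.Re z \/ t = complex.Im z ->
    exists2 i0 : nat, (i0 + (8 * q + 2) <= N)%N &
      (forall i, (i < i0)%N || (i0 + (8 * q + 2) <= i)%N ->
        4 * (q%:R * h) <= `|t - (i%:R * h - O)|) /\
      (forall i, `|(t - ((i0 + i)%:R * h - O)) - ((4 * q)%:R - i%:R) * h| <= h).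
  move=> ht; have [t1 t2] := hz t ht.
  (* Index of the grid line just below t; the window goes from 4q steps before it to 4q + 1 steps
     after it. *)
  pose a := Num.truncn ((t + O) / h).
  have to0 : 0 <= (t + O) / h.
    by rewrite divr_ge0 ?(ltW h0)//; apply: le_trans t1; rewrite mulr_ge0// ltW.
  have /andP[a1 a2] := truncn_itv to0; rewrite -/a in a1 a2.
  move: a1; rewrite ler_pdivlMr// => a1.
  move: a2; rewrite ltr_pdivrMr// -natr1 mulrDl mul1r => a2.
  have aq : (4 * q <= a)%N.
    rewrite -ltnS -(ltr_nat R) -(ltr_pM2r h0) -natr1 mulrDl mul1r.
    exact: le_lt_trans t1 a2.
  have aN : (a + (4 * q + 2) <= N)%N.
    rewrite -(ler_nat R) -(ler_pM2r h0) natrD mulrDl.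
    by apply: le_trans t2; rewrite lerD2r.
  exists (a - 4 * q)%N; first lia.
  split=> i.
    move=> /orP[hi|hi].
      have : (i + 4 * q < a)%N by lia.
      rewrite -(ltr_nat R) -(ltr_pM2r h0) natrD mulrDl natrM => hh.
      by apply: le_trans (ler_norm _); lra.
    have : (a + 4 * q + 2 <= i)%N by lia.
    rewrite -(ler_nat R) -(ler_pM2r h0) natrD (natrD _ a) !mulrDl natrM => hh.
    by rewrite distrC; apply: le_trans (ler_norm _); lra.
  rewrite natrD natrB// ler_norml; apply/andP; split; lra.
have [i0 iN [iout iin]] := idx _ (or_introl erefl).
have [j0 jN [jout jin]] := idx _ (or_intror erefl).
pose F (i j : nat) := bump_log L (q%:R * h) (z - grid_pt h O i j).
have F0r i j : 4 * (q%:R * h) <= `|complex.Re z - (i%:R * h - O)| -> F i j = 0.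
  move=> hh; apply: bump_outer => //; apply: le_trans hh _.
  by apply: le_trans (Re_le_cabs _); rewrite ReB.
have F0i i j : 4 * (q%:R * h) <= `|complex.Im z - (j%:R * h - O)| -> F i j = 0.
  move=> hh; apply: bump_outer => //; apply: le_trans hh _.
  by apply: le_trans (Im_le_cabs _); rewrite ImB.
rewrite (@big_window _ (fun i => \sum_(j < N) F i j) N i0 (8 * q + 2))//; last first.
  by move=> i hi; rewrite big1// => j _; apply/F0r/iout.
have Fw i : \sum_(j < N) F i j = \sum_(j < 8 * q + 2) F i (j0 + j)%N.
  by apply: big_window => // j hj; apply/F0i/jout.
under eq_bigr do rewrite Fw.
rewrite /grid_ref -sumrB; apply: le_trans (ler_norm_sum _ _ _) _.
apply: le_trans (_ : \sum_(i < 8 * q + 2) \sum_(j < 8 * q + 2) 4 / q%:R <= _).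
  apply: ler_sum => i _; rewrite -sumrB; apply: le_trans (ler_norm_sum _ _ _) _.
  apply: ler_sum => j _; apply: le_trans (bump_lip _ _ L0 r0) _.
  rewrite ler_pdivrMr// mulrA divfK ?gt_eqF//.
  have := cabs_le_ReIm (z - grid_pt h O (i0 + i) (j0 + j) -
     (((4 * q)%:R - i%:R) * h +i* (((4 * q)%:R - j%:R) * h))).
  rewrite !ReB !ImB/=; have := iin i; have := jin j; lra.
rewrite -!natr_mul_sum mulrA -natrM mulrA ler_pdivrMr//.
have -> : grid_cst R * q%:R * q%:R = (400 * q * q)%:R by rewrite !natrM.
rewrite -natrM ler_nat; nia.
Qed.

Lemma card_union_bound (I J : finType) (p : pred J) (S : I -> pred J) :
  (forall j, p j -> exists i, S i j) -> (#|p| <= \sum_i #|S i|)%N.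
Proof.
move=> h; rewrite -sum1_card.
have cE i : #|S i| = (\sum_j S i j)%N.
  rewrite -sum1_card big_mkcond/=; apply: eq_bigr => j _.
  by rewrite unfold_in; case: (S i j).
rewrite [X in (_ <= X)%N](eq_bigr _ (fun i _ => cE i)).
rewrite exchange_big/= [leqRHS](bigID p)/= -[leqLHS]addn0 leq_add//.
apply: leq_sum => j pj; have [i Sij] := h j pj.
by rewrite (bigD1 i)//= Sij leq_addr.
Qed.

Definition cell_idx (R : realType) (q : nat) (O t : R) : nat :=
  Num.truncn ((t + O) * q%:R).

Lemma cell_idx_itv (R : realType) (q : nat) (O t : R) : (0 < q)%N -> 0 <= t + O ->
  (cell_idx q O t)%:R / q%:R <= t + O < ((cell_idx q O t)%:R + 1) / q%:R.
Proof.
move=> q0 t0; have qR : 0 < q%:R :> R by rewrite ltr0n.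
have /andP[a b] := truncn_itv (mulr_ge0 t0 (ltW qR)).
by rewrite ler_pdivrMr// a ltr_pdivlMr// natr1.
Qed.

Lemma cell_idx_close (R : realType) (q : nat) (O t t' : R) : (0 < q)%N ->
  0 <= t + O -> 0 <= t' + O -> cell_idx q O t = cell_idx q O t' ->
  `|t - t'| <= q%:R^-1.
Proof.
move=> q0 t0 t0' e.
have /andP[a b] := cell_idx_itv q0 t0; have /andP[a' b'] := cell_idx_itv q0 t0'.
rewrite e in a b; move: b b'; rewrite !mulrDl !mul1r => b b'.
by rewrite ler_norml; apply/andP; split; lra.
Qed.

Lemma cell_idx_mid (R : realType) (q : nat) (O t : R) : (0 < q)%N -> 0 <= t + O ->
  `|t - (((cell_idx q O t)%:R + 2^-1) / q%:R - O)| <= (2 * q%:R)^-1.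
Proof.
move=> q0 t0; have qR : 0 < q%:R :> R by rewrite ltr0n.
have /andP[a b] := cell_idx_itv q0 t0.
have e : (2 * q%:R)^-1 = 2^-1 / q%:R :> R by rewrite invfM.
move: b; rewrite e !mulrDl !mul1r => b.
by rewrite ler_norml; apply/andP; split; lra.
Qed.

(** An endpoint of the cell of t separates t from t'; the boolean tells which one. The point t' may
    lie below -O, where [Num.truncn] returns the index 0. *)
Lemma cell_idx_edge (R : realType) (q : nat) (O t t' d : R) : (0 < q)%N ->
  0 <= t + O -> `|t - t'| <= d -> cell_idx q O t' <> cell_idx q O t ->
  exists b : bool, `|t - (((cell_idx q O t)%:R + b%:R) / q%:R - O)| <= d.
Proof.
move=> q0 t0 d0 ne; have qR : 0 < q%:R :> R by rewrite ltr0n.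
have /andP[a b] := cell_idx_itv q0 t0.
move: d0; rewrite ler_norml => /andP[d1 d2].
have [lt|lt] : (cell_idx q O t' < cell_idx q O t)%N \/
               (cell_idx q O t < cell_idx q O t')%N by lia.
  exists false; rewrite addr0 ger0_norm; last by lra.
  have h : t' + O < (cell_idx q O t)%:R / q%:R.
    have [t0'|t0'] := leP 0 (t' + O).
      have /andP[_ b'] := cell_idx_itv q0 t0'; apply: lt_le_trans b' _.
      by rewrite ler_pM2r ?invr_gt0// natr1 ler_nat.
    by apply: lt_le_trans t0' _; rewrite divr_ge0.
  lra.
exists true; rewrite (_ : true%:R = 1 :> R)//.
rewrite -[X in `|X|]opprK normrN ger0_norm; last by lra.
have t0' : 0 <= t' + O.
  rewrite leNgt; apply/negP => neg; have : cell_idx q O t' = 0%N.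
    apply/truncn0Pn; rewrite -ltNge; apply: lt_trans ltr01.
    by rewrite pmulr_llt0.
  by move=> e; rewrite e in lt.
have /andP[a' _] := cell_idx_itv q0 t0'.
have h : ((cell_idx q O t)%:R + 1) / q%:R <= t' + O.
  by apply: le_trans a'; rewrite ler_pM2r ?invr_gt0// natr1 ler_nat.
rewrite /=; lra.
Qed.

(** Two points of one cell are within 2/q. The three terms count the samples near cell sides, the
    oscillation of the sum of bumps (relative size 1/q), and the error e over all (2ZK)^2 test
    functions, normalized by their total of order q^2. *)
Lemma grid_matching (R : realType) (n L q K Z : nat) (x y : 'I_n -> R[i])
    (bnd e Kr : R) :
  let h : R := (q%:R * K%:R)^-1 in let O : R := Z%:R / q%:R in
  (0 < L)%N -> (0 < q)%N -> (0 < K)%N -> (0 < Z)%N ->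
  (forall i, `|complex.Re (x i)| <= bnd /\ `|complex.Im (x i)| <= bnd) ->
  (forall i, `|complex.Re (y i)| <= bnd /\ `|complex.Im (y i)| <= bnd) ->
  bnd + (4 * q + 2)%:R * h <= O ->
  0 <= e ->
  (forall a b : nat, (a < 2 * Z * K)%N -> (b < 2 * Z * K)%N ->
    `|\sum_i bump_log L K%:R^-1 (x i - grid_pt h O a b) -
      \sum_i bump_log L K%:R^-1 (y i - grid_pt h O a b)| <= e) ->
  (forall z : R[i], #|[pred j |
     ((`|complex.Re (y j) - complex.Re z| <= (2 * q%:R)^-1) &&
      (`|complex.Im (y j) - complex.Im z| <= 8 / K%:R)) ||
     ((`|complex.Re (y j) - complex.Re z| <= 8 / K%:R) &&
      (`|complex.Im (y j) - complex.Im z| <= (2 * q%:R)^-1))]|%:R <= Kr) ->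
  exists s : 'S_n, #|[pred j | 2 / q%:R < cabs (x j - y (s j))]|%:R <=
    36 * Z%:R ^+ 2 * Kr + 16 * grid_cst R / q%:R * n%:R + 32 * Z%:R ^+ 2 * K%:R ^+ 2 * e / q%:R ^+ 2.
Proof.
move=> h O L0 q0 K0 Z0 hx hy hO e0 he hK.
have qR : 0 < q%:R :> R by rewrite ltr0n.
have c0 : 0 <= grid_cst R by exact: ler0n.
move: (grid_cst R) (@grid_sum_approx R) c0 => c approx c0.
have KR : 0 < K%:R :> R by rewrite ltr0n.
have h0 : 0 < h by rewrite invr_gt0 mulr_gt0.
have rE : q%:R * h = K%:R^-1 by rewrite /h; field; rewrite !gt_eqF.
have r0 : 0 < K%:R^-1 :> R by rewrite invr_gt0.
pose T := ('I_(2 * Z).+1 * 'I_(2 * Z).+1)%type.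
pose N := (2 * Z * K)%N.
pose cell (z : R[i]) : T :=
  (inord (cell_idx q O (complex.Re z)), inord (cell_idx q O (complex.Im z))).
pose ctr (w : 'I_N * 'I_N) := grid_pt h O w.1 w.2.
pose g (w : 'I_N * 'I_N) z := bump_log L K%:R^-1 (z - ctr w).
have bpos t : `|t| <= bnd -> 0 <= t + O /\ (cell_idx q O t < (2 * Z).+1)%N.
  rewrite ler_norml => /andP[t1 t2].
  have p : 0 <= (4 * q + 2)%:R * h by rewrite mulr_ge0// ltW.
  have tO : 0 <= t + O by lra.
  split=> //; have /andP[a _] := cell_idx_itv q0 tO.
  rewrite ltnS -(ler_nat R) -(ler_pM2r (_ : 0 < q%:R^-1)) ?invr_gt0//.
  apply: le_trans a _; rewrite natrM -mulrA -/O; lra.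
have xpos i : [/\ 0 <= complex.Re (x i) + O, 0 <= complex.Im (x i) + O,
    (cell_idx q O (complex.Re (x i)) < (2 * Z).+1)%N &
    (cell_idx q O (complex.Im (x i)) < (2 * Z).+1)%N].
  by have [/bpos[? ?] /bpos[? ?]] := hx i.
have ypos i : [/\ 0 <= complex.Re (y i) + O, 0 <= complex.Im (y i) + O,
    (cell_idx q O (complex.Re (y i)) < (2 * Z).+1)%N &
    (cell_idx q O (complex.Im (y i)) < (2 * Z).+1)%N].
  by have [/bpos[? ?] /bpos[? ?]] := hy i.
have gnear w z : 0 < g w z -> cabs (z - ctr w) < 4 / K%:R.
  move=> gp; rewrite ltNge; apply/negP => far.
  by move: gp; rewrite /g bump_outer ?ltxx.
pose G0 := grid_ref L q h.
have G0ge : q%:R ^+ 2 / 8 <= G0 by exact: grid_ref_ge.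
have sumg z : `|complex.Re z| <= bnd /\ `|complex.Im z| <= bnd ->
    `|\sum_w g w z - G0| <= c * q%:R.
  move=> hz.
  rewrite -(pair_bigA _ (fun i j : 'I_N => bump_log L K%:R^-1 (z - grid_pt h O i j)))/=.
  rewrite -rE; apply: approx => // t ht.
  have : `|t| <= bnd by case: ht => ->; case: hz.
  rewrite ler_norml => /andP[t1 t2].
  have NE : N%:R * h = 2 * O.
    by rewrite /N !natrM /h /O; field; rewrite !gt_eqF.
  rewrite NE; move: hO; rewrite natrD mulrDl.
  have p : 0 <= 2 * h by rewrite mulr_ge0// ltW.
  by split; lra.
pose deep j := `[< forall w v, 0 < g w (y j) -> 0 < g w v -> cell v = cell (y j) >].
have Gp0 : 0 < G0 + c * q%:R.
  apply: ltr_wpDr; first by rewrite mulr_ge0// ltW.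
  by apply: lt_le_trans G0ge; rewrite divr_gt0// exprn_gt0.
have deficit := @cell_deficit R R[i] _ T n x y g ctr cell deep
  (G0 - c * q%:R) (G0 + c * q%:R) e.
have {}deficit :
  (\sum_(Q : T) (#|[pred j | cell (y j) == Q]| - #|[pred i | cell (x i) == Q]|))%:R <=
    #|predC deep|%:R + (1 - (G0 - c * q%:R) / (G0 + c * q%:R)) * n%:R +
    #|{: 'I_N * 'I_N}|%:R * e / (G0 + c * q%:R).
  apply: deficit => //.
  - by move=> w v; have /andP[] := bump_bounds (v - ctr w) L0 r0.
  - move=> w; rewrite /g subrr bump_inner ?cabs0 ?ltW//.
    by rewrite ln_gt0// ltr1n.
  - by move=> j /asboolP.
  - by rewrite lerD2l; have := mulr_ge0 c0 (ltW qR); lra.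
  - by move=> i; have := sumg _ (hx i); rewrite ler_norml => /andP[_]; lra.
  - by move=> i; have := sumg _ (hy i); rewrite ler_norml => /andP[+ _]; lra.
  - by move=> [a b]; apply: he.
(* There are (2Z+1)^2 cells with four sides each, and 4 (2Z+1)^2 <= 36 Z^2. *)
have nd : #|predC deep|%:R <= 36 * Z%:R ^+ 2 * Kr.
  pose I := (T * (bool * bool))%type.
  (* The midpoint of a side, so that the half-length is 1/(2q): the first boolean tells vertical
     from horizontal, the second chooses the lower or upper coordinate. *)
  pose cz (i : I) : R[i] := if i.2.1
    then ((i.1.1%:R + i.2.2%:R) / q%:R - O) +i* ((i.1.2%:R + 2^-1) / q%:R - O)
    else ((i.1.1%:R + 2^-1) / q%:R - O) +i* ((i.1.2%:R + i.2.2%:R) / q%:R - O).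
  pose S (i : I) := [pred j |
     ((`|complex.Re (y j) - complex.Re (cz i)| <= (2 * q%:R)^-1) &&
      (`|complex.Im (y j) - complex.Im (cz i)| <= 8 / K%:R)) ||
     ((`|complex.Re (y j) - complex.Re (cz i)| <= 8 / K%:R) &&
      (`|complex.Im (y j) - complex.Im (cz i)| <= (2 * q%:R)^-1))].
  have cover j : (predC deep) j -> exists i, S i j.
    move=> /= /asboolPn/existsNP[w /existsNP[v /not_implyP[gy /not_implyP[gv ne]]]].
    have d1 := gnear _ _ gy; have d2 := gnear _ _ gv.
    (* Both points lie in one bump support, a disc of radius 4/K. *)
    have dd : cabs (y j - v) <= 8 / K%:R.
      have -> : y j - v = (y j - ctr w) - (v - ctr w) by ring.
      by apply: le_trans (cabsD _ _) _; rewrite cabsN; lra.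
    have [p1 p2 c1 c2] := ypos j.
    have dRe : `|complex.Re (y j) - complex.Re v| <= 8 / K%:R.
      by rewrite -ReB; exact: le_trans (Re_le_cabs _) dd.
    have dIm : `|complex.Im (y j) - complex.Im v| <= 8 / K%:R.
      by rewrite -ImB; exact: le_trans (Im_le_cabs _) dd.
    have [eR|nR] := pselect (cell_idx q O (complex.Re v) = cell_idx q O (complex.Re (y j))).
      have nI : cell_idx q O (complex.Im v) <> cell_idx q O (complex.Im (y j)).
        by move=> eI; apply: ne; rewrite /cell eR eI.
      have [b hb] := cell_idx_edge q0 p2 dIm nI.
      exists (cell (y j), (false, b)); rewrite /S /cz/= !inordK// hb.
      by rewrite cell_idx_mid.
    have [b hb] := cell_idx_edge q0 p1 dRe nR.
    exists (cell (y j), (true, b)); rewrite /S /cz/= !inordK// hb.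
    by rewrite cell_idx_mid// orbT.
  have := card_union_bound cover; rewrite -(ler_nat R) => /le_trans; apply.
  rewrite natr_sum; apply: le_trans (ler_sum _ (fun i _ => hK (cz i))) _.
  rewrite sumr_const -[Kr *+ _]mulr_natl ler_wpM2r//; first exact: le_trans (hK 0).
  rewrite !card_prod !card_bool card_ord.
  have Z1 : 1 <= Z%:R :> R by rewrite ler1n.
  rewrite !natrM -natr1 natrM.
  have : 0 <= Z%:R * (Z%:R - 1) :> R by rewrite mulr_ge0 ?subr_ge0.
  lra.
have [s hs] := exists_matching (fun j => cell (x j)) (fun j => cell (y j)).
exists s.
have bad : (#|[pred j | (2 / q%:R < cabs (x j - y (s j)))%R]| <=
    #|[pred j | cell (x j) != cell (y (s j))]|)%N.
  apply: subset_leq_card; apply/fintype.subsetP => j; rewrite !inE => hj.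
  apply/negP => /eqP[/(congr1 val) + /(congr1 val)] => /=.
  have [x1 x2 x3 x4] := xpos j; have [y1 y2 y3 y4] := ypos (s j).
  rewrite !inordK// => eR eI.
  have cR := cell_idx_close q0 x1 y1 eR; have cI := cell_idx_close q0 x2 y2 eI.
  move: hj; rewrite ltNge => /negP; apply.
  by apply: le_trans (cabs_le_ReIm _) _; rewrite ReB ImB; lra.
have Gq : q%:R ^+ 2 / 8 <= G0 + c * q%:R.
  by apply: le_trans G0ge _; rewrite lerDl mulr_ge0// ltW.
have q2 : 0 < q%:R ^+ 2 / 8 :> R by rewrite divr_gt0// exprn_gt0.
have iG : (G0 + c * q%:R)^-1 <= 8 / q%:R ^+ 2.
  by rewrite -[leRHS]invf_div lef_pV2 ?posrE.
apply: le_trans (_ : (#|[pred j | cell (x j) != cell (y (s j))]|)%:R <= _).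
  by rewrite ler_nat.
apply: le_trans (_ : (\sum_(Q : T) (#|[pred j | cell (y j) == Q]| -
    #|[pred i | cell (x i) == Q]|))%:R <= _); first by rewrite ler_nat.
apply: le_trans deficit _; rewrite lerD//; first rewrite lerD//.
  rewrite ler_wpM2r//.
  have -> : 1 - (G0 - c * q%:R) / (G0 + c * q%:R) =
     2 * c * q%:R * (G0 + c * q%:R)^-1 by field; rewrite gt_eqF.
  apply: le_trans (ler_wpM2l _ iG) _; first by rewrite !mulr_ge0// ltW.
  have -> : 2 * c * q%:R * (8 / q%:R ^+ 2) = 16 * c / q%:R :> R by field; rewrite gt_eqF.
  by [].
rewrite card_prod card_ord.
apply: le_trans (ler_wpM2l _ iG) _; first by rewrite mulr_ge0.
have -> : (N * N)%:R * e * (8 / q%:R ^+ 2) =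
  32 * Z%:R ^+ 2 * K%:R ^+ 2 * e / q%:R ^+ 2.
  by rewrite /N !natrM; field; rewrite gt_eqF.
by [].
Qed.

(** * Sample points and the matching at a fixed n *)

(** All circle points used by all bumps: grid centre (a, b), ring family 2/K or 1/K according to c,
    radius l, root of unity u. These are the z of the union bound. *)
Definition sample_pt (R : realType) (q K Z L : nat) (a b : nat) (c : bool)
    (l u : nat) : R[i] :=
  grid_pt (q%:R * K%:R)^-1 (Z%:R / q%:R) a b +
  (ring_rad L (if c then 2 * K%:R^-1 else K%:R^-1) l)%:C * omega R (6 * L) ^+ u.

Lemma big_eigval (R : realType) (n : nat) (A : 'M[R[i]]_n) (F : R[i] -> R) :
  \sum_(i < n) F (eigval A i) = \sum_(z <- eigvals A) F z.
Proof. by rewrite (big_nth 0) size_eigvals big_mkord. Qed.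

Lemma mem_eigval (R : realType) (n : nat) (A : 'M[R[i]]_n) (i : 'I_n) :
  eigval A i \in eigvals A.
Proof. by apply: mem_nth; rewrite size_eigvals. Qed.

(** The lower bound on A - z keeps the eigenvalues at distance at least s >= eta from z, so the
    floor is inactive and the potential is exactly a log-determinant. *)
Lemma sum_logmax_eigval (R : realType) (n : nat) (A : 'M[R[i]]_n) (z : R[i]) (s eta : R) :
  0 < eta -> eta <= s ->
  (forall v, s * l2norm v <= l2norm ((A - z%:M) *m v)) ->
  \sum_(i < n) logmax eta (eigval A i - z) = ln (cabs (\det (A - z%:M))).
Proof.
move=> e0 es h; have far x : x \in eigvals A -> s <= cabs (x - z).
  move=> /eigvals_eigenvector[v v0 hv]; have := h v.
  by rewrite mulmxBl mul_scalar_mx hv -scalerBl l2normZ ler_pM2r// l2norm_gt0.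
rewrite (big_eigval A (fun x => logmax eta (x - z))) cabs_det_sub.
elim: (eigvals A) far => [|x l IH] far; first by rewrite !big_nil ln1.
have x0 : 0 < cabs (x - z).
  by apply: lt_le_trans (far x (mem_head _ _)); exact: lt_le_trans es.
have far' y : y \in l -> s <= cabs (y - z).
  by move=> yl; apply: far; rewrite in_cons yl orbT.
have p : 0 < \prod_(y <- l) cabs (y - z).
  elim: l far' {IH far} => [|y l IH] far'; first by rewrite big_nil.
  rewrite big_cons mulr_gt0//.
    by apply: lt_le_trans (far' y (mem_head _ _)); exact: lt_le_trans es.
  by apply: IH => w wl; apply: far'; rewrite in_cons wl orbT.
rewrite !big_cons lnM ?posrE// IH//; congr (_ + _); rewrite /logmax max_l//.
by apply: le_trans es _; apply: far; rewrite mem_head.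
Qed.

(** Deterministic, with all parameters free. [E] is the error of the potentials at one sample point,
    [e] the resulting error for one bump. The floors differ: eta1 <= s leaves the eigenvalue side
    exact, while eta2 balances the rank of the modification against the relative size nu / eta2 of
    the noise. *)
Lemma spectrum_matching (R : realType) (k : nat) (a : int -> R[i]) (n L q K Z : nat)
    (N : 'M[R[i]]_n) (nu eta1 eta2 s Kst Kr rr : R) :
  let y := fun j : 'I_n => symbol_fun k a (omega R n ^+ j) in
  let B := toeplitz_mx k a n + N in
  let E := (k.*2%:R + rr) * ln (1 + Kst * (s^-1 + 2 / eta2)) +
           2 * n%:R * (nu / eta2) in
  let e := 2 * (E + n%:R * (2 + ln (16 * K%:R^-1 / eta1) +
                               ln (16 * K%:R^-1 / eta2)) / L%:R) in
  (0 < n)%N -> (0 < L)%N -> (0 < q)%N -> (0 < K)%N -> (0 < Z)%N ->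
  0 <= nu -> opbound N nu -> nu <= q%:R^-1 ->
  symbol_l1 k a + q%:R^-1 + (4 * q + 2)%:R * (q%:R * K%:R)^-1 <= Z%:R / q%:R ->
  0 < eta1 -> eta1 <= s -> eta1 <= K%:R^-1 / (2 * (6 * L)%:R) ->
  0 < eta2 -> eta2 <= 1 -> eta2 <= K%:R^-1 / (2 * (6 * L)%:R) -> nu / eta2 <= 2^-1 ->
  (forall (i j : nat) (c : bool) (l u : nat),
    (i < 2 * Z * K)%N -> (j < 2 * Z * K)%N -> (l < L)%N -> (u < 6 * L)%N ->
    2 * symbol_l1 k a + 2 * cabs (sample_pt R q K Z L i j c l u) + 1 <= Kst /\
    s < sigma_min (B - (sample_pt R q K Z L i j c l u)%:M)) ->
  (forall z, #|[pred j | cabs (y j - z) < eta2]|%:R <= rr) ->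
  (forall z : R[i], #|[pred j |
     ((`|complex.Re (y j) - complex.Re z| <= (2 * q%:R)^-1) &&
      (`|complex.Im (y j) - complex.Im z| <= 8 / K%:R)) ||
     ((`|complex.Re (y j) - complex.Re z| <= 8 / K%:R) &&
      (`|complex.Im (y j) - complex.Im z| <= (2 * q%:R)^-1))]|%:R <= Kr) ->
  exists p : 'S_n, #|[pred j : 'I_n | 2 / q%:R < cabs (eigval B j - y (p j))]|%:R <=
    36 * Z%:R ^+ 2 * Kr + 16 * grid_cst R / q%:R * n%:R +
    32 * Z%:R ^+ 2 * K%:R ^+ 2 * e / q%:R ^+ 2.
Proof.
move=> y B E e n0 L0 q0 K0 Z0 nu0 hN nuq hO e10 e1s er1 e20 e21 er2 nue hs hrr hKr.
have qR : 0 < q%:R :> R by rewrite ltr0n.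
have KR : 0 < K%:R :> R by rewrite ltr0n.
have r0 : 0 < K%:R^-1 :> R by rewrite invr_gt0.
have s0 : 0 < s by exact: lt_le_trans e1s.
have compare (i j : nat) (c : bool) (l u : nat) : (i < 2 * Z * K)%N ->
    (j < 2 * Z * K)%N -> (l < L)%N -> (u < 6 * L)%N ->
    `|\sum_(v < n) logmax eta1 (eigval B v - sample_pt R q K Z L i j c l u) -
      \sum_v logmax eta2 (y v - sample_pt R q K Z L i j c l u)| <= E.
  move=> hi hj hl hu; have [hKst hsig] := hs i j c l u hi hj hl hu.
  have low v := sigma_min_lower v n0 (ltW s0) hsig.
  rewrite (sum_logmax_eigval e10 e1s low).
  have eta2P : 0 < eta2 <= 1 by rewrite e20.
  apply: le_trans (logdet_compare n0 nu0 eta2P nue hN s0 low hKst) _.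
  rewrite /E lerD2r ler_wpM2r//.
    have lz := cabs_ge0 (sample_pt R q K Z L i j c l u).
    have ll := symbol_l1_ge0 k a.
    rewrite ln_ge0// lerDl mulr_ge0//; first lra.
    by rewrite addr_ge0// ?invr_ge0 ?divr_ge0// ltW.
  by rewrite natrD lerD2l; exact: hrr.
have K00 : (0 < 2 * Z * K)%N by rewrite !muln_gt0 Z0.
have e0 : 0 <= e.
  (* [E] bounds an absolute value at the first sample point. *)
  have lE : 0 <= E.
    have := @compare 0%N 0%N true 0%N 0%N K00 K00 L0 (_ : (0 < 6 * L)%N).
    by rewrite muln_gt0 L0 => /(_ isT)/(le_trans _); apply.
  rewrite /e mulr_ge0// addr_ge0// divr_ge0// mulr_ge0//.
  have lnp (t : R) : 0 < t -> t <= K%:R^-1 / (2 * (6 * L)%:R) -> 0 <= ln (16 * K%:R^-1 / t).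
    move=> t0 tK; rewrite ln_ge0// ler_pdivlMr// mul1r; apply: le_trans tK _.
    have m1 : 1 <= 2 * (6 * L)%:R :> R by rewrite -natrM ler1n !muln_gt0 L0.
    have m0 : 0 < 2 * (6 * L)%:R :> R by exact: lt_le_trans m1.
    rewrite ler_pdivrMr//; have := ler_wpM2l (ltW r0) m1; lra.
  by rewrite !addr_ge0 ?lnp.
have l0 := symbol_l1_ge0 k a.
have opB : opbound B (symbol_l1 k a + nu).
  by apply: opboundD => //; exact: opbound_toeplitz.
apply: (@grid_matching R n L q K Z (fun i : 'I_n => eigval B i) y
  (symbol_l1 k a + q%:R^-1) e Kr) => //.
- move=> i; have := eigvals_opbound opB (mem_eigval B i) => hb.
  have h2 : cabs (eigval B i) <= symbol_l1 k a + q%:R^-1 by apply: le_trans hb _; rewrite lerD2l.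
  by split; apply: le_trans h2; [exact: Re_le_cabs|exact: Im_le_cabs].
- move=> i; have h2 : cabs (y i) <= symbol_l1 k a + q%:R^-1.
    apply: le_trans (_ : symbol_l1 k a <= _).
      by apply: cabs_symbol_fun; rewrite cabsX cabs_omega expr1n.
    by rewrite lerDl invr_ge0.
  by split; apply: le_trans h2; [exact: Re_le_cabs|exact: Im_le_cabs].
- move=> i j hi hj; apply: bump_compare => // c l u.
  exact: (compare i j c l u).
Qed.

(** * Asymptotics of the parameters *)

(** Taken as an integer because it counts cells; once all sizes are powers of it, error estimates
    become algebra in q and 1/q. *)
Definition mesh (R : realType) (tau : R) (n : nat) : nat := Num.truncn (n%:R `^ tau).

Lemma mesh_bounds (R : realType) (tau : R) (n : nat) : 0 <= tau -> (0 < n)%N ->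
  [/\ (0 < mesh tau n)%N, (mesh tau n)%:R <= n%:R `^ tau &
      n%:R `^ tau <= 2 * (mesh tau n)%:R].
Proof.
move=> t0 n0; have n1 : 1 <= n%:R :> R by rewrite ler1n.
have Q1 : 1 <= n%:R `^ tau.
  by apply: le_trans (ler_powR n1 t0); rewrite powRr0.
have /andP[a b] := truncn_itv (le_trans ler01 Q1).
have q1 : (0 < mesh tau n)%N by rewrite /mesh truncn_gt0.
split=> //; apply: le_trans (ltW b) _; rewrite -/(mesh tau n) -natrM ler_nat; lia.
Qed.

Lemma powRN_le_mesh (R : realType) (tau e : R) (n m : nat) : 0 <= tau -> (0 < n)%N ->
  tau * m%:R <= e -> n%:R `^ (- e) <= ((mesh tau n)%:R^-1) ^+ m.
Proof.
move=> t0 n0 te; have [q1 qQ _] := mesh_bounds t0 n0.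
have n1 : 1 <= n%:R :> R by rewrite ler1n.
have qR : 0 < (mesh tau n)%:R :> R by rewrite ltr0n.
rewrite powRN exprVn lef_pV2 ?posrE ?exprn_gt0 ?powR_gt0 ?ltr0n//.
apply: le_trans (_ : n%:R `^ (tau * m%:R) <= _); last by rewrite ler_powR.
by rewrite powRrM powR_mulrn ?powR_ge0// lerXn2r// nnegrE ?powR_ge0.
Qed.

(** Since ln n = ln(n^tau) / tau <= n^tau / tau, a logarithm is charged as one factor q. *)
Lemma ln_le_mesh (R : realType) (tau : R) (n : nat) : 0 < tau -> (0 < n)%N ->
  ln n%:R <= 2 / tau * (mesh tau n)%:R.
Proof.
move=> t0 n0; have [_ _ Qq] := mesh_bounds (ltW t0) n0.
have Q0 : 0 < n%:R `^ tau by apply: powR_gt0; rewrite ltr0n.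
have -> : ln n%:R = ln (n%:R `^ tau) / tau.
  by rewrite ln_powR mulrC mulKf// gt_eqF.
rewrite mulrAC ler_pM2r ?invr_gt0//.
by apply: le_trans (ltW (ln_sublinear Q0)) Qq.
Qed.

Lemma near_mesh_ge (R : realType) (tau G : R) : 0 < tau ->
  \forall n \near \oo, G <= (mesh tau n)%:R.
Proof.
move=> t0; pose A := `|G| + 1; have A1 : 1 <= A by rewrite lerDr.
have A0 : 0 < A by exact: lt_le_trans A1.
exists (Num.truncn (A `^ tau^-1)).+1 => // n /= hn.
have hA : A `^ tau^-1 <= n%:R.
  apply: le_trans (ltW (truncnS_gt _)) _; by rewrite ler_nat.
have AQ : A <= n%:R `^ tau.
  have -> : A = (A `^ tau^-1) `^ tau.
    by rewrite -powRrM mulVf ?lt0r_neq0// powRr1// ltW.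
  by apply: ge0_ler_powR; rewrite ?nnegrE ?powR_ge0 ?(ltW t0).
have Q0 := le_trans (ltW A0) AQ.
have := truncn_itv Q0 => /andP[_]; rewrite -/(mesh tau n) -natr1 => h.
have := ler_norm G; rewrite /A in AQ; lra.
Qed.

Lemma near_nat_ge (R : realType) (G : R) : \forall n \near \oo, G <= n%:R.
Proof.
exists (Num.truncn G).+1 => // n /= hn.
by apply: le_trans (ltW (truncnS_gt _)) _; rewrite ler_nat.
Qed.

Lemma eq_ler (R : realType) (x y : R) : x = y -> x <= y.
Proof. by move=> ->. Qed.

Lemma expr_cancel (R : realType) (q u : R) (m p : nat) :
  q * u = 1 -> q ^+ m * u ^+ (m + p) = u ^+ p.
Proof. by move=> qu; rewrite exprD mulrA -exprMn qu expr1n mul1r. Qed.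

(** With u = 1/q, each term of the matching bound becomes a constant times n u. The factor Z^2 K^2 /
    q^2 costs q^(2c), so e must be of order n u^(2c+1). As the logarithms l1, l2, l3 cost one more
    q, the ranks divided by n and 1/L must be of order u^(2c+2), and the noise ratio of order
    u^(2c+1). *)
Lemma error_budget (R : realType) (c : nat) (q u n Kr rr nue kk A B l1 l2 l3 g
    Z Ka1 Ka2 M k0 E e : R) :
  q * u = 1 -> 1 <= q -> 0 <= u -> 0 <= n -> 0 <= Ka1 -> 0 <= Ka2 -> 0 <= M -> 0 <= k0 ->
  0 <= A -> 0 <= Z -> 0 <= kk -> 0 <= rr ->
  Kr <= Ka1 * n * u ^+ 3 -> rr <= Ka2 * n * u ^+ (2 * c + 2) ->
  nue <= M * u ^+ (2 * c + 1) -> kk <= k0 * n * u ^+ (2 * c + 2) ->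
  l1 <= A * q -> l2 <= A * q -> l3 <= A * q -> Z <= B * q ->
  E = (kk + rr) * l1 + 2 * n * nue ->
  e = 2 * (E + n * (2 + l2 + l3) / q ^+ (2 * c + 2)) ->
  36 * Z ^+ 2 * Kr + 16 * g / q * n + 32 * Z ^+ 2 * (q ^+ c) ^+ 2 * e / q ^+ 2 <=
  (36 * B ^+ 2 * Ka1 + 16 * g +
   64 * B ^+ 2 * ((k0 + Ka2) * A + 2 * M + 2 + 2 * A)) * (n * u).
Proof.
move=> qu q1 u0 n0 K10 K20 M0 k00 A0 Z0 kk0 rr0 hKr hrr hnue hkk hl1 hl2 hl3 hZ EE eE.
have qp : 0 < q by lra.
have uE : q^-1 = u by rewrite -[u]mul1r -(mulVf (lt0r_neq0 qp)) -mulrA qu mulr1.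
set w := u ^+ (2 * c + 1).
have w0 : 0 <= w by exact: exprn_ge0.
have qw : q * u ^+ (2 * c + 2) = w.
  by rewrite /w addn2 addn1 exprS mulrA qu mul1r.
have Aq0 : 0 <= A * q by rewrite mulr_ge0// ltW.
have hE : E <= ((k0 + Ka2) * A + 2 * M) * (n * w).
  have h1 : (kk + rr) * l1 <= (k0 + Ka2) * A * (n * w).
    apply: le_trans (_ : ((k0 + Ka2) * n * u ^+ (2 * c + 2)) * (A * q) <= _).
      apply: le_trans (ler_wpM2l (addr_ge0 kk0 rr0) hl1) _.
      by rewrite ler_wpM2r// 2!mulrDl lerD.
    by rewrite -qw; apply: eq_ler; ring.
  have h2 := ler_wpM2l (mulr_ge0 (ler0n R 2) n0) hnue.
  rewrite EE [leRHS]mulrDl lerD//; apply: le_trans h2 _.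
  by rewrite -/w; apply: eq_ler; ring.
have he : e <= 2 * ((k0 + Ka2) * A + 2 * M + 2 + 2 * A) * (n * w).
  have h1 : n * (2 + l2 + l3) / q ^+ (2 * c + 2) <= (2 + 2 * A) * (n * w).
    rewrite -exprVn uE.
    apply: le_trans (_ : n * ((2 + 2 * A) * q) * u ^+ (2 * c + 2) <= _).
      rewrite ler_wpM2r ?exprn_ge0// ler_wpM2l//; lra.
    by rewrite -qw; apply: eq_ler; ring.
  rewrite eE -[leRHS]mulrA ler_wpM2l//.
  by apply: le_trans (lerD hE h1) _; apply: eq_ler; ring.
set D := (k0 + Ka2) * A + 2 * M + 2 + 2 * A in he *.
have D0 : 0 <= D.
  by rewrite /D !addr_ge0 ?mulr_ge0// addr_ge0.
have Z2 : Z ^+ 2 <= B ^+ 2 * q ^+ 2.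
  by rewrite -exprMn lerXn2r// nnegrE//; exact: le_trans hZ.
rewrite [leRHS]mulrDl [X in _ <= X + _]mulrDl; apply: lerD; first apply: lerD.
- apply: le_trans (_ : 36 * Z ^+ 2 * (Ka1 * n * u ^+ 3) <= _).
    by rewrite ler_wpM2l// mulr_ge0// sqr_ge0.
  apply: le_trans (_ : 36 * (B ^+ 2 * q ^+ 2) * (Ka1 * n * u ^+ 3) <= _).
    by rewrite ler_wpM2r ?mulr_ge0 ?exprn_ge0// ler_wpM2l.
  have e3 : q ^+ 2 * u ^+ 3 = u by rewrite (expr_cancel 2 1 qu) expr1.
  have -> : 36 * (B ^+ 2 * q ^+ 2) * (Ka1 * n * u ^+ 3) =
    36 * B ^+ 2 * Ka1 * (n * (q ^+ 2 * u ^+ 3)) by ring.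
  by rewrite e3.
- by rewrite uE; apply: eq_ler; ring.
- have -> : 32 * Z ^+ 2 * (q ^+ c) ^+ 2 * e / q ^+ 2 =
      32 * (Z ^+ 2 * ((q ^+ c) ^+ 2 * u ^+ 2)) * e by rewrite -uE exprVn; ring.
  apply: le_trans (_ : 32 * (Z ^+ 2 * ((q ^+ c) ^+ 2 * u ^+ 2)) * (2 * D * (n * w)) <= _).
    by rewrite ler_wpM2l// !mulr_ge0// ?exprn_ge0// ?exprn_ge0// ltW.
  apply: le_trans (_ : 32 * (B ^+ 2 * q ^+ 2 * ((q ^+ c) ^+ 2 * u ^+ 2)) *
      (2 * D * (n * w)) <= _).
    rewrite ler_wpM2r ?mulr_ge0// ler_wpM2l// ler_wpM2r//.
    by rewrite mulr_ge0// ?exprn_ge0// ?exprn_ge0// ltW.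
  have -> : 32 * (B ^+ 2 * q ^+ 2 * ((q ^+ c) ^+ 2 * u ^+ 2)) * (2 * D * (n * w)) =
    64 * B ^+ 2 * D * (n * ((q ^+ 2 * u ^+ 2) * ((q ^+ c) ^+ 2 * w))) by ring.
  rewrite -exprMn qu expr1n mul1r -exprM mulnC /w (expr_cancel (2 * c) 1 qu) expr1.
  by [].
Qed.

(** The grid fills a square of half-side O, whose corners have modulus sqrt 2 times O: the origin of
    the factor sqrt 2 in beta. *)
Lemma cabs_grid_pt (R : realType) (h O : R) (N i j : nat) :
  0 <= h -> (i < N)%N -> (j < N)%N -> N%:R * h = 2 * O ->
  cabs (grid_pt h O i j) <= Num.sqrt 2 * O.
Proof.
move=> h0 iN jN NO.
have O0 : 0 <= O by have := mulr_ge0 (ler0n R N) h0; lra.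
have b (t : nat) : (t < N)%N -> (t%:R * h - O) ^+ 2 <= O ^+ 2.
  move=> tN; have t0 : 0 <= t%:R * h by rewrite mulr_ge0.
  have tO : t%:R * h <= 2 * O by rewrite -NO ler_wpM2r// ler_nat ltnW.
  by rewrite -subr_ge0 subr_sqr; apply: mulr_ge0; lra.
rewrite -(@ler_pXn2r _ 2)// ?nnegrE ?cabs_ge0 ?mulr_ge0 ?sqrtr_ge0//.
rewrite cabs_sq exprMn sqr_sqrtr//=.
by have := b _ iN; have := b _ jN; lra.
Qed.

Lemma sqrt2_ge1 (R : realType) : 1 <= Num.sqrt 2 :> R.
Proof. by rewrite -[leLHS]sqrtr1 ler_sqrt// ler1n. Qed.

(** The half-side Z/q exceeds ell by at most 3/q and the rings reach at most 4/K <= 4/q further; q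
    >= 7 makes the excess 7/q at most 1. *)
Lemma cabs_sample_pt (R : realType) (ell : R) (q K Z L i j : nat) (c : bool) (l u : nat) :
  (7 <= q)%N -> (q <= K)%N -> 0 <= ell -> Z%:R <= ell * q%:R + 3 ->
  (i < 2 * Z * K)%N -> (j < 2 * Z * K)%N -> (l < L)%N ->
  cabs (sample_pt R q K Z L i j c l u) <= Num.sqrt 2 * (ell + 1).
Proof.
move=> q7 qK l0 hZ hi hj hl.
have q0 : 0 < q%:R :> R by rewrite ltr0n; lia.
have K0 : 0 < K%:R :> R by rewrite ltr0n; lia.
have K1 : 0 < K%:R^-1 :> R by rewrite invr_gt0.
have NO : (2 * Z * K)%:R * (q%:R * K%:R)^-1 = 2 * (Z%:R / q%:R) :> R.
  by rewrite !natrM; field; rewrite !gt_eqF.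
have hh : 0 <= (q%:R * K%:R)^-1 :> R by rewrite invr_ge0 mulr_ge0// ltW.
have g1 := cabs_grid_pt hh hi hj NO.
have rb : 0 <= @ring_rad R L (if c then 2 * K%:R^-1 else K%:R^-1) l <= 4 * (K%:R^-1 : R).
  have K2 : 0 < (if c then 2 * K%:R^-1 else K%:R^-1) :> R.
    by case: c => //; rewrite mulr_gt0.
  have /andP[b1 b2] := ring_rad_bounds hl K2.
  have b3 : (if c then 2 * K%:R^-1 else K%:R^-1) <= 2 * K%:R^-1 :> R.
    by case: (c); lra.
  rewrite (le_trans (ltW K2) b1)/=; lra.
apply: le_trans (cabsD _ _) _.
rewrite cabsM cabs_real cabsX cabs_omega expr1n mulr1.
have /andP[rb0 rb1] := rb; rewrite ger0_norm//.
have Kq : K%:R^-1 <= q%:R^-1 :> R by rewrite lef_pV2 ?posrE// ler_nat.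
have q7' : q%:R^-1 <= 7^-1 :> R by rewrite lef_pV2 ?posrE// ler_nat.
have s1 := sqrt2_ge1 R.
have Zq : Z%:R / q%:R <= ell + 3 * q%:R^-1.
  by rewrite ler_pdivrMr// mulrDl mulfVK ?gt_eqF.
have h1 : Num.sqrt 2 * (Z%:R / q%:R) <= Num.sqrt 2 * (ell + 3 * q%:R^-1).
  by rewrite ler_wpM2l// sqrtr_ge0.
have p : 0 <= q%:R^-1 :> R by rewrite invr_ge0 ltW.
have h2 : 4 * q%:R^-1 <= Num.sqrt 2 * (4 * q%:R^-1) :> R by rewrite ler_peMl// mulr_ge0.
have h3 : Num.sqrt 2 * (ell + 3 * q%:R^-1) + Num.sqrt 2 * (4 * q%:R^-1) <=
    Num.sqrt 2 * (ell + 1).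
  by rewrite -mulrDr ler_wpM2l ?sqrtr_ge0//; lra.
lra.
Qed.

Lemma rect_count_le (R : realType) (f : R[i] -> R[i]) (c e K : R) (n : nat) (z : R[i]) :
  bigO_with K (fun n => ereal_sup [set ((rect_count f c e n z)%:R : R)%:E | z in [set: R[i]]])
    (fun n => n%:R `^ (1 - 3 * e)) ->
  K <= n%:R -> (rect_count f c e n z)%:R <= K * n%:R `^ (1 - 3 * e).
Proof.
move=> [_ h] /h; move=> h'.
rewrite -lee_fin; apply: le_trans h'; apply: le_trans (lee_abs _).
by apply: ereal_sup_ubound; exists z.
Qed.

Lemma powR_1B3 (R : realType) (e tau : R) (n m : nat) : 0 <= tau -> (0 < n)%N ->
  tau * m%:R <= 3 * e ->
  n%:R `^ (1 - 3 * e) <= n%:R * ((mesh tau n)%:R^-1) ^+ m.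
Proof.
move=> t0 n0 h; have nR : 0 < n%:R :> R by rewrite ltr0n.
rewrite powRD; last by apply/implyP => _; rewrite gt_eqF.
by rewrite powRr1 ?ler_pM2l ?powRN_le_mesh.
Qed.

Lemma ln_poly_le_mesh (R : realType) (tau A e t : R) (n : nat) : 0 < tau -> (0 < n)%N ->
  1 <= A -> 0 <= e -> 0 < t -> t <= A * n%:R `^ e ->
  ln t <= (ln A + e * (2 / tau)) * (mesh tau n)%:R.
Proof.
move=> t0 n0 A1 e0 tp tA; have [q1 _ _] := mesh_bounds (ltW t0) n0.
have nR : 0 < n%:R `^ e by apply: powR_gt0; rewrite ltr0n.
have A0 : 0 < A by exact: lt_le_trans A1.
have : ln t <= ln (A * n%:R `^ e) by rewrite ler_ln ?posrE// mulr_gt0.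
move=> /le_trans; apply; rewrite lnM ?posrE// ln_powR mulrDl lerD//.
  by rewrite ler_peMr ?ln_ge0// ler1n.
by rewrite -mulrA ler_wpM2l// ln_le_mesh.
Qed.

Lemma mesh_inv_le (R : realType) (tau : R) (n : nat) : 0 <= tau -> (0 < n)%N ->
  (mesh tau n)%:R^-1 <= 2 * n%:R `^ (- tau).
Proof.
move=> t0 n0; have [q1 _ Qq] := mesh_bounds t0 n0.
have qR : 0 < (mesh tau n)%:R :> R by rewrite ltr0n.
have QR : 0 < n%:R `^ tau :> R by apply: powR_gt0; rewrite ltr0n.
by rewrite powRN ler_pdivlMr// mulrC ler_pdivrMr.
Qed.

(** As c0 >= 1, the disc of radius n^(-c0 e) fits in the first rectangle of the assumption. *)
Lemma small_count_le (R : realType) (k : nat) (a : int -> R[i]) (c0 e K : R) (n : nat)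
    (z : R[i]) : 1 <= c0 -> 0 <= e -> (0 < n)%N ->
  (rect_count (symbol_fun k a) c0 e n z)%:R <= K ->
  #|[pred j : 'I_n | cabs (symbol_fun k a (omega R n ^+ j) - z) < n%:R `^ (- (c0 * e))]|%:R <= K.
Proof.
move=> c01 e0 n0; apply: le_trans; rewrite ler_nat; apply: subset_leq_card.
apply/fintype.subsetP => j; rewrite !inE => h; left; split.
  rewrite -ReB; apply: le_trans (Re_le_cabs _) _; apply: le_trans (ltW h) _.
  by apply: ler_powR; rewrite ?ler1n// lerN2 ler_peMl.
by rewrite -ImB; apply: le_trans (Im_le_cabs _) (ltW h).
Qed.

(** The two rectangles of the assumption cover the neighbourhoods of a horizontal and of a vertical
    cell side. *)
Lemma strip_count_le (R : realType) (k : nat) (a : int -> R[i]) (c0 e K r1 r2 : R) (n : nat)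
    (z : R[i]) :
  let y := fun j : 'I_n => symbol_fun k a (omega R n ^+ j) in
  r1 <= n%:R `^ (- e) -> r2 <= n%:R `^ (- (c0 * e)) ->
  (rect_count (symbol_fun k a) c0 e n z)%:R <= K ->
  #|[pred j : 'I_n |
     ((`|complex.Re (y j) - complex.Re z| <= r1) &&
      (`|complex.Im (y j) - complex.Im z| <= r2)) ||
     ((`|complex.Re (y j) - complex.Re z| <= r2) &&
      (`|complex.Im (y j) - complex.Im z| <= r1))]|%:R <= K.
Proof.
move=> y h1 h2; apply: le_trans; rewrite ler_nat; apply: subset_leq_card.
apply/fintype.subsetP => j; rewrite !inE => /orP[/andP[a1 a2]|/andP[a1 a2]].
  by left; split; [exact: le_trans h1|exact: le_trans h2].
by right; split; [exact: le_trans h2|exact: le_trans h1].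
Qed.

(** The choice of parameters. The conditions on tau say, in order: the assumption is available at
    the exponent tau(3c+5); the noise divided by eta2 is O(q^(-2c-1)); q^(2c+2) <= n. The condition
    c0 <= c - 2 makes K large enough for 8/K to be an admissible rectangle width. *)
Lemma spectrum_matching_large (R : realType) (k : nat) (a : int -> R[i])
    (eps0 c0 : R) (Ka : R -> R) (gam M kap tau : R) (c : nat) :
  let y (n : nat) := fun j : 'I_n => symbol_fun k a (omega R n ^+ j) in
  1 <= c0 ->
  (forall eps' : R, 0 < eps' <= eps0 ->
     bigO_with (Ka eps')
       (fun n => ereal_sup
          [set ((rect_count (symbol_fun k a) c0 eps' n z)%:R : R)%:E
          | z in [set: R[i]]])
       (fun n => n%:R `^ (1 - 3 * eps'))) ->
  0 < M -> 0 < kap -> 0 < tau -> (2 <= c)%N -> c0 <= (c - 2)%:R ->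
  tau * (3 * c + 5)%:R <= eps0 ->
  c0 * (tau * (3 * c + 5)%:R) + tau * (2 * c + 1)%:R <= gam ->
  tau * (2 * c + 2)%:R <= 1 ->
  exists2 C : R, 0 < C & \forall n \near \oo,
    let q := mesh tau n in let K := (q ^ c)%N in
    let Z := (Num.truncn (symbol_l1 k a * q%:R)).+3 in let L := (q ^ (2 * c + 2))%N in
    forall N : 'M[R[i]]_n, opbound N (M * n%:R `^ (- gam)) ->
    (forall (i j : nat) (b : bool) (l u : nat),
      (i < 2 * Z * K)%N -> (j < 2 * Z * K)%N -> (l < L)%N -> (u < 6 * L)%N ->
      n%:R `^ (- kap) <
        sigma_min (toeplitz_mx k a n + N - (sample_pt R q K Z L i j b l u)%:M)) ->
    exists p : 'S_n,
      #|[pred j : 'I_n | C * n%:R `^ (- tau) <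
           cabs (eigval (toeplitz_mx k a n + N) j - y n (p j))]|%:R <=
      C * (n%:R * n%:R `^ (- tau)).
Proof.
move=> y c01 hA M0 kap0 tau0 c2 cc t1 t2 t3.
pose ell := symbol_l1 k a; have ell0 : 0 <= ell := symbol_l1_ge0 k a.
(* The sum 3c + 5 = c + (2c+2) + 3 puts eta2 below 1/(12 K L): c for K, 2c + 2 for L, and q^3 >= 7^3
   for the factor 12. *)
pose e2 := tau * (3 * c + 5)%:R.
have e20 : 0 < e2 by rewrite mulr_gt0// ltr0n addn_gt0 orbT.
have taue2 : tau <= e2 by rewrite /e2 ler_peMr ?(ltW tau0)// ler1n addn_gt0 orbT.
have hA2 : 0 < e2 <= eps0 by rewrite e20.
have hA1 : 0 < tau <= eps0 by rewrite tau0 (le_trans taue2).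
have [Ka2p _] := hA _ hA2; have [Ka1p _] := hA _ hA1.
pose Kst := 2 * ell + 2 * (Num.sqrt 2 * (ell + 1)) + 1.
have Kst0 : 0 <= Kst by rewrite /Kst; have := mulr_ge0 (sqrtr_ge0 (2 : R)) (addr_ge0 ell0 ler01); lra.
(* The eigenvalue floor n^(-kap') has to be at most n^(-kap), the bound on sigma_min, and at most
   eta2, hence small compared with the rings. *)
pose kap' := Num.max kap (c0 * e2).
have kk' : kap <= kap' by rewrite le_max lexx.
have ck' : c0 * e2 <= kap' by rewrite le_max lexx orbT.
have kap'0 : 0 <= kap' by exact: le_trans (ltW kap0) kk'.
(* All three logarithms have arguments at most (16 + 3 Kst) n^kap'. *)
pose A := ln (16 + 3 * Kst) + kap' * (2 / tau).
have A16 : 1 <= 16 + 3 * Kst by lra.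
have A0 : 0 <= A.
  by rewrite /A addr_ge0 ?ln_ge0// mulr_ge0// divr_ge0// ltW.
pose D := 36 * (ell + 3) ^+ 2 * Ka tau + 16 * grid_cst R +
   64 * (ell + 3) ^+ 2 * ((k.*2%:R + Ka e2) * A + 2 * M + 2 + 2 * A).
exists (2 * `|D| + 4); first by have := normr_ge0 D; lra.
near=> n; move=> N hN hsig.
pose q := mesh tau n; pose K := (q ^ c)%N; pose L := (q ^ (2 * c + 2))%N.
(* Adding 3 after truncation gives Z >= ell q + 2: one cell of margin for the noise and one for the
   supports of the bumps. *)
pose Z := (Num.truncn (ell * q%:R)).+3.
have n0 : (0 < n)%N.
  rewrite -(ler_nat R); near: n; exact: near_nat_ge.
have nKa1 : Ka tau <= n%:R by near: n; exact: near_nat_ge.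
have nKa2 : Ka e2 <= n%:R by near: n; exact: near_nat_ge.
(* The bound 7 keeps the sample points within beta, 2M makes the noise ratio at most 1/2, and
   2^(c+1) serves the rectangle width 8/K. *)
have qG : 7 + 2 * M + 2 ^+ c.+1 <= q%:R.
  by rewrite /q; near: n; exact: near_mesh_ge.
have p2c : 0 <= 2 ^+ c.+1 :> R by exact: exprn_ge0.
have q7R : 7 <= q%:R :> R by lra.
have q2M : 2 * M <= q%:R by lra.
have q2c : 2 ^+ c.+1 <= q%:R :> R by lra.
have {qG} nR : 0 < n%:R :> R by rewrite ltr0n.
have [q0 qQ Qq] := mesh_bounds (ltW tau0) n0; rewrite -/q in q0 qQ Qq.
have q7 : (7 <= q)%N by rewrite -(ler_nat R).
have qR : 0 < q%:R :> R by rewrite ltr0n.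
pose u : R := q%:R^-1.
have u0 : 0 < u by rewrite invr_gt0.
have u7 : u <= 7^-1 by rewrite lef_pV2 ?posrE.
have u1 : u <= 1 by lra.
have qu : q%:R * u = 1 by rewrite mulfV// gt_eqF.
have uX m : 0 <= u ^+ m by rewrite exprn_ge0// ltW.
have KE : K%:R = q%:R ^+ c :> R by rewrite natrX.
have LE : L%:R = q%:R ^+ (2 * c + 2) :> R by rewrite natrX.
have K0 : (0 < K)%N by rewrite expn_gt0 q0.
have L0 : (0 < L)%N by rewrite expn_gt0 q0.
have iK : K%:R^-1 = u ^+ c :> R by rewrite KE exprVn.
have iL : L%:R^-1 = u ^+ (2 * c + 2) :> R by rewrite LE exprVn.
have low (e : R) m : tau * m%:R <= e -> n%:R `^ (- e) <= u ^+ m.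
  by move=> h; apply: powRN_le_mesh => //; exact: ltW.
have Pp (e : R) : 0 < n%:R `^ e by exact: powR_gt0.
have pow_le (e e' : R) : e <= e' -> n%:R `^ e <= n%:R `^ e'.
  by move=> h; rewrite ler_powR// ler1n.
pose eta2 := n%:R `^ (- (c0 * e2)); pose eta1 := n%:R `^ (- kap').
have e2c0 : e2 <= c0 * e2 by rewrite ler_peMl// ltW.
have eta2u : eta2 <= u ^+ (3 * c + 5) by exact: low.
have eta12 : eta1 <= eta2 by apply: pow_le; rewrite lerN2.
have eta1s : eta1 <= n%:R `^ (- kap) by apply: pow_le; rewrite lerN2.
have eta2r : eta2 <= K%:R^-1 / (2 * (6 * L)%:R).
  apply: le_trans eta2u _; rewrite iK natrM mulrA invfM iL.
  rewrite (_ : 3 * c + 5 = c + (2 * c + 2) + 3)%N; last by clear; lia.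
  rewrite 2!exprD [leRHS]mulrCA [leRHS]mulrC ler_wpM2l ?mulr_ge0 ?uX//.
  have := lerXn2r 3 _ _ u7; rewrite !nnegrE => /(_ (ltW u0)) h.
  apply: le_trans (h _) _; clear -u0; lra.
have eta21 : eta2 <= 1.
  by apply: le_trans eta2u _; rewrite exprn_ile1// ltW.
pose nu := M * n%:R `^ (- gam).
have nu0 : 0 <= nu by rewrite mulr_ge0 ?ltW// Pp.
have nueta : nu / eta2 <= M * u ^+ (2 * c + 1).
  rewrite /nu -mulrA ler_pM2l// /eta2 -powRN opprK -powRD; last first.
    by apply/implyP => _; rewrite gt_eqF.
  have -> : - gam + c0 * e2 = - (gam - c0 * e2) by ring.
  by apply: low; rewrite lerBrDl.
have ucu : u ^+ (2 * c + 1) <= u.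
  by rewrite addn1 exprS ler_piMr ?(ltW u0)// exprn_ile1// ltW.
have Mu : M * u <= 2^-1.
  have := ler_wpM2r (ltW u0) q2M; rewrite qu; lra.
have nue2 : nu / eta2 <= 2^-1.
  by apply: le_trans nueta _; apply: le_trans (ler_wpM2l (ltW M0) ucu) Mu.
have nuu : nu <= u.
  have h1 : nu <= M * u ^+ 2.
    rewrite /nu ler_pM2l//; apply: low; apply: le_trans t2.
    rewrite -[leLHS]add0r lerD//; first exact: mulr_ge0 (le_trans ler01 c01) (ltW e20).
    by rewrite ler_pM2l// ler_nat; clear -c2; lia.
  apply: le_trans h1 _; rewrite expr2 mulrA ler_piMl ?(ltW u0)//; lra.
have qK : (q <= K)%N by rewrite -[leqLHS]expn1 leq_pexp2l//; clear -c2; lia.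
have q4K : (4 * q + 2 <= K)%N.
  apply: (@leq_trans (q ^ 2)); first by rewrite expnS expn1; clear -q7; nia.
  by rewrite leq_pexp2l.
have lq0 : 0 <= ell * q%:R by rewrite mulr_ge0// ltW.
have /andP[Z1 Z2] := truncn_itv lq0.
have ZE : Z%:R = (Num.truncn (ell * q%:R))%:R + 3 :> R by rewrite /Z -addn3 natrD.
have Zup : Z%:R <= ell * q%:R + 3 by rewrite ZE lerD2r.
have Zlow : ell * q%:R + 2 <= Z%:R by move: Z2; rewrite ZE -natr1; clear; lra.
have hO : ell + q%:R^-1 + (4 * q + 2)%:R * (q%:R * K%:R)^-1 <= Z%:R / q%:R.
  have h1 : (4 * q + 2)%:R * (q%:R * K%:R)^-1 <= q%:R^-1 :> R.
    rewrite invfM mulrCA ler_piMr ?invr_ge0//.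
    by rewrite ler_pdivrMr ?ltr0n// mul1r ler_nat.
  rewrite ler_pdivlMr//; apply: le_trans Zlow.
  have := ler_wpM2r (ltW qR) h1; rewrite !mulrDl mulVf ?gt_eqF//; clear; lra.
pose rr := Ka e2 * n%:R * u ^+ (2 * c + 2).
pose Kr := Ka tau * n%:R * u ^+ 3.
have rr0 : 0 <= rr by rewrite /rr !mulr_ge0// ltW.
have hrr (z : R[i]) : #|[pred j | cabs (y n j - z) < eta2]|%:R <= rr.
  apply: small_count_le => //; first exact: ltW.
  apply: le_trans (rect_count_le z (hA _ hA2) nKa2) _.
  rewrite /rr -mulrA ler_pM2l//; apply: powR_1B3 => //; first exact: ltW.
  rewrite /e2 mulrCA ler_pM2l// -natrM ler_nat; clear; lia.
have hKr (z : R[i]) : #|[pred j |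
     ((`|complex.Re (y n j) - complex.Re z| <= (2 * q%:R)^-1) &&
      (`|complex.Im (y n j) - complex.Im z| <= 8 / K%:R)) ||
     ((`|complex.Re (y n j) - complex.Re z| <= 8 / K%:R) &&
      (`|complex.Im (y n j) - complex.Im z| <= (2 * q%:R)^-1))]|%:R <= Kr.
  apply: (strip_count_le (c0 := c0) (e := tau)).
  - rewrite powRN lef_pV2 ?posrE ?Pp// mulr_gt0//.
  - have Q1 : 1 <= n%:R `^ tau by apply: le_trans qQ; rewrite ler1n.
    rewrite powRN [c0 * tau]mulrC powRrM.
    have QcP : 0 < (n%:R `^ tau) `^ c0 by apply: powR_gt0; exact: Pp.
    rewrite -[leLHS]invf_div lef_pV2 ?posrE ?divr_gt0 ?ltr0n//.
    rewrite ler_pdivlMr// KE.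
    (* Here n^(c0 tau) <= (2q)^(c-2), and 8 (2q)^(c-2) <= q^c amounts to 2^(c+1) <= q^2. *)
    apply: le_trans (_ : (2 * q%:R) ^+ (c - 2) * 8 <= _).
      rewrite ler_pM2r//; apply: le_trans (ler_powR Q1 cc) _.
      rewrite powR_mulrn ?(ltW (Pp _))//.
      by rewrite lerXn2r// nnegrE ?mulr_ge0// ltW.
    rewrite -{2}(subnK c2) exprD exprMn mulrAC mulrC.
    rewrite ler_wpM2l ?exprn_ge0 ?(ltW qR)//.
    have e8 : 2 ^+ (c - 2) * 8 = 2 ^+ c.+1 :> R.
      by rewrite (_ : c.+1 = c - 2 + 3)%N ?exprD; [ring|clear -c2; lia].
    rewrite e8 expr2; apply: le_trans q2c _; rewrite ler_peMr ?(ltW qR)//; lra.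
  - apply: le_trans (rect_count_le z (hA _ hA1) nKa1) _.
    rewrite /Kr -mulrA ler_pM2l//; apply: powR_1B3 => //; first exact: ltW.
    by rewrite mulrC.
have hs (i j : nat) (b : bool) (l v : nat) :
    (i < 2 * Z * K)%N -> (j < 2 * Z * K)%N -> (l < L)%N -> (v < 6 * L)%N ->
    2 * symbol_l1 k a + 2 * cabs (sample_pt R q K Z L i j b l v) + 1 <= Kst /\
    n%:R `^ (- kap) < sigma_min (toeplitz_mx k a n + N - (sample_pt R q K Z L i j b l v)%:M).
  move=> hi hj hl hv; split; last exact: hsig.
  have := cabs_sample_pt b v q7 qK ell0 Zup hi hj hl.
  by clear; rewrite /Kst -/ell; lra.
have eta1r := le_trans eta12 eta2r.
have [p hp] := spectrum_matching n0 L0 q0 K0 (isT : (0 < Z)%N) nu0 hN nuu hO (Pp _)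
  eta1s eta1r (Pp _) eta21 eta2r nue2 hs hrr hKr.
exists p; set B := toeplitz_mx k a n + N in hp *.
have nt0 : 0 < n%:R `^ (- tau) by exact: Pp.
have ut : u <= 2 * n%:R `^ (- tau) by apply: mesh_inv_le => //; exact: ltW.
have D0 := normr_ge0 D.
apply: le_trans (_ : #|[pred j : 'I_n | 2 / q%:R < cabs (eigval B j - y n (p j))]|%:R <= _).
  rewrite ler_nat; apply: subset_leq_card; apply/fintype.subsetP => j; rewrite !inE.
  apply: le_lt_trans; rewrite -/u.
  have D4 : 4 <= 2 * `|D| + 4 by clear -D0; lra.
  by apply: le_trans (ler_wpM2r (ltW nt0) D4); clear -ut; lra.
apply: le_trans hp _.
have lnb t : 0 < t -> t <= (16 + 3 * Kst) * n%:R `^ kap' -> ln t <= A * q%:R.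
  by move=> t0 ht; apply: ln_poly_le_mesh.
have ieta2 : eta2^-1 = n%:R `^ (c0 * e2) by rewrite /eta2 -powRN opprK.
have ieta1 : eta1^-1 = n%:R `^ kap' by rewrite /eta1 -powRN opprK.
have is_ : (n%:R `^ (- kap))^-1 = n%:R `^ kap by rewrite -powRN opprK.
have le2 : n%:R `^ (c0 * e2) <= n%:R `^ kap' by exact: pow_le.
have le1 : n%:R `^ kap <= n%:R `^ kap' by exact: pow_le.
have ge1 : 1 <= n%:R `^ kap' by apply: le_trans (pow_le _ _ kap'0); rewrite powRr0.
have iK0 : 0 < K%:R^-1 :> R by rewrite invr_gt0 ltr0n.
have iK1 : K%:R^-1 <= 1 :> R by rewrite invf_le1 ?ltr0n// ler1n.
have log16 e : e <= kap' -> ln (16 * K%:R^-1 / (n%:R `^ (- e))) <= A * q%:R.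
  move=> he; rewrite powRN invrK; apply: lnb.
    by rewrite mulr_gt0 ?Pp// mulr_gt0.
  by apply: ler_pM; rewrite ?mulr_ge0 ?(ltW (Pp _)) ?(ltW iK0) ?pow_le//; clear -iK1 Kst0; lra.
have hl1 : ln (1 + Kst * ((n%:R `^ (- kap))^-1 + 2 / eta2)) <= A * q%:R.
  apply: lnb.
    apply: ltr_pwDl => //; rewrite mulr_ge0// addr_ge0 ?invr_ge0 ?(ltW (Pp _))//.
    by rewrite divr_ge0// ltW// Pp.
  rewrite ieta2 is_.
  have h1 : Kst * (n%:R `^ kap + 2 * n%:R `^ (c0 * e2)) <= Kst * (3 * n%:R `^ kap').
    by rewrite ler_wpM2l//; clear -le1 le2; lra.
  clear -h1 ge1 Kst0; lra.
have Zle : Z%:R <= (ell + 3) * q%:R.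
  by apply: le_trans Zup _; rewrite mulrDl lerD2l ler_peMr// ler1n.
(* The fixed rank 2k is put in the form of the other ranks, using q^(2c+2) <= n. *)
have kk : k.*2%:R <= k.*2%:R * n%:R * u ^+ (2 * c + 2).
  have h1 : q%:R ^+ (2 * c + 2) <= n%:R :> R.
    apply: le_trans (_ : (n%:R `^ tau) ^+ (2 * c + 2) <= _).
      by apply: lerXn2r; rewrite ?nnegrE// ltW// Pp.
    rewrite -powR_mulrn ?(ltW (Pp _))// -powRrM.
    by apply: le_trans (pow_le _ _ t3) _; rewrite powRr1// ltW.
  by rewrite -mulrA ler_peMr// /u exprVn ler_pdivlMr ?exprn_gt0// mul1r.
have q1R : 1 <= q%:R :> R by rewrite ler1n.
have hb := error_budget (c := c) (grid_cst R) qu q1R (ltW u0) (ltW nR)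
  (ltW Ka1p) (ltW Ka2p) (ltW M0) (ler0n R k.*2) A0 (ler0n R Z) (ler0n R k.*2) rr0
  (lexx Kr) (lexx rr) nueta kk hl1 (log16 _ (lexx kap')) (log16 _ ck') Zle erefl erefl.
rewrite LE [K%:R ^+ 2]/= {1}KE; apply: le_trans hb _; rewrite -/D.
apply: le_trans (_ : `|D| * (n%:R * u) <= _).
  by rewrite ler_wpM2r ?ler_norm// mulr_ge0 ?ltW.
have h1 : n%:R * u <= 2 * (n%:R * n%:R `^ (- tau)).
  by rewrite mulrCA ler_wpM2l// ltW.
have h2 : 0 <= n%:R * n%:R `^ (- tau) by rewrite mulr_ge0 ?ltW.
apply: le_trans (ler_wpM2l D0 h1) _.
by rewrite [leLHS]mulrA ler_wpM2r//; clear -D0; lra.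
Unshelve. all: by end_near.
Qed.

(** * Probability *)

(** It shows that the supremum defining [spectral_norm] is over a bounded set, as
    [spectral_norm_opbound] requires. *)
Lemma opbound_frobenius (R : realType) (m n : nat) (A : 'M[R[i]]_(m, n)) :
  opbound A (Num.sqrt (\sum_i \sum_j cabs (A i j) ^+ 2)).
Proof.
have p : 0 <= \sum_i \sum_j cabs (A i j) ^+ 2.
  by apply: sumr_ge0 => i _; apply: sumr_ge0 => j _; exact: sqr_ge0.
move=> v; rewrite -(@ler_pXn2r _ 2)// ?nnegrE ?mulr_ge0 ?l2norm_ge0 ?sqrtr_ge0//.
rewrite l2norm_sq exprMn sqr_sqrtr// mulr_suml; apply: ler_sum => i _.
have q : 0 <= \sum_j cabs (A i j) ^+ 2 by apply: sumr_ge0 => j _; exact: sqr_ge0.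
have -> : (\sum_j cabs (A i j) ^+ 2) * l2norm v ^+ 2 =
    (Num.sqrt (\sum_j cabs (A i j) ^+ 2) * l2norm v) ^+ 2.
  by rewrite exprMn (sqr_sqrtr q).
apply: lerXn2r; rewrite ?nnegrE ?cabs_ge0 ?mulr_ge0 ?sqrtr_ge0 ?l2norm_ge0//.
rewrite mxE; apply: le_trans (cabs_sum _ _ _) _.
under eq_bigr do rewrite cabsM.
exact: (sum_mul_le_sqrt (fun j => cabs (A i j)) (fun j => cabs (v j 0))).
Qed.

Lemma spectral_norm_opbound (R : realType) (n : nat) (A : 'M[R[i]]_n) (t : R) :
  spectral_norm A <= t -> opbound A t.
Proof.
move=> h v; have [->|v0] := eqVneq v 0; first by rewrite mulmx0 l2norm0 mulr0.
have nv := l2norm_gt0 v0.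
rewrite -ler_pdivrMr//; apply: le_trans h.
have cE : cabs ((l2norm v)^-1%:C) = (l2norm v)^-1.
  by rewrite cabs_real ger0_norm// invr_ge0 ltW.
apply: ub_le_sup.
  exists (Num.sqrt (\sum_i \sum_j cabs (A i j) ^+ 2)) => _ [w /= w1 <-].
  apply: le_trans (opbound_frobenius A w) _.
  by rewrite ler_piMr// sqrtr_ge0.
exists ((l2norm v)^-1%:C *: v) => /=.
  by rewrite l2normZ cE mulVf// gt_eqF.
by rewrite -scalemxAr l2normZ cE mulrC.
Qed.

(** A union bound by induction on the list. Measurability of each A i is what lets the probability
    of its complement control the intersection. *)
Lemma prob_inter_ge (R : realType) d (T : measurableType d) (P : probability T R)
    (B : set T) (b x : R) (I : eqType) (A : I -> set T) (s : seq I) :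
  measurable B -> (forall i, i \in s -> measurable (A i)) -> ((1 - b)%:E <= P B)%E ->
  (forall i, i \in s -> (P (~` A i) <= x%:E)%E) ->
  exists G : set T, [/\ measurable G,
    (forall t, G t -> B t /\ forall i, i \in s -> A i t) &
    ((1 - (b + (size s)%:R * x))%:E <= P G)%E].
Proof.
move=> mB; elim: s => [|i s IH] mA hB hA.
  exists B; split; [exact: mB|by move=> t Bt; split|by rewrite mul0r addr0].
have [] := IH _ hB.
- by move=> j js; apply: mA; rewrite in_cons js orbT.
- by move=> j js; apply: hA; rewrite in_cons js orbT.
move=> G [mG GB PG].
have mAi : measurable (A i) by apply: mA; rewrite mem_head.
exists (A i `&` G); split.
- exact: measurableI.
- move=> t [At Gt]; have [Bt h] := GB t Gt; split=> // j.
  by rewrite in_cons => /orP[/eqP->|/h].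
have le1 : (P G <= P (A i `&` G) + P (~` A i))%E.
  apply: le_trans (measureU2 _ _ _); first last.
  - exact: measurableC.
  - exact: measurableI.
  apply: le_measure; rewrite ?inE//.
    by apply: measurableU; [exact: measurableI|exact: measurableC].
  by move=> t Gt; have [At|nAt] := pselect (A i t); [left|right].
have le2 : ((1 - (b + (size s)%:R * x))%:E <= P (A i `&` G) + x%:E)%E.
  apply: le_trans PG _; apply: le_trans le1 _; rewrite leeD2l//.
  by apply: hA; rewrite mem_head.
have -> : 1 - (b + (size (i :: s))%:R * x) = 1 - (b + (size s)%:R * x) - x.
  by rewrite /= -natr1; ring.
by rewrite EFinB leeBlDr.
Qed.

Lemma powRN_cvg0 (R : realType) (e : R) : 0 < e -> n%:R `^ (- e) @[n --> \oo] --> (0 : R).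
Proof.
move=> e0; apply/cvgrPdist_le => eps eps0.
near=> n.
have n0 : (0 < n)%N by rewrite -(ler_nat R); near: n; exact: near_nat_ge.
have [q0 _ _] := mesh_bounds (ltW e0) n0.
rewrite sub0r normrN ger0_norm ?powR_ge0//.
have h : e * 1%:R <= e by rewrite mulr1.
apply: le_trans (powRN_le_mesh (ltW e0) n0 h) _; rewrite expr1.
rewrite -[leRHS]invrK lef_pV2 ?posrE ?invr_gt0 ?ltr0n//.
by near: n; exact: near_mesh_ge.
Unshelve. all: by end_near.
Qed.

Lemma perturbed_measurable (R : realType) (k : nat) (a : int -> R[i]) (alp gam : R)
    (E : random_matrices R) (n : nat) (z : R[i]) (i j : 'I_n) :
  measurable_fun setT (fun t : rm_space E n =>
    complex.Re ((perturbed k a alp gam t - z%:M) i j)) /\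
  measurable_fun setT (fun t : rm_space E n =>
    complex.Im ((perturbed k a alp gam t - z%:M) i j)).
Proof.
have [m1 m2] := @rm_meas R E n i j.
pose c := toeplitz_mx k a n i j - (z *+ (i == j)).
pose r := n%:R `^ (- alp - gam).
have e t : (perturbed k a alp gam t - z%:M) i j = c + r%:C * (@rm_mx R E n t i j).
  by rewrite /perturbed !mxE -/r /c mxE addrAC.
split.
  rewrite (_ : (fun t => _) = (fun t => complex.Re c + r * complex.Re (@rm_mx R E n t i j))).
    by apply: measurable_funD => //; exact: measurable_funM.
  apply/funext => t; rewrite {}e; case: c => c1 c2; case: (rm_mx _ i j) => x y /=.
  by rewrite mul0r subr0.
rewrite (_ : (fun t => _) = (fun t => complex.Im c + r * complex.Im (@rm_mx R E n t i j))).
  by apply: measurable_funD => //; exact: measurable_funM.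
apply/funext => t; rewrite {}e; case: c => c1 c2; case: (rm_mx _ i j) => x y /=.
by rewrite mul0r addr0.
Qed.

(** Grid points, two families, L radii and 6L points multiply to 48 Z^2 q^(6c+4), and Z is O(q). The
    exponent 6c + 6 is the one that tau must make cheap in the union bound. *)
Lemma sample_count_le (R : realType) (ell : R) (Z q c : nat) :
  0 <= ell -> (0 < q)%N -> Z%:R <= ell * q%:R + 3 ->
  (2 * Z * q ^ c * (2 * Z * q ^ c) *
    (2 * (q ^ (2 * c + 2) * (6 * q ^ (2 * c + 2)))))%:R <=
  48 * (ell + 3) ^+ 2 * q%:R ^+ (6 * c + 6) :> R.
Proof.
move=> ell0 q0 hZ.
have q1 : 1 <= q%:R :> R by rewrite ler1n.
have e : (2 * Z * q ^ c * (2 * Z * q ^ c) *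
    (2 * (q ^ (2 * c + 2) * (6 * q ^ (2 * c + 2)))) =
    48 * Z ^ 2 * q ^ (6 * c + 4))%N.
  have -> : (6 * c + 4 = c + c + ((2 * c + 2) + (2 * c + 2)))%N by clear; lia.
  rewrite !(expnD q (c + c)) !(expnD q c) !(expnD q (2 * c + 2)%N (2 * c + 2)%N).
  move: (q ^ c)%N (q ^ (2 * c + 2))%N => u v; clear; rewrite expnS expn1; nia.
rewrite e 2!natrM 2!natrX.
have -> : (6 * c + 6 = 2 + (6 * c + 4))%N by clear; lia.
rewrite (exprD _ 2) [leRHS](mulrA _ (q%:R ^+ 2)) ler_wpM2r ?exprn_ge0//.
rewrite -[leRHS](mulrA 48) ler_wpM2l// -exprMn.
apply: lerXn2r; rewrite ?nnegrE ?mulr_ge0 ?addr_ge0//.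
by apply: le_trans hZ _; rewrite mulrDl lerD2l ler_peMr.
Qed.

(** One event implies both conclusions: most pairs are close, and D controls the few exceptional
    eigenvalues. *)
Definition well_matched (R : realType) (k : nat) (a : int -> R[i]) (C D tau : R)
    (n : nat) (B : 'M[R[i]]_n) : Prop :=
  (forall j : 'I_n, cabs (eigval B j) <= D) /\
  exists p : 'S_n,
    #|[pred j : 'I_n | C * n%:R `^ (- tau) <
         cabs (eigval B j - symbol_fun k a (omega R n ^+ p j))]|%:R <=
    C * (n%:R * n%:R `^ (- tau)).

(** C and tau are fixed before E. For a given E, at most O(n^(del/2)) sample points, each failing
    with probability O(n^(-del)), leave a failure probability that tends to 0. *)
Lemma well_matched_whp (R : realType) (k : nat) (a : int -> R[i])
  (eps0 c0 : R) (Ka : R -> R)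
  (eps0_gt0 : 0 < eps0) (c0_ge1 : 1 <= c0)
  (assumption_a : forall eps' : R, 0 < eps' <= eps0 ->
     bigO_with (Ka eps')
       (fun n => ereal_sup
          [set ((rect_count (symbol_fun k a) c0 eps' n z)%:R : R)%:E
          | z in [set: R[i]]])
       (fun n => n%:R `^ (1 - 3 * eps')))
  (gam del M alp kap Ki Kii : R)
  (gam_gt0 : 0 < gam) (del_gt0 : 0 < del)
  (M_gt0 : 0 < M) (alp_ge0 : 0 <= alp) (kap_gt0 : 0 < kap) :
  exists C tau : R, [/\ 0 < C, 0 < tau, tau <= 1 &
    forall E : random_matrices R,
      with_prob_1_bigO Ki del
        (fun n => [set t : rm_space E n |
                   spectral_norm (rm_mx t) <= M * n%:R `^ alp]) ->
      bigO_with Kii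
        (fun n => ereal_sup
           [set rm_prob E n [set t |
                  sigma_min (perturbed k a alp gam t - z%:M)
                  <= n%:R `^ (- kap)]
           | z in [set z : R[i] | cabs z <= Num.sqrt 2 * (symbol_l1 k a + M + 1)]])
        (fun n => n%:R `^ (- del)) ->
      with_prob_1_o1 (fun n => [set t : rm_space E n |
        well_matched k a C (symbol_l1 k a + M) tau (perturbed k a alp gam t)])].
Proof.
pose c := (Num.truncn c0).+3.
pose T0 := Num.min (Num.min eps0 gam) (Num.min del 1).
have T00 : 0 < T0 by rewrite !lt_min eps0_gt0 gam_gt0 del_gt0 ltr01.
have T0e : T0 <= eps0 by rewrite !ge_min lexx.
have T0g : T0 <= gam by rewrite !ge_min lexx orbT.
have T0d : T0 <= del by rewrite !ge_min lexx !orbT.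
have T01 : T0 <= 1 by rewrite !ge_min lexx !orbT.
have c0p : 0 < c0 by exact: lt_le_trans c0_ge1.
(* Then c0 tau m <= T0/2 for every m <= 6c + 6. The half leaves room for the two terms in the
   condition on gam and gives n^(del/2) in the count of sample points. *)
pose tau := T0 / (c0 * (12 * c + 12)%:R).
have dp : 0 < c0 * (12 * c + 12)%:R by rewrite mulr_gt0// ltr0n.
have tau0 : 0 < tau by rewrite divr_gt0.
have ctau m : (m <= 6 * c + 6)%N -> c0 * (tau * m%:R) <= T0 / 2.
  move=> hm; have -> : c0 * (tau * m%:R) = T0 * (m%:R / (12 * c + 12)%:R).
    by rewrite /tau; field; rewrite !gt_eqF// ltr0n.
  rewrite ler_pM2l// ler_pdivrMr ?ltr0n// mulrC ler_pdivlMr// -natrM ler_nat.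
  by clear -hm; lia.
have taum m : (m <= 6 * c + 6)%N -> tau * m%:R <= T0 / 2.
  move=> hm; apply: le_trans (ctau m hm).
  by rewrite ler_peMl// mulr_ge0// ltW.
have c2 : (2 <= c)%N by [].
have cc : c0 <= (c - 2)%:R by rewrite /c subn2/= ltW// truncnS_gt.
have t1 : tau * (3 * c + 5)%:R <= eps0.
  have := @taum (3 * c + 5)%N ltac:(clear; lia); clear -T0e T00; lra.
have t2 : c0 * (tau * (3 * c + 5)%:R) + tau * (2 * c + 1)%:R <= gam.
  have := @ctau (3 * c + 5)%N ltac:(clear; lia).
  have := @taum (2 * c + 1)%N ltac:(clear; lia); clear -T0g T00; lra.
have t3 : tau * (2 * c + 2)%:R <= 1.
  have := @taum (2 * c + 2)%N ltac:(clear; lia); clear -T01 T00; lra.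
have tau1 : tau <= 1.
  by apply: le_trans t3; rewrite ler_peMr ?(ltW tau0)// ler1n addn2.
have [C C0 hC] := spectrum_matching_large c0_ge1 assumption_a M_gt0 kap_gt0 tau0 c2 cc t1 t2 t3.
exists C, tau; split=> // E [Ki0 hi] [Kii0 hii].
pose ell := symbol_l1 k a; have ell0 : 0 <= ell := symbol_l1_ge0 k a.
pose Cs : R := 48 * (ell + 3) ^+ 2.
have Cs0 : 0 <= Cs by rewrite mulr_ge0// sqr_ge0.
exists (fun n => Ki * n%:R `^ (- del) + Cs * Kii * n%:R `^ (- (del / 2))).
split.
  have -> : (0 : R) = Ki * 0 + Cs * Kii * 0 by rewrite !mulr0 addr0.
  apply: cvgD; apply: cvgM; try exact: cvg_cst; apply: powRN_cvg0 => //.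
  by rewrite divr_gt0.
have G : \forall n \near \oo, [/\ (0 < n)%N, Ki <= n%:R, Kii <= n%:R &
    7 <= (mesh tau n)%:R :> R].
  near=> n; split.
  - by rewrite -(ler_nat R); near: n; exact: near_nat_ge.
  - by near: n; exact: near_nat_ge.
  - by near: n; exact: near_nat_ge.
  - by near: n; exact: near_mesh_ge.
apply: filterS2 hC G => n hCn [n0 nKi nKii hq7].
have nR : 0 < n%:R :> R by rewrite ltr0n.
have n1 : 1 <= n%:R :> R by rewrite ler1n.
pose q := mesh tau n; pose K := (q ^ c)%N; pose L := (q ^ (2 * c + 2))%N.
pose Z := (Num.truncn (ell * q%:R)).+3.
have q7 : (7 <= q)%N by rewrite -(ler_nat R).
have q0 : (0 < q)%N by apply: leq_trans q7.
have qK : (q <= K)%N by rewrite -[leqLHS]expn1 leq_pexp2l.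
have lq0 : 0 <= ell * q%:R by rewrite mulr_ge0.
have Zup : Z%:R <= ell * q%:R + 3.
  by rewrite /Z -addn3 natrD lerD2r; have /andP[] := truncn_itv lq0.
have [B [mB BE PB]] := hi n nKi.
pose I := ('I_(2 * Z * K) * 'I_(2 * Z * K) * (bool * ('I_L * 'I_(6 * L))))%type.
pose zp (x : I) := sample_pt R q K Z L x.1.1 x.1.2 x.2.1 x.2.2.1 x.2.2.2.
pose A (x : I) := [set t : rm_space E n |
  n%:R `^ (- kap) < sigma_min (perturbed k a alp gam t - (zp x)%:M)].
have mA x : measurable (A x).
  apply: measurable_sigma_min_gt; [exact: n0|exact: powR_ge0|].
  by move=> i j; exact: perturbed_measurable.
have PA x : (rm_prob E n (~` A x) <= (Kii * n%:R `^ (- del))%:E)%E.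
  apply: le_trans (hii n nKii); apply: le_trans (lee_abs _).
  apply: ereal_sup_ubound; exists (zp x) => /=.
    apply: le_trans (cabs_sample_pt _ _ q7 qK ell0 Zup (ltn_ord _) (ltn_ord _) (ltn_ord _)) _.
    by rewrite ler_wpM2l ?sqrtr_ge0// lerD2r lerDl ltW.
  congr (rm_prob E n _); apply/seteqP; split=> t /=; rewrite /A/=.
    by rewrite leNgt => /negP.
  by move=> /negP; rewrite -leNgt.
have [H [mH HB PH]] := prob_inter_ge (s := enum {: I}) mB (fun i _ => mA i) PB (fun i _ => PA i).
exists H; split=> //.
  move=> t /HB[Bt At].
  pose N := (n%:R `^ (- alp - gam))%:C *: @rm_mx R E n t.
  have hN : opbound N (M * n%:R `^ (- gam)).
    have h1 := opboundZ (n%:R `^ (- alp - gam))%:C (spectral_norm_opbound (BE t Bt)).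
    apply: opbound_le h1; rewrite cabs_real ger0_norm ?powR_ge0// mulrCA.
    rewrite ler_pM2l// -powRD; last by apply/implyP => _; rewrite gt_eqF.
    by rewrite addrAC addNr add0r.
  split.
    move=> j; have hB : opbound (perturbed k a alp gam t) (ell + M * n%:R `^ (- gam)).
      by apply: opboundD hN; exact: opbound_toeplitz.
    apply: le_trans (eigvals_opbound hB (mem_eigval _ j)) _.
    rewrite lerD2l ler_piMr ?(ltW M_gt0)//.
    by apply: le_trans (ler_powR n1 (_ : - gam <= 0)) _; rewrite ?powRr0// oppr_le0 ltW.
  apply: (hCn N hN) => i j b l u hi' hj' hl hu.
  exact: (At (Ordinal hi', Ordinal hj', (b, (Ordinal hl, Ordinal hu))) (mem_enum _ _)).
apply: le_trans PH; rewrite lee_fin lerB// lerD2l -cardE.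
have card : #|{: I}|%:R <= Cs * n%:R `^ (del / 2).
  rewrite !card_prod !card_ord card_bool.
  apply: le_trans (sample_count_le c ell0 q0 Zup) _; rewrite -/Cs.
  rewrite ler_wpM2l//.
  have [_ qQ _] := mesh_bounds (ltW tau0) n0.
  apply: le_trans (_ : (n%:R `^ tau) ^+ (6 * c + 6) <= _).
    by apply: lerXn2r; rewrite ?nnegrE ?powR_ge0.
  rewrite -powR_mulrn ?powR_ge0// -powRrM ler_powR//.
  by have := @taum (6 * c + 6)%N (leqnn _); clear -T0d; lra.
apply: le_trans (ler_wpM2r (mulr_ge0 (ltW Kii0) (powR_ge0 _ _)) card) _.
have -> : Cs * n%:R `^ (del / 2) * (Kii * n%:R `^ (- del)) =
   Cs * Kii * (n%:R `^ (del / 2) * n%:R `^ (- del)) by ring.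
rewrite -powRD; last by apply/implyP => _; rewrite gt_eqF.
by have -> : del / 2 + - del = - (del / 2) by field.
Unshelve. all: by end_near.
Qed.

(** Terms with g j <= x pay x^p; the at most y others pay D^p. *)
Lemma sum_powR_le (R : realType) (n : nat) (g : 'I_n -> R) (x y D p : R) :
  0 <= p -> 0 <= x -> (forall j, 0 <= g j <= D) ->
  #|[pred j | x < g j]|%:R <= y ->
  \sum_j g j `^ p <= n%:R * x `^ p + y * D `^ p.
Proof.
move=> p0 x0 hg hy.
have h : \sum_j g j `^ p <= \sum_j (x `^ p + (x < g j)%R%:R * D `^ p).
  apply: ler_sum => j _; have /andP[g0 gD] := hg j.
  have D0 : 0 <= D := le_trans g0 gD.
  have [xg|gx] := ltrP x (g j).
    by rewrite mul1r ler_wpDl ?powR_ge0// ge0_ler_powR ?nnegrE.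
  by rewrite mul0r addr0 ge0_ler_powR ?nnegrE.
apply: le_trans h _; rewrite big_split/= sumr_const card_ord -[x `^ p *+ n]mulr_natl.
rewrite -mulr_suml lerD2l ler_wpM2r ?powR_ge0//; apply: le_trans hy.
by rewrite -natr_sum ler_nat -big_mkcond/= sum1_card.
Qed.

Lemma with_prob_1_o1_sub (R : realType) (E : random_matrices R)
    (A B : forall n, set (rm_space E n)) :
  (\forall n \near \oo, A n `<=` B n) -> with_prob_1_o1 A -> with_prob_1_o1 B.
Proof.
move=> sAB [q [q0 hq]]; exists q; split=> //.
apply: filterS2 sAB hq => n sn [G [mG GA PG]].
by exists G; split=> //; exact: subset_trans sn.
Qed.

Lemma lip_is_derive (R : realType) (f df : R -> R) :
  (forall x : R, is_derive x (1 : R) f (df x)) -> (forall x, `|df x| <= 1) ->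
  forall s t, `|f s - f t| <= `|s - t|.
Proof.
move=> fd df1 s t; wlog ts : s t / t <= s.
  move=> h; case: (leP t s) => [ts|/ltW st]; first exact: h.
  by move: (h _ _ st); rewrite distrC (distrC t).
have [|c _ ->] := @MVT_segment _ f df t s ts (fun x _ => fd x).
  apply: continuous_subspaceT => x; apply: differentiable_continuous.
  by apply/derivable1_diffP; exact: ex_derive.
by rewrite normrM ler_piMl.
Qed.

Lemma expi_lip (R : realType) (s t : R) :
  cabs (expi s - expi t) <= 2 * `|s - t|.
Proof.
apply: le_trans (cabs_le_ReIm _) _; rewrite ReB ImB/= mulr_natl mulr2n.
apply: lerD.
  by apply: lip_is_derive => x; rewrite normrN ler_norml sin_geN1 sin_le1.
by apply: lip_is_derive => x; rewrite ler_norml cos_geN1 cos_le1.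
Qed.

Lemma expi_exprz (R : realType) (t : R) (e : int) : expi t ^ e = expi (e%:~R * t).
Proof.
case: e => m; first by rewrite -exprnP expiX.
by rewrite NegzE -exprz_inv expiV -exprnP expiX mulrN mulrNz mulNr.
Qed.

(** A frequency j contributes |a_j| |j| times the Lipschitz constant 2 of [expi], and |j| <= k. *)
Lemma symbol_lip (R : realType) (k : nat) (a : int -> R[i]) (s t : R) :
  cabs (symbol_fun k a (expi s) - symbol_fun k a (expi t)) <=
  2 * k%:R * symbol_l1 k a * `|s - t|.
Proof.
rewrite /symbol_fun -sumrB; apply: le_trans (cabs_sum _ _ _) _.
rewrite -mulrA mulrCA mulr_suml; apply: ler_sum => i _.
rewrite -mulrBr cabsM ler_wpM2l ?cabs_ge0// !expi_exprz.
apply: le_trans (expi_lip _ _) _.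
rewrite -mulrBr normrM mulrA ler_wpM2r// ler_wpM2l//.
rewrite -intr_norm (pmulrn 1) ler_int.
by have := ltn_ord i; lia.
Qed.

(** With x = n^(-tau) <= 1 and p >= 1, x^p <= x, so close pairs and exceptional pairs both
    contribute O(x) to the mean; the p-th root turns this into n^(-tau/p). *)
Lemma min_matching_cost_le (R : realType) (k : nat) (a : int -> R[i])
    (C D tau p : R) (n : nat) (B : 'M[R[i]]_n) :
  (0 < n)%N -> 0 <= C -> 0 <= tau -> 1 <= p ->
  well_matched k a C D tau B ->
  min_matching_cost p (symbol_fun k a) B <=
  (C `^ p + C * (D + symbol_l1 k a) `^ p) `^ p^-1 * n%:R `^ (- (tau / p)).
Proof.
move=> n0 C0 t0 p1 [hD [q hq]].
have nR : 0 < n%:R :> R by rewrite ltr0n.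
have p0 : 0 < p by exact: lt_le_trans p1.
(* The cost uses omega^(s j + 1), so the matching is composed with the inverse of the cyclic
   successor; wrapping around is harmless as omega^n = 1. *)
pose s : 'S_n := (q * (perm (@ordS_inj n))^-1)%g.
have sE j : omega R n ^+ (s j).+1 = omega R n ^+ q j.
  rewrite -(prim_expr_mod (omega_prim R n0)).
  have -> : ((s j).+1 %% n = ordS (s j))%N by [].
  by rewrite -(permE (@ordS_inj n)) /s permM permKV.
apply: le_trans (bigmin_le _ s _) _; rewrite /matching_cost.
under eq_bigr do rewrite sE.
set x := n%:R `^ (- tau) in hq *.
have x0 : 0 <= x by exact: powR_ge0.
have x1 : x <= 1.
  by rewrite -(powRr0 n%:R) ler_powR ?ler1n// oppr_le0.
have -> : n%:R `^ (- (tau / p)) = x `^ p^-1 by rewrite -powRrM mulNr.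
have E0 : 0 <= (D + symbol_l1 k a) `^ p by exact: powR_ge0.
rewrite -powRM ?addr_ge0 ?mulr_ge0 ?powR_ge0//.
apply: ge0_ler_powR; rewrite ?nnegrE ?invr_ge0 ?(ltW p0)//.
- by rewrite mulr_ge0 ?invr_ge0// sumr_ge0// => j _; exact: powR_ge0.
- by rewrite mulr_ge0 ?addr_ge0 ?mulr_ge0 ?powR_ge0.
rewrite ler_pdivrMl//.
have hg (j : 'I_n) : 0 <= cabs (eigval B j - symbol_fun k a (omega R n ^+ q j)) <= D + symbol_l1 k a.
  rewrite cabs_ge0; apply: le_trans (cabsD _ _) _; rewrite cabsN lerD//.
  by apply: cabs_symbol_fun; rewrite cabsX cabs_omega expr1n.
apply: le_trans (sum_powR_le (ltW p0) (mulr_ge0 C0 x0) hg hq) _.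
rewrite mulrDl mulrDr lerD//.
  rewrite ler_pM2l// powRM// ler_wpM2l ?powR_ge0//.
  rewrite /x -powRrM ler_powR ?ler1n//.
  by rewrite mulNr lerN2 ler_peMr.
by rewrite le_eqVlt; apply/orP; left; apply/eqP; ring.
Qed.

(** * Wasserstein distance *)

Lemma measurable_cabs_sub (R : realType) :
  measurable_fun setT (fun x : (R * R) * (R * R) =>
    cabs (of_plane x.1 - of_plane x.2)).
Proof.
rewrite (_ : (fun x => _) = (fun x : (R * R) * (R * R) =>
    Num.sqrt ((x.1.1 - x.2.1) ^+ 2 + (x.1.2 - x.2.2) ^+ 2))); last first.
  by apply/funext => -[[x1 y1] [x2 y2]].
apply: (measurableT_comp (f := @Num.sqrt R)).
  by apply: continuous_measurable_fun; exact: sqrt_continuous.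
have m1 := @measurable_fst _ _ (R * R)%type (R * R)%type.
have m2 := @measurable_snd _ _ (R * R)%type (R * R)%type.
by apply: measurable_funD; apply: measurable_funX; apply: measurable_funB;
  (apply: (measurableT_comp (f := fst)) || apply: (measurableT_comp (f := snd))).
Qed.

Lemma of_planeK (R : realType) : cancel (@to_plane R) (@of_plane R).
Proof. by case. Qed.

(** Half-open, so that each t has at most one index; it parametrizes the arc from omega_n^i to
    omega_n^(i+1). *)
Definition arc (R : realType) (n i : nat) : set R :=
  `[i%:R / n%:R, i.+1%:R / n%:R[%classic.

Lemma measurable_arc (R : realType) (n i : nat) :
  measurable (@arc R n i : set (measurableTypeR R)).
Proof. exact: measurable_itv. Qed.

Lemma arc_inj (R : realType) (n i j : nat) (t : R) : (0 < n)%N ->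
  arc n i t -> arc n j t -> i = j.
Proof.
move=> n0; have nR : 0 < n%:R :> R by rewrite ltr0n.
rewrite /arc/= !in_itv/= => /andP[i1 i2] /andP[j1 j2].
have := le_lt_trans i1 j2; have := le_lt_trans j1 i2.
by rewrite !ltr_pM2r ?invr_gt0// !ltr_nat; clear; lia.
Qed.

Lemma uniform_arc (R : realType) (n i : nat) : (i < n)%N ->
  uniform_prob (@ltr01 R) (arc n i) = (n%:R^-1)%:E.
Proof.
move=> ni; have n0 : (0 < n)%N by apply: leq_ltn_trans ni.
have nR : 0 < n%:R :> R by rewrite ltr0n.
rewrite /uniform_prob.
rewrite (eq_integral (cst 1%E)).
  rewrite integral_cst//; last exact: measurable_arc.
  rewrite mul1e; apply: (eq_trans (lebesgue_measure_itv `[i%:R / n%:R, i.+1%:R / n%:R[)).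
  rewrite /= lte_fin ltr_pM2r ?invr_gt0// ltr_nat ltnSn.
  by rewrite -EFinB -mulrBl -natrB// subSnn mul1r.
move=> x; rewrite inE /arc/= in_itv/= => /andP[x1 x2].
rewrite /uniform_pdf; case: ifPn => [_|]; first by rewrite subr0 invr1.
rewrite negb_and -!ltNge => /orP[h|h]; exfalso; move: h; apply/negP; rewrite -leNgt.
  by apply: le_trans x1; rewrite divr_ge0.
by apply/ltW/(lt_le_trans x2); rewrite ler_pdivrMr// mul1r ler_nat.
Qed.

(** P lives on the whole line. The n disjoint masses 1/n add up to 1, so the complement of the arcs
    is null and S splits along them. *)
Lemma measure_arcs (R : realType) (P : probability (measurableTypeR R) R) (n : nat)
    (S : set (measurableTypeR R)) :
  (0 < n)%N -> (forall i, (i < n)%N -> P (arc n i) = (n%:R^-1)%:E) -> measurable S ->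
  [/\ P S = (\sum_(i < n) P (S `&` arc n i))%E,
    measurable (\big[setU/set0]_(i < n) (arc n i : set (measurableTypeR R))) &
    P (~` \big[setU/set0]_(i < n) arc n i) = 0%E].
Proof.
move=> n0 hP mS.
have triv V : trivIset setT (fun i : nat => V `&` @arc R n i).
  by move=> i j _ _ [t [[_ ti] [_ tj]]]; exact: arc_inj n0 ti tj.
pose U : set (measurableTypeR R) := \big[setU/set0]_(i < n) @arc R n i.
have mU : measurable U.
  by apply: bigsetU_measurable => i _; exact: measurable_arc.
have PU : P U = 1%E.
  rewrite /U (measure_bigsetU P (F := @arc R n)).
  - rewrite (eq_bigr (fun=> (n%:R^-1)%:E)); last by move=> i _; exact: hP.
    by rewrite sumEFin sumr_const card_ord -[X in X%:E]mulr_natl mulfV// pnatr_eq0 -lt0n.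
  - by move=> i; exact: measurable_arc.
  - by have := triv setT; under eq_fun do rewrite setTI.
have PC0 : P (~` U) = 0%E by rewrite probability_setC// PU subee.
split; [|exact: mU|exact: PC0].
have PC : P (S `\` U) = 0%E.
  apply: (subset_measure0 (B := ~` U)) => //.
  - exact: measurableD.
  - exact: measurableC.
rewrite -(measure_bigsetU P (F := fun i => S `&` @arc R n i)); first last.
- exact: triv.
- by move=> i; apply: measurableI => //; exact: measurable_arc.
have -> : \big[setU/set0]_(i < n) (S `&` @arc R n i) = S `&` U.
  by rewrite /U big_distrr.
by rewrite (measureDI P mS mU) [X in (X + _)%E]PC add0e.
Qed.

(** Written with indicators so that measurability is immediate; its value off the arcs is
    immaterial. *)
Definition arc_step (R : realType) (n : nat) (w : 'I_n -> R[i])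
    (t : measurableTypeR R) : R * R :=
  (\sum_(i < n) complex.Re (w i) * \1_(arc n i) t,
   \sum_(i < n) complex.Im (w i) * \1_(arc n i) t).

Lemma arc_step_arc (R : realType) (n : nat) (w : 'I_n -> R[i]) (i : 'I_n) (t : R) :
  arc n i t -> arc_step w t = to_plane (w i).
Proof.
move=> ti; have n0 : (0 < n)%N by apply: leq_ltn_trans (ltn_ord i).
suff h (c : 'I_n -> R) : \sum_(j < n) c j * \1_(arc n j) t = c i.
  by rewrite /arc_step !h.
rewrite (bigD1 i)//= big1 ?addr0.
  by rewrite indicE mem_set// mulr1.
move=> j ji; rewrite indicE memNset ?mulr0// => tj.
by case/negP: ji; apply/eqP/val_inj; exact: arc_inj n0 tj ti.
Qed.

Lemma measurable_arc_step (R : realType) (n : nat) (w : 'I_n -> R[i]) :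
  measurable_fun setT (arc_step w).
Proof.
by apply: measurable_fun_pair => /=; apply: measurable_sum => i;
  apply: measurable_funM => //; apply: measurable_indic; exact: measurable_arc.
Qed.

Lemma arc_cover (R : realType) (n : nat) (t : R) :
  ~ (\big[setU/set0]_(i < n) arc n i) t \/ exists i : 'I_n, arc n i t.
Proof.
have [h|h] := pselect (exists i : 'I_n, arc n i t); [by right|left].
rewrite -bigcup_mkord => -[i /= ni ti]; apply: h.
by exists (Ordinal ni).
Qed.

Lemma integral_arcs_le (R : realType) (P : probability (measurableTypeR R) R) (n : nat)
    (g : measurableTypeR R -> R) (c : 'I_n -> R) :
  (0 < n)%N -> (forall i, (i < n)%N -> P (arc n i) = (n%:R^-1)%:E) ->
  measurable_fun setT g -> (forall t, 0 <= g t) -> (forall i, 0 <= c i) ->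
  (forall (i : 'I_n) t, arc n i t -> g t <= c i) ->
  (\int[P]_t (g t)%:E <= (n%:R^-1 * \sum_(i < n) c i)%:E)%E.
Proof.
move=> n0 hP mg g0 c0 gc.
have [_ mU PU] := measure_arcs n0 hP measurableT.
set U := \big[setU/set0]_(i < n) _ in mU PU.
have mg' : measurable_fun setT (EFin \o g) by exact/measurable_EFinP.
rewrite (@ge0_negligible_integral _ _ _ P setT (~` U))//; first last.
- by move=> t _; rewrite lee_fin.
- exact: measurableC.
rewrite setTD setCK.
have mc (i : 'I_n) : measurable_fun U (fun t : measurableTypeR R => (c i * \1_(arc n i) t)%:E).
  apply/measurable_EFinP; apply: measurable_funM => //.
  by apply: measurable_indic; exact: measurable_arc.
have c1 (i : 'I_n) (t : measurableTypeR R) : (0 <= (c i * \1_(arc n i) t)%:E)%E.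
  by rewrite lee_fin mulr_ge0.
apply: (@le_trans _ _ (\int[P]_(t in U) \sum_(i < n) (c i * \1_(arc n i) t)%:E)%E).
  apply: ge0_le_integral => //.
  - by move=> t _; rewrite lee_fin.
  - exact: measurable_funTS.
  - exact: emeasurable_sum.
  move=> t Ut; case: (@arc_cover R n t) => [//|[i ti]].
  rewrite (bigD1 i)//= indicE mem_set// mulr1.
  rewrite -[leLHS]adde0; apply: leeD; first by rewrite lee_fin gc.
  by apply: sume_ge0 => j _; exact: c1.
rewrite ge0_integral_sum// mulr_sumr -sumEFin; apply: lee_sum => i _.
have mi := @measurable_arc R n i.
under eq_integral do rewrite EFinM.
rewrite ge0_integralZl ?lee_fin//; last first.
  by apply/measurable_EFinP; exact: measurable_indic.
rewrite integral_indic// mulrC EFinM lee_wpmul2l ?lee_fin// -(hP i)//.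
by apply: le_measure; rewrite ?inE//; exact: measurableI.
Qed.

(** Both marginals are images of the same t. The first is the empirical measure because each arc has
    mass 1/n and q only permutes the eigenvalues. *)
Lemma W1_le (R : realType) (k : nat) (a : int -> R[i]) (n : nat) (B : 'M[R[i]]_n)
    (q : 'S_n) : (0 < n)%N ->
  (W1 (empirical_measure B) (symbol_law k a) <=
   (n%:R^-1 * \sum_(i < n) (cabs (eigval B (q i) - symbol_fun k a (omega R n ^+ i)) +
      4 * pi * k%:R * symbol_l1 k a / n%:R))%:E)%E.
Proof.
move=> n0; have nR : 0 < n%:R :> R by rewrite ltr0n.
pose P : probability (measurableTypeR R) R := uniform_prob (@ltr01 R).
have Parc i : (i < n)%N -> P (arc n i) = (n%:R^-1)%:E by exact: uniform_arc.
pose w (i : 'I_n) := eigval B (q i).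
pose h (t : measurableTypeR R) := (arc_step w t, symbol_circle k a t).
have mh : measurable_fun setT h.
  by apply: measurable_fun_pair; [exact: measurable_arc_step|exact: measurable_symbol_circle].
pose hm : {mfun measurableTypeR R >-> ((R * R) * (R * R))%type} := mfun_Sub (mem_set mh).
pose Q : probability ((R * R) * (R * R))%type R := distribution P hm.
apply: (@le_trans _ _ (\int[Q]_x (cabs (of_plane x.1 - of_plane x.2))%:E)%E).
  apply: ereal_inf_lbound; exists Q => //= V mV; split.
    have mS : measurable (arc_step w @^-1` V).
      by rewrite -[X in measurable X]setTI; exact: measurable_arc_step.
    have -> : Q (V `*` setT) = P (arc_step w @^-1` V).
      congr (P _); apply/seteqP; split=> t /=; first by case.
      by move=> ?; split.
    have [-> _ _] := measure_arcs n0 Parc mS.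
    have -> : empirical_measure B V =
        ((n%:R^-1)%:E * \sum_(i < n) \d_(to_plane (eigval B i)) V)%E by [].
    rewrite ge0_sume_distrr//.
    rewrite [RHS](reindex_inj (@perm_inj _ q))/=; apply: eq_bigr => i _.
    rewrite diracE; have [wV|wV] := pselect (V (to_plane (w i))).
      rewrite mem_set// mule1 -(Parc i (ltn_ord i)); congr (P _).
      apply/seteqP; split=> t /=; first by case.
      by move=> ti; split=> //; rewrite (arc_step_arc w ti).
    rewrite memNset// mule0 (_ : _ `&` _ = set0) ?measure0//.
    by apply/seteqP; split=> t //= -[]; rewrite /preimage/= => + ti; rewrite (arc_step_arc w ti).
  congr (P _); apply/seteqP; split=> t /=; first by case.
  by move=> ?; split.
have mc := @measurable_cabs_sub R.
rewrite /Q (@ge0_integral_distribution _ _ _ _ _ P hm (fun x => (cabs (of_plane x.1 - of_plane x.2))%:E)); first last.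
- by move=> x; rewrite lee_fin cabs_ge0.
- exact/measurable_EFinP.
apply: (integral_arcs_le (g := fun t => cabs (of_plane (h t).1 - of_plane (h t).2)) n0 Parc).
- exact: (measurableT_comp mc mh).
- by move=> t; exact: cabs_ge0.
- move=> i; rewrite addr_ge0 ?cabs_ge0// divr_ge0// mulr_ge0 ?symbol_l1_ge0//.
  by rewrite !mulr_ge0// pi_ge0.
move=> i t ti.
change (cabs (of_plane (arc_step w t) - of_plane (symbol_circle k a t)) <=
  cabs (w i - symbol_fun k a (omega R n ^+ i)) + 4 * pi * k%:R * symbol_l1 k a / n%:R).
rewrite (arc_step_arc w ti) /symbol_circle !of_planeK.
set x := symbol_fun k a (omega R n ^+ i).
have -> : w i - symbol_fun k a (expi (2 * pi * t)) =
  (w i - x) + (x - symbol_fun k a (expi (2 * pi * t))) by rewrite addrA subrK.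
apply: le_trans (cabsD _ _) _; rewrite lerD2l /x /omega expiX.
apply: le_trans (symbol_lip _ _ _ _) _.
(* The Lipschitz constant of the symbol times 2 pi / n, the angular length of an arc. *)
have -> : 4 * pi * k%:R * symbol_l1 k a / n%:R = (2 * k%:R * symbol_l1 k a) * (2 * pi / n%:R) by ring.
rewrite ler_wpM2l ?mulr_ge0 ?symbol_l1_ge0//.
have -> : i%:R * (2 * pi / n%:R) - 2 * pi * t = 2 * pi * (i%:R / n%:R - t) :> R by ring.
rewrite normrM ger0_norm ?mulr_ge0 ?pi_ge0// ler_wpM2l ?mulr_ge0 ?pi_ge0//.
move: ti; rewrite /arc/= in_itv/= => /andP[t1 t2].
rewrite distrC ger0_norm ?subr_ge0// lerBlDl; apply: ltW; apply: lt_le_trans t2 _.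
by rewrite -natr1 mulrDl mul1r.
Qed.

Lemma W1_well_matched_le (R : realType) (k : nat) (a : int -> R[i])
    (C D tau : R) (n : nat) (B : 'M[R[i]]_n) :
  (0 < n)%N -> 0 <= C -> tau <= 1 ->
  well_matched k a C D tau B ->
  (W1 (empirical_measure B) (symbol_law k a) <=
   ((C + C * (D + symbol_l1 k a) + 4 * pi * k%:R * symbol_l1 k a) *
     n%:R `^ (- tau))%:E)%E.
Proof.
move=> n0 C0 t1 [hD [q hq]].
have nR : 0 < n%:R :> R by rewrite ltr0n.
apply: le_trans (W1_le k a B q^-1 n0) _; rewrite lee_fin ler_pdivrMl//.
rewrite big_split/= sumr_const card_ord -[_ *+ n]mulr_natl mulrC mulfVK ?gt_eqF//.
set x := n%:R `^ (- tau) in hq *.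
set L := 4 * pi * k%:R * symbol_l1 k a.
have L0 : 0 <= L by rewrite mulr_ge0 ?symbol_l1_ge0// !mulr_ge0// pi_ge0.
have x0 : 0 <= x by exact: powR_ge0.
rewrite (reindex_inj (@perm_inj _ q))/=; under eq_bigr do rewrite permK.
have hg (j : 'I_n) : 0 <= cabs (eigval B j - symbol_fun k a (omega R n ^+ q j)) <= D + symbol_l1 k a.
  rewrite cabs_ge0; apply: le_trans (cabsD _ _) _; rewrite cabsN lerD//.
  by apply: cabs_symbol_fun; rewrite cabsX cabs_omega expr1n.
have D0 : 0 <= D + symbol_l1 k a.
  by have /andP[h1 h2] := hg (Ordinal n0); exact: le_trans h2.
have hs := sum_powR_le ler01 (mulr_ge0 C0 x0) hg hq.
rewrite (eq_bigr _ (fun j _ => powRr1 (cabs_ge0 _))) !powRr1 ?mulr_ge0// in hs.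
(* Since tau <= 1, the discretization error of order 1/n is absorbed into n^(-tau). *)
have nx : 1 <= n%:R * x.
  rewrite /x -{1}(powRr1 (ltW nR)) -powRD ?(gt_eqF nR) ?implybT//.
  by rewrite -[leLHS](powRr0 n%:R) ler_powR ?ler1n// subr_ge0.
have : L <= L * (n%:R * x) by rewrite ler_peMr.
move=> hL; rewrite [leRHS](_ : _ = n%:R * (C * x) + C * (n%:R * x) * (D + symbol_l1 k a) + L * (n%:R * x)).
  exact: lerD.
by ring.
Qed.

Theorem theorem4p1 (R : realType) (k : nat) (a : int -> R[i])
  (eps0 c0 : R) (Ka : R -> R)
  (eps0_gt0 : 0 < eps0) (c0_ge1 : 1 <= c0)
  (assumption_a : forall eps' : R, 0 < eps' <= eps0 ->
     bigO_with (Ka eps')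
       (fun n => ereal_sup
          [set ((rect_count (symbol_fun k a) c0 eps' n z)%:R : R)%:E
          | z in [set: R[i]]])
       (fun n => n%:R `^ (1 - 3 * eps')))
  (gam del M alp kap Ki Kii : R)
  (gam_gt0 : 0 < gam) (del_gt0 : 0 < del)
  (M_gt0 : 0 < M) (alp_ge0 : 0 <= alp) (kap_gt0 : 0 < kap) :
  let beta := Num.sqrt 2 * (symbol_l1 k a + M + 1) in
  let assumption_i (E : random_matrices R) :=
    with_prob_1_bigO Ki del
      (fun n => [set t : rm_space E n |
                 spectral_norm (rm_mx t) <= M * n%:R `^ alp]) in
  let assumption_ii (E : random_matrices R) :=
    bigO_with Kii
      (fun n => ereal_sup
         [set rm_prob E n [set t |
                sigma_min (perturbed k a alp gam t - z%:M)
                <= n%:R `^ (- kap)]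
         | z in [set z : R[i] | cabs z <= beta]])
      (fun n => n%:R `^ (- del)) in
  (forall p : R, 1 <= p ->
     exists C eps : R, [/\ 0 < C, 0 < eps &
       forall E : random_matrices R, assumption_i E -> assumption_ii E ->
         with_prob_1_o1
           (fun n => [set t : rm_space E n |
              min_matching_cost p (symbol_fun k a) (perturbed k a alp gam t)
              <= C * n%:R `^ (- eps)])]) /\
  (exists C eps : R, [/\ 0 < C, 0 < eps &
     forall E : random_matrices R, assumption_i E -> assumption_ii E ->
       with_prob_1_o1
         (fun n => [set t : rm_space E n |
            (W1 (empirical_measure (perturbed k a alp gam t)) (symbol_law k a)
             <= (C * n%:R `^ (- eps))%:E)%E])]).
Proof.
(* These constants serve every p and the Wasserstein bound: for n >= 1 both conclusions hold
   pointwise on the event [well_matched]. *)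
have [C [tau [C0 tau0 tau1 hE]]] := well_matched_whp eps0_gt0 c0_ge1 assumption_a
  Ki Kii gam_gt0 del_gt0 M_gt0 alp_ge0 kap_gt0.
move=> beta assumption_i assumption_ii.
have ell0 := symbol_l1_ge0 k a.
have D0 : 0 <= symbol_l1 k a + M + symbol_l1 k a by rewrite !addr_ge0// ltW.
split=> [p p1|].
  have p0 : 0 < p by exact: lt_le_trans p1.
  exists ((C `^ p + C * (symbol_l1 k a + M + symbol_l1 k a) `^ p) `^ p^-1), (tau / p).
  split; [|by rewrite divr_gt0|].
    by rewrite powR_gt0// ltr_wpDr ?powR_gt0// mulr_ge0 ?powR_ge0// ltW.
  move=> E hi hii; apply: with_prob_1_o1_sub (hE E hi hii).
  near=> n; move=> t; apply: min_matching_cost_le => //; try exact: ltW.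
  by near: n; exists 1%N.
exists (C + C * (symbol_l1 k a + M + symbol_l1 k a) + 4 * pi * k%:R * symbol_l1 k a), tau.
split=> //.
  by rewrite ltr_wpDr ?mulr_ge0 ?pi_ge0// ltr_wpDr// mulr_ge0// ltW.
move=> E hi hii; apply: with_prob_1_o1_sub (hE E hi hii).
near=> n; move=> t; apply: W1_well_matched_le => //; try exact: ltW.
by near: n; exists 1%N.
Unshelve. all: by end_near.
Qed.
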